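(* Let $\mathfrak s$ be a transitive semisimple graded $CR$ algebra. Let $\mathfrak l$ be a nondegenerate transitive $CR$ graded $\mathfrak s$-module for which the Levi--Tanaka extension is defined. Then the Levi--Tanaka extension $\mathfrak g$ of $\mathfrak s$ by $\mathfrak l$ has the $J$ property, i.e. there is an element $J_{\mathfrak g}\in\mathfrak g$ such that $[J_{\mathfrak g},X]=JX$ for all $X\in\mathfrak g_{-1}=\mathfrak s_{-1}\oplus\mathfrak l_{-1}$.
   Context: Lie algebras and modules are real and finite dimensional. A gradation of a module $\mathfrak l$ over a $\mathbb Z$-graded Lie algebra $\mathfrak s=\bigoplus_p\mathfrak s_p$ is a decomposition $\mathfrak l=\bigoplus_{p\in\mathbb Z}\mathfrak l_p$ with $[\mathfrak s_p,\mathfrak l_q]\subset\mathfrak l_{p+q}$, where $[X,Y]=X\cdot Y$. The Abelian extension $\mathfrak s\oplus\mathfrak l$ has the bracket of $\mathfrak s$, $[X,Y]=X\cdot Y$ for $X\in\mathfrak s,Y\in\mathfrak l$, and $[\mathfrak l,\mathfrak l]=0$. For graded $\mathfrak a$: $\mathfrak a_-=\bigoplus_{p<0}\mathfrak a_p$. A graded module $\mathfrak l$ is transitive if $[\mathfrak s_{-1},Y]\ne\{0\}$ for all $Y\in\mathfrak l_p\setminus\{0\}$, $p\ge0$; nondegenerate if $[\mathfrak s_{-1},Y]\neq\{0\}$ for all $Y\in\mathfrak l_{-1}\setminus\{0\}$; fundamental if $\mathfrak l_{p-1}=[\mathfrak s_{-1},\mathfrak l_p]$ for all $p<0$. A graded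 Lie algebra has one of these properties if its adjoint module does. A graded $CR$ algebra is a graded real Lie algebra $\mathfrak s$ with a linear $J:\mathfrak s_{-1}\to\mathfrak s_{-1}$ such that $J^2=-\mathrm{Id}$, $[JX,JY]=[X,Y]$ for $X,Y\in\mathfrak s_{-1}$, and $[A,JX]=J[A,X]$ for $A\in\mathfrak s_0,X\in\mathfrak s_{-1}$. A graded $\mathfrak s$-module $\mathfrak l$ is $CR$ if a complex structure $J$ is given on $\mathfrak l_{-1}$ making $\mathfrak s\oplus\mathfrak l$ a graded $CR$ algebra. Levi--Tanaka algebra: for a fundamental nondegenerate graded $CR$ algebra $\mathfrak m=\bigoplus_{p<0}\mathfrak m_p$, $\mathfrak g(\mathfrak m)=\bigoplus_p\mathfrak g_p$ is its maximal transitive $CR$ prolongation: $\mathfrak g_p=\mathfrak m_p$ for $p<0$; $\mathfrak g_0$ = degree $0$ derivations of $\mathfrak m$ commuting with $J$ on $\mathfrak m_{-1}$; for $p>0$ recursively $\mathfrak g_p$ = degree $p$ homogeneous derivations $\mathfrak m\to\bigoplus_{q<p}\mathfrak g_q$, with $[A,X]=A(X)$ for $A\in\mathfrak g_p$ ($p\ge 0$), $X\in\mathfrak m$, and brackets in nonnegative degrees determined by $[[A,B],X]=[A,[B,X]]-[B,[A,X]]$. Levi--Tanaka extension: it is defined when $\mathfrak s$ is a semisimple graded $CR$ algebra and $\mathfrak l$ a graded transitive $CR$ $\mathfrak s$-module such that $\mathfrak s\oplus\mathfrak l$ is fundamental and nondegenerate. The Levi--Tanaka extension of $\mathfrak s$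 by $\mathfrak l$ is $\mathfrak g=\mathfrak g(\mathfrak s\oplus\mathfrak l):=\mathfrak g(\mathfrak s_-\oplus\mathfrak l_-)$; $\mathfrak s\oplus\mathfrak l$ is a graded subalgebra of $\mathfrak g$. *)

(* Defs.v *)
From HB Require Import structures.
From mathcomp Require Import all_boot all_order all_algebra.
From mathcomp Require Import boolp classical_sets reals.

Set Implicit Arguments.
Unset Strict Implicit.
Unset Printing Implicit Defensive.

Import Order.TTheory GRing.Theory Num.Theory.
Local Open Scope classical_set_scope.
Local Open Scope ring_scope.

Definition lspan (K : fieldType) (V : lmodType K) (A : set V) : set V :=
  [set x | exists2 r : seq (K * V), (forall z, z \in r -> A z.2)
           & x = \sum_(z <- r) z.1 *: z.2].

Section Lspan.
Variable K : fieldType.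

Lemma lspan0 (V : lmodType K) (A : set V) : lspan A 0.
Proof. by exists [::] => //; rewrite big_nil. Qed.

Lemma lspan_lin (V : lmodType K) (A : set V) a x y :
  lspan A x -> lspan A y -> lspan A (a *: x + y).
Proof.
move=> [r rA ->] [t tA ->]; exists ([seq (a * z.1, z.2) | z <- r] ++ t).
  by move=> z; rewrite mem_cat => /orP[/mapP[w wr ->]|/tA//]; exact: rA wr.
rewrite big_cat big_map scaler_sumr; congr (_ + _).
by apply: eq_bigr => z _; rewrite scalerA.
Qed.

Lemma lspan_sub (V : lmodType K) (A : set V) x : A x -> lspan A x.
Proof.
move=> Ax; exists [:: (1, x)]; last by rewrite big_seq1 scale1r.
by move=> z; rewrite inE => /eqP ->.
Qed.

Lemma lspan_ind (V : lmodType K) (A P : set V) :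
    P 0 -> (forall a x y, A x -> lspan A y -> P y -> P (a *: x + y)) ->
  forall x, lspan A x -> P x.
Proof.
move=> P0 PS x [r rA ->]; elim: r rA => [|z r IH] rA; first by rewrite big_nil.
have rA' w : w \in r -> A w.2 by move=> wr; apply: rA; rewrite inE wr orbT.
rewrite big_cons; apply: PS; [|by exists r|exact: IH].
by apply: rA; rewrite inE eqxx.
Qed.

End Lspan.

Lemma pairP (A B : Type) (u v : A * B) : u.1 = v.1 -> u.2 = v.2 -> u = v.
Proof. by case: u v => [? ?] [? ?] /= -> ->. Qed.

Record lie_algebra (K : fieldType) (V : lmodType K) := LieAlgebra {
  br : V -> V -> V;
  br_linl : forall a X Y Z, br (a *: X + Y) Z = a *: br X Z + br Y Z;
  br_linr : forall a X Y Z, br X (a *: Y + Z) = a *: br X Y + br X Z;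
  br_alt : forall X, br X X = 0;
  br_jacobi : forall X Y Z,
    br X (br Y Z) + br Y (br Z X) + br Z (br X Y) = 0
}.

Record gradation (K : fieldType) (V : lmodType K) := Gradation {
  gr : int -> set V;
  gr0 : forall p, gr p 0;
  gr_lin : forall p a X Y, gr p X -> gr p Y -> gr p (a *: X + Y);
  gr_span : forall X, lspan [set Y | exists p, gr p Y] X;
  gr_free : forall (r : seq int) (f : int -> V), uniq r ->
    (forall p, gr p (f p)) -> \sum_(p <- r) f p = 0 ->
    forall p, p \in r -> f p = 0
}.

Record graded_lie (K : fieldType) (V : lmodType K) := GradedLie {
  gl_lie :> lie_algebra V;
  gl_gr :> gradation V;
  gl_br : forall p q X Y,
    gr gl_gr p X -> gr gl_gr q Y -> gr gl_gr (p + q) (br gl_lie X Y)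
}.

Record graded_module (K : fieldType) (V : lmodType K) (S : graded_lie V)
    (W : lmodType K) := GradedModule {
  act : V -> W -> W;
  act_linl : forall a X X' Y, act (a *: X + X') Y = a *: act X Y + act X' Y;
  act_linr : forall a X Y Y', act X (a *: Y + Y') = a *: act X Y + act X Y';
  act_br : forall X X' Y, act (br S X X') Y = act X (act X' Y) - act X' (act X Y);
  gm_gr :> gradation W;
  gm_act : forall p q X Y,
    gr S p X -> gr gm_gr q Y -> gr gm_gr (p + q) (act X Y)
}.

Section Properties.
Variables (K : fieldType) (V : lmodType K) (S : graded_lie V).

Definition transitive_module (W : lmodType K) (L : graded_module S W) : Prop :=
  forall p Y, 0 <= p -> gr L p Y -> Y <> 0 ->
  exists2 X, gr S (-1) X & act L X Y <> 0.

Definition nondegenerate_module (W : lmodType K) (L : graded_module S W) : Prop :=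
  forall Y, gr L (-1) Y -> Y <> 0 ->
  exists2 X, gr S (-1) X & act L X Y <> 0.

Definition fundamental_module (W : lmodType K) (L : graded_module S W) : Prop :=
  forall p, p < 0 ->
  gr L (p - 1) =
  lspan [set Z | exists X Y, [/\ gr S (-1) X, gr L p Y & Z = act L X Y]].

Lemma br_anti X Y : br S X Y = - br S Y X.
Proof.
apply/eqP; rewrite -addr_eq0; apply/eqP; move: (br_alt S (X + Y)).
have brDl A B C : br S (A + B) C = br S A C + br S B C.
  by rewrite -[A]scale1r br_linl !scale1r.
have brDr A B C : br S A (B + C) = br S A B + br S A C.
  by rewrite -[B]scale1r br_linr !scale1r.
by rewrite brDl !brDr !br_alt add0r addr0.
Qed.

Lemma adjoint_act_br X X' Y :
  br S (br S X X') Y = br S X (br S X' Y) - br S X' (br S X Y).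
Proof.
have brN A B : br S A (- B) = - br S A B.
  have H0 : br S A 0 = 0.
    have := br_linr S 1 A 0 0; rewrite !scale1r addr0 => /eqP.
    by rewrite -subr_eq0 opprD addNKr oppr_eq0 => /eqP.
  by have := br_linr S (-1) A B 0; rewrite !scaleN1r H0 !addr0.
have := br_jacobi S X X' Y.
rewrite (br_anti Y X) brN (br_anti Y (br S X X')) => /eqP.
by rewrite subr_eq0 => /eqP ->.
Qed.

Definition adjoint : graded_module S V :=
  GradedModule (br_linl S) (br_linr S) adjoint_act_br (@gl_br _ _ S).

Definition transitive_algebra : Prop := transitive_module adjoint.
Definition nondegenerate_algebra : Prop := nondegenerate_module adjoint.
Definition fundamental_algebra : Prop := fundamental_module adjoint.

End Properties.

Section Semisimple.
Variables (K : fieldType) (V : lmodType K) (A : lie_algebra V).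

Definition ideal (I : set V) : Prop :=
  [/\ I 0, forall a X Y, I X -> I Y -> I (a *: X + Y)
    & forall X Y, I Y -> I (br A X Y)].

Fixpoint derived_series (I : set V) (n : nat) : set V :=
  if n is n'.+1 then
    let D := derived_series I n' in
    lspan [set Z | exists X Y, [/\ D X, D Y & Z = br A X Y]]
  else I.

Definition solvable_subalgebra (I : set V) : Prop :=
  exists n, derived_series I n `<=` [set 0].

Definition semisimple : Prop :=
  forall I, ideal I -> solvable_subalgebra I -> I `<=` [set 0].

End Semisimple.

(* J is a function on the whole space, but only its restriction to the
   component of degree -1 is constrained and used. *)
Record is_cr (K : fieldType) (V : lmodType K) (S : graded_lie V) (J : V -> V)
    : Prop := IsCR {
  cr_stable : forall X, gr S (-1) X -> gr S (-1) (J X);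
  cr_lin : forall a X Y, gr S (-1) X -> gr S (-1) Y ->
    J (a *: X + Y) = a *: J X + J Y;
  cr_sqr : forall X, gr S (-1) X -> J (J X) = - X;
  cr_br : forall X Y, gr S (-1) X -> gr S (-1) Y ->
    br S (J X) (J Y) = br S X Y;
  cr_comm : forall A X, gr S 0 A -> gr S (-1) X ->
    br S A (J X) = J (br S A X)
}.

Record cr_algebra (K : fieldType) (V : lmodType K) := CRAlgebra {
  cr_gl :> graded_lie V;
  cr_J : V -> V;
  cr_axioms : is_cr cr_gl cr_J
}.

Section Extension.
Variables (K : fieldType) (V W : lmodType K).
Variables (S : graded_lie V) (L : graded_module S W).

Definition ext_br (x y : V * W) : V * W :=
  (br S x.1 y.1, act L x.1 y.2 - act L y.1 x.2).

Lemma act0r X : act L X 0 = 0.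
Proof.
have := act_linr L 1 X 0 0; rewrite !scale1r addr0 => /eqP.
by rewrite -subr_eq0 opprD addNKr oppr_eq0 => /eqP.
Qed.

Lemma act0l Y : act L 0 Y = 0.
Proof.
have := act_linl L 1 0 0 Y; rewrite !scale1r addr0 => /eqP.
by rewrite -subr_eq0 opprD addNKr oppr_eq0 => /eqP.
Qed.

Lemma actBr X Y Z : act L X (Y - Z) = act L X Y - act L X Z.
Proof. by rewrite addrC -scaleN1r act_linr scaleN1r addrC. Qed.

Lemma ext_linl a X Y Z : ext_br (a *: X + Y) Z = a *: ext_br X Z + ext_br Y Z.
Proof.
apply: pairP; first exact: br_linl.
rewrite /= act_linl act_linr scalerBr opprD.
by rewrite !addrA; congr (_ + _); rewrite addrAC.
Qed.

Lemma ext_linr a X Y Z : ext_br X (a *: Y + Z) = a *: ext_br X Y + ext_br X Z.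
Proof.
apply: pairP; first exact: br_linr.
rewrite /= act_linl act_linr scalerBr opprD.
by rewrite !addrA; congr (_ + _); rewrite addrAC.
Qed.

Lemma ext_alt X : ext_br X X = 0.
Proof. by apply: pairP; [exact: br_alt|exact: subrr]. Qed.

Lemma ext_jacobi X Y Z :
  ext_br X (ext_br Y Z) + ext_br Y (ext_br Z X) + ext_br Z (ext_br X Y) = 0.
Proof.
apply: pairP; first exact: br_jacobi.
rewrite /= !actBr !act_br.
set a := act L X.1 (act L Y.1 Z.2); set b := act L X.1 (act L Z.1 Y.2).
set c := act L Y.1 (act L Z.1 X.2); set d := act L Z.1 (act L Y.1 X.2).
set e := act L Y.1 (act L X.1 Z.2); set f := act L Z.1 (act L X.1 Y.2).
rewrite !opprB !addrA.
rewrite [LHS](ACl ((1*12)*(2*7)*(3*10)*(4*5)*(6*11)*(8*9)))/=.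
by rewrite !(subrr, addNr) !addr0.
Qed.

Definition ext_lie : lie_algebra (V * W)%type :=
  LieAlgebra ext_linl ext_linr ext_alt ext_jacobi.

Definition ext_comp (p : int) : set (V * W) :=
  [set z | gr S p z.1 /\ gr L p z.2].

Lemma ext_comp0 p : ext_comp p 0.
Proof. by split; exact: gr0. Qed.

Lemma ext_comp_lin p a X Y :
  ext_comp p X -> ext_comp p Y -> ext_comp p (a *: X + Y).
Proof. by move=> [? ?] [? ?]; split; apply: gr_lin. Qed.

Lemma ext_comp_span X : lspan [set Y | exists p, ext_comp p Y] X.
Proof.
case: X => x y; have -> : (x, y) = 1 *: (x, 0) + (0, y) :> (V * W)%type.
  by rewrite scale1r; apply: pairP; rewrite /= ?addr0 ?add0r.
apply: lspan_lin.
  move: x (gr_span S x); apply: lspan_ind => [|a x x' [p px] _ IH].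
    exact: lspan0.
  have -> : (a *: x + x', 0) = a *: (x, 0) + (x', 0) :> (V * W)%type.
    by apply: pairP; rewrite /= ?scaler0 ?addr0.
  by apply: lspan_lin => //; apply: lspan_sub; exists p; split => //; exact: gr0.
move: y (gr_span L y); apply: lspan_ind => [|a y y' [p py] _ IH].
  exact: lspan0.
have -> : (0, a *: y + y') = a *: (0, y) + (0, y') :> (V * W)%type.
  by apply: pairP; rewrite /= ?scaler0 ?addr0.
by apply: lspan_lin => //; apply: lspan_sub; exists p; split => //; exact: gr0.
Qed.

Lemma ext_comp_free (r : seq int) (f : int -> V * W) : uniq r ->
  (forall p, ext_comp p (f p)) -> \sum_(p <- r) f p = 0 ->
  forall p, p \in r -> f p = 0.
Proof.
move=> ur fP f0 p pr; apply: pairP.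
  apply: (gr_free (g := S) (f := fun p => (f p).1) ur) pr => [q|].
    by case: (fP q).
  by rewrite -(raddf_sum fst) f0.
apply: (gr_free (g := L) (f := fun p => (f p).2) ur) pr => [q|].
  by case: (fP q).
by rewrite -(raddf_sum snd) f0.
Qed.

Definition ext_gr : gradation (V * W)%type :=
  Gradation ext_comp0 ext_comp_lin ext_comp_span ext_comp_free.

Lemma ext_gr_br p q X Y :
  gr ext_gr p X -> gr ext_gr q Y -> gr ext_gr (p + q) (br ext_lie X Y).
Proof.
move=> [X1 X2] [Y1 Y2]; split; first exact: gl_br.
rewrite /= [X in gr _ _ X]addrC -scaleN1r.
by apply: gr_lin; [rewrite addrC|]; exact: gm_act.
Qed.

Definition extension : graded_lie (V * W)%type := GradedLie ext_gr_br.

End Extension.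

Record cr_module (K : fieldType) (V : lmodType K) (S : cr_algebra V)
    (W : lmodType K) := CRModule {
  cm_gm :> graded_module S W;
  cm_J : W -> W;
  cm_axioms : is_cr (extension cm_gm) (fun z => (cr_J S z.1, cm_J z.2))
}.

Definition cr_extension (K : fieldType) (V W : lmodType K) (S : cr_algebra V)
    (L : cr_module S W) : cr_algebra (V * W)%type :=
  CRAlgebra (cm_axioms L).

Section NegativePart.
Variables (K : fieldType) (V : lmodType K) (A : cr_algebra V).

Definition neg_homog : set V := [set X | exists2 p, p < 0 & gr A p X].

Definition neg_pred : {pred V} := [pred X | `[< lspan neg_homog X >]].

Lemma neg_submod : submod_closed neg_pred.
Proof.
split; first by apply/asboolP; exact: lspan0.
by move=> a X Y /asboolP HX /asboolP HY; apply/asboolP; exact: lspan_lin.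
Qed.

HB.instance Definition _ := GRing.isSubmodClosed.Build K V neg_pred neg_submod.

Record neg_part := NegPart { neg_val : V; _ : neg_val \in neg_pred }.

HB.instance Definition _ := [isSub of neg_part for neg_val].
HB.instance Definition _ := [Choice of neg_part by <:].
HB.instance Definition _ := [SubChoice_isSubLmodule of neg_part by <:].

Lemma neg_homogP p X : p < 0 -> gr A p X -> X \in neg_pred.
Proof. by move=> p0 pX; apply/asboolP/lspan_sub; exists p. Qed.

Lemma neg_br_closed (X Y : neg_part) : br A (val X) (val Y) \in neg_pred.
Proof.
have br0l Z : br A 0 Z = 0.
  have := br_linl A 1 0 0 Z; rewrite !scale1r addr0 => /eqP.
  by rewrite -subr_eq0 opprD addNKr oppr_eq0 => /eqP.
have br0r Z : br A Z 0 = 0 by rewrite br_anti br0l oppr0.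
move: (valP X) (valP Y) => /asboolP HX /asboolP HY; apply/asboolP.
move: (val X) HX; apply: lspan_ind => [|a x x' [p p0 px] _ IH].
  by rewrite br0l; exact: lspan0.
rewrite br_linl; apply: lspan_lin => {IH}//.
move: (val Y) HY; apply: lspan_ind => [|b y y' [q q0 qy] _ IH].
  by rewrite br0r; exact: lspan0.
rewrite br_linr; apply: lspan_lin => //; apply: lspan_sub.
exists (p + q); last exact: gl_br.
by rewrite -(addr0 0) ltrD.
Qed.

Definition neg_br (X Y : neg_part) : neg_part := NegPart (neg_br_closed X Y).

Lemma neg_linl a X Y Z : neg_br (a *: X + Y) Z = a *: neg_br X Z + neg_br Y Z.
Proof. by apply: val_inj; rewrite /= br_linl. Qed.

Lemma neg_linr a X Y Z : neg_br X (a *: Y + Z) = a *: neg_br X Y + neg_br X Z.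
Proof. by apply: val_inj; rewrite /= br_linr. Qed.

Lemma neg_alt X : neg_br X X = 0.
Proof. by apply: val_inj; rewrite /= br_alt. Qed.

Lemma neg_jacobi X Y Z :
  neg_br X (neg_br Y Z) + neg_br Y (neg_br Z X) + neg_br Z (neg_br X Y) = 0.
Proof. by apply: val_inj; rewrite /= br_jacobi. Qed.

Definition neg_lie : lie_algebra neg_part :=
  LieAlgebra neg_linl neg_linr neg_alt neg_jacobi.

(* For 0 <= p this is the zero subspace. *)
Definition neg_comp (p : int) : set neg_part := [set X | gr A p (val X)].

Lemma neg_comp0 p : neg_comp p 0.
Proof. exact: (gr0 A p). Qed.

Lemma neg_comp_lin p a X Y :
  neg_comp p X -> neg_comp p Y -> neg_comp p (a *: X + Y).
Proof. by move=> HX HY; rewrite /neg_comp /=; apply: gr_lin. Qed.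

Lemma neg_comp_span X : lspan [set Y | exists p, neg_comp p Y] X.
Proof.
have /asboolP [r rA rE] := valP X.
have [t tA tE] : exists2 t : seq (K * neg_part),
    (forall z, z \in t -> exists p, neg_comp p z.2) &
    \sum_(z <- r) z.1 *: z.2 = val (\sum_(z <- t) z.1 *: z.2).
  elim: r rA {rE} => [|[a x] r IH] rA.
    by exists [::] => //; rewrite !big_nil.
  have [|t tA tE] := IH; first by move=> z zr; apply: rA; rewrite inE zr orbT.
  have [|p p0 px] := rA (a, x); first by rewrite inE eqxx.
  exists ((a, NegPart (neg_homogP p0 px)) :: t); last by rewrite !big_cons /= tE.
  by move=> z; rewrite inE => /orP[/eqP -> /=|/tA //]; exists p.
by exists t => //; apply: val_inj; rewrite rE.
Qed.

Lemma neg_comp_free (r : seq int) (f : int -> neg_part) : uniq r ->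
  (forall p, neg_comp p (f p)) -> \sum_(p <- r) f p = 0 ->
  forall p, p \in r -> f p = 0.
Proof.
move=> ur fP f0 p pr; apply: val_inj.
apply: (gr_free (g := A) (f := fun p => val (f p)) ur) pr => [q|].
  exact: fP.
by rewrite -(raddf_sum val) f0.
Qed.

Definition neg_gr : gradation neg_part :=
  Gradation neg_comp0 neg_comp_lin neg_comp_span neg_comp_free.

Lemma neg_gr_br p q X Y :
  gr neg_gr p X -> gr neg_gr q Y -> gr neg_gr (p + q) (br neg_lie X Y).
Proof. exact: gl_br. Qed.

Definition neg_gl : graded_lie neg_part := GradedLie neg_gr_br.

(* insubd only matters outside degree -1, where cr_J is unconstrained. *)
Definition neg_J (X : neg_part) : neg_part :=
  insubd (0 : neg_part) (cr_J A (val X)).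

Lemma neg_JE X : gr A (-1) (val X) -> val (neg_J X) = cr_J A (val X).
Proof.
move=> HX; rewrite val_insubd (@neg_homogP (-1)) //.
exact: (cr_stable (cr_axioms A)).
Qed.

Lemma neg_cr : is_cr neg_gl neg_J.
Proof.
have cA := cr_axioms A; split.
- by move=> X HX; rewrite /= /neg_comp /= neg_JE //; exact: (cr_stable cA).
- move=> a X Y HX HY; apply: val_inj; rewrite /= !neg_JE //.
    exact: (cr_lin cA).
  exact: (gr_lin a HX HY).
- move=> X HX; apply: val_inj; rewrite /= !neg_JE //.
    exact: (cr_sqr cA).
  exact: (cr_stable cA).
- by move=> X Y HX HY; apply: val_inj; rewrite /= !neg_JE //; exact: (cr_br cA).
move=> B X HB HX; apply: val_inj; rewrite /= !neg_JE //.
  exact: (cr_comm cA).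
by rewrite /= -[(-1)]add0r; exact: gl_br.
Qed.

Definition negative_part : cr_algebra neg_part := CRAlgebra neg_cr.

End NegativePart.

Section LeviTanaka.
Variables (K : fieldType) (M G : lmodType K).
Variables (m : cr_algebra M) (g : cr_algebra G) (iota : M -> G).

(* Homogeneous derivations of degree p from m to g, where m acts on g through
   iota; for p = 0 they are moreover required to commute with J on m_(-1).
   Since D maps m_q into g_(q + p) and m lives in negative degrees, D takes its
   values in the sum of the g_q with q < p. *)
Definition cr_derivation (p : int) (D : M -> G) : Prop :=
  [/\ forall a X Y, D (a *: X + Y) = a *: D X + D Y,
      forall q X, gr m q X -> gr g (q + p) (D X),
      forall X Y, D (br m X Y) = br g (D X) (iota Y) + br g (iota X) (D Y)
    & p = 0 -> forall X, gr m (-1) X -> D (cr_J m X) = cr_J g (D X)].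

(* g is the Levi-Tanaka algebra g(m), up to the canonical identifications:
   iota identifies m with g_-, and A |-> [A, iota _] identifies g_p, 0 <= p,
   with the space of derivations of degree p. That [A, iota _] is such a
   derivation for each A in g_p, and that the brackets in nonnegative degrees
   are those of the recursive construction, follows from g being a graded CR
   algebra (Jacobi identity, gl_br, cr_comm). *)
Record is_levi_tanaka : Prop := IsLeviTanaka {
  lt_negative : forall p, 0 <= p -> gr m p `<=` [set 0];
  lt_fundamental : fundamental_algebra m;
  lt_nondegenerate : nondegenerate_algebra m;
  lt_linear : forall a X Y, iota (a *: X + Y) = a *: iota X + iota Y;
  lt_inj : injective iota;
  lt_br : forall X Y, iota (br m X Y) = br g (iota X) (iota Y);
  lt_neg : forall p, p < 0 -> gr g p = iota @` gr m p;
  lt_J : forall X, gr m (-1) X -> iota (cr_J m X) = cr_J g (iota X);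
  lt_prolong : forall p D, 0 <= p -> cr_derivation p D ->
    exists! A, gr g p A /\ (forall X, br g A (iota X) = D X)
}.

Definition J_property : Prop :=
  exists Jg, forall X, gr g (-1) X -> br g Jg X = cr_J g X.

End LeviTanaka.

Section LeviTanakaExtension.
Variables (K : fieldType) (V W : lmodType K) (S : cr_algebra V).
Variable L : cr_module S W.

Definition levi_tanaka_extension_defined : Prop :=
  [/\ semisimple S, transitive_module L,
      fundamental_algebra (cr_extension L)
    & nondegenerate_algebra (cr_extension L)].

Definition is_levi_tanaka_extension (G : lmodType K) (g : cr_algebra G)
    (iota : neg_part (cr_extension L) -> G) : Prop :=
  is_levi_tanaka (negative_part (cr_extension L)) g iota.

End LeviTanakaExtension.

(* Main.v *)
(* It suffices to extend [J] on [s_(-1) + l_(-1)] to a derivation [D] of degree 0 of the negative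
   part of [s + l]: since [D = J] in degree -1, [D] commutes with [J] and defines an element of
   [g_0].  [D] is built one degree at a time by [D [x, y] = [J x, y] + [x, D y]] for [x] in
   [s_(-1)].  This is consistent because no nonzero element of [s] or [l] of degree [<= -2] is
   annihilated by [s_1] (complete reducibility), provided that [D] interacts with [s_1] by
   [[a, D y] = D [a, y] - [d a, y]], where [d] is minus the adjoint of [J] for the Killing form.

   For [y] in [l_(-1)] this says [[a, J y] = - [d a, y]], that is, over the complex numbers, that
   [b = a - i d a] annihilates [l^(1,0)].  Let [c] in [[s^(0,1), s_1]] act on [s^(0,1)] as [-1],
   and hence on all such [b] as [1], as the grading element does.  The grading operator of [l]
   minus [c] commutes with [b] and with [s^(0,1)], and comparing the traces of [c] on
   [l^(0,1) + l_0 + l_1 + ...] and on its complement, inside every spectral subspace, shows that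
   [b] annihilates [l^(1,0)]. *)
Require Import Defs.
From mathcomp Require Import all_boot all_order all_algebra.
From mathcomp Require Import boolp classical_sets reals.
From mathcomp Require Import complex ring.

Set Implicit Arguments.
Unset Strict Implicit.
Unset Printing Implicit Defensive.

Import Order.TTheory GRing.Theory Num.Theory VectorInternalTheory.
Local Open Scope ring_scope.

(** * Linear identities *)

(** If bracketing with [J_g] is a derivation of [s], invariance of the Killing form forces
    [[J_g, a]], for [a] in [s_1], to be minus the adjoint of [J] applied to [a]. This is the origin
    of [d]; the relation with [s_1] is then the derivation rule.

    Complete reducibility needs submodules, so [s] must be generated by [s_(-1) + s_0 + s_1]. In
    positive degrees this is Killing-dual to the absence of nonzero elements of [s] of degree
    [<= -2] annihilated by [s_1], which therefore is proved by traces instead: by transitivity the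
    grading element is a sum of brackets [[s_1, s_(-1)]], hence has trace zero on the span generated
    by such elements, a space of negative degrees.

    The final trace argument needs a sum of brackets whose factors all preserve
    [l^(0,1) + l_0 + l_1 + ...]. This rules out [s^(1,0)], so the grading element cannot be used
    directly. It is split along [[s^(0,1), s_1]] and the centralizer of [s^(0,1)], two subspaces of
    the complexified [s_0] that meet only in 0; its first component is [c]. *)

Inductive zexpr := ZVar of nat | ZZero | ZAdd of zexpr & zexpr | ZOpp of zexpr.

Fixpoint zeval (V : zmodType) (env : seq V) (e : zexpr) : V :=
  match e with
  | ZVar i => env`_i
  | ZZero => 0
  | ZAdd a b => zeval env a + zeval env b
  | ZOpp a => - zeval env a
  end.

Fixpoint zcoef (e : zexpr) (i : nat) : int :=
  match e with
  | ZVar j => Posz (i == j)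
  | ZZero => 0
  | ZAdd a b => zcoef a i + zcoef b i
  | ZOpp a => - zcoef a i
  end.

Lemma zevalE (V : zmodType) (env : seq V) e :
  zeval env e = \sum_(i < size env) env`_i *~ zcoef e i.
Proof.
elim: e => /= [j||a -> b ->|a ->].
- have [ltj|gej] := ltnP j (size env).
    rewrite (bigD1 (Ordinal ltj)) //= eqxx mulr1z big1 ?addr0 // => i.
    by rewrite -val_eqE /= => /negbTE ->; rewrite mulr0z.
  rewrite nth_default // big1 // => i _.
  by rewrite ltn_eqF ?mulr0z // (leq_trans (ltn_ord i)).
- by rewrite big1 // => i _; rewrite mulr0z.
- by rewrite -big_split; apply: eq_bigr => i _; rewrite mulrzDr.
by rewrite -sumrN; apply: eq_bigr => i _; rewrite mulrNz.
Qed.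

Lemma zmod_correct (V : zmodType) (env : seq V) a b :
  all (fun i => zcoef a i == zcoef b i) (iota 0 (size env)) ->
  zeval env a = zeval env b.
Proof.
move=> /allP H; rewrite !zevalE; apply: eq_bigr => i _.
by rewrite (eqP (H _ _)) // mem_iota /=.
Qed.

(** Atoms are identified up to unification, so convertible forms of a vector count as one. The inner
    [match] runs [unify] while a term is being returned; its failure selects the next branch. *)
Ltac zindex x env :=
  lazymatch env with
  | ?y :: ?e =>
    match constr:(0%N) with
    | _ => let _ := match constr:(0%N) with _ => unify x y end in constr:(Some 0%N)
    | _ => lazymatch zindex x e with
           | Some ?k => constr:(Some (S k))
           | None => constr:(@None nat)
           end
    end
  | _ => constr:(@None nat)
  end.

Ltac zenv t env :=
  lazymatch t with
  | (?a + ?b)%R => let e := zenv a env in zenv b e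
  | (- ?a)%R => zenv a env
  | 0%R => env
  | ?x => lazymatch zindex x env with
          | Some _ => env
          | None => constr:(x :: env)
          end
  end.

Ltac zreify t env :=
  lazymatch t with
  | (?a + ?b)%R => let x := zreify a env in let y := zreify b env in constr:(ZAdd x y)
  | (- ?a)%R => let x := zreify a env in constr:(ZOpp x)
  | 0%R => constr:(ZZero)
  | ?x => lazymatch zindex x env with Some ?k => constr:(ZVar k) end
  end.

(* Decides identities of [zmodType]s by comparing the integer coefficients of the atoms. *)
Ltac zmod :=
  lazymatch goal with
  | |- @eq ?T ?a ?b =>
    let e0 := zenv a (@nil T) in let env := zenv b e0 in
    let x := zreify a env in let y := zreify b env in
    exact (@zmod_correct _ env x y isT)
  end.

(** * Traces and spectral projections *)

Section MatrixTrace.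
Variable F : fieldType.

Lemma mxtraceC n (A B : 'M[F]_n) : \tr (A * B) = \tr (B * A).
Proof. exact: mxtrace_mulC. Qed.

(** Rank factorization [A = C R]: cancelling in [C R C R = C R] leaves [R C = 1], of size the rank,
    and the trace is cyclic. *)
Lemma mxtrace_idem n (A : 'M[F]_n) : A * A = A -> \tr A = (\rank A)%:R.
Proof.
move=> AA; have cA := mulmx_base A.
suff rc : row_base A *m col_base A = 1%:M.
  by rewrite -{1}cA mxtrace_mulC rc mxtrace1.
apply: (row_free_inj (row_base_free A)); apply: (row_full_inj (col_base_full A)).
by rewrite mul1mx -mulmxA cA mulmxA cA -mulmxE in AA *.
Qed.

(** With [A = C R] of full rank, [A ^+ k.+1 = C (R C) ^+ k R], so [R C] has the same trace and a
    smaller exponent. No eigenvalues are involved. *)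
Lemma mxtrace_nilp n (A : 'M[F]_n) k : A ^+ k = 0 -> \tr A = 0.
Proof.
elim: k n A => [|k IH] n A.
  rewrite expr0 => A1; have -> : A = 0 by rewrite -[A]mulr1 A1 mulr0.
  by rewrite mxtrace0.
move=> Ak; rewrite -{1}(mulmx_base A) mxtrace_mulC; apply: IH.
have H C B j : C *m B = A -> C *m (B *m C) ^+ j *m B = A ^+ j.+1.
  move=> CB; elim: j => [|j IHj]; first by rewrite expr0 mulmx1 expr1.
  by rewrite [in RHS]exprSr -mulmxE -IHj [in LHS]exprSr -mulmxE -CB !mulmxA.
apply: (row_free_inj (row_base_free A)); apply: (row_full_inj (col_base_full A)).
by rewrite mul0mx mulmx0 mulmxA H ?mulmx_base.
Qed.

(** The condition [a f = f a f] says that the image of [f] is stable under [a]; the trace is that of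
    a commutator of restrictions to this image. *)
Lemma mxtrace_idem_comm n (f a b : 'M[F]_n) :
  f * f = f -> a * f = f * a * f -> b * f = f * b * f ->
  \tr (f * (a * b - b * a)) = 0.
Proof.
move=> ff; wlog suff H : a b / a * f = f * a * f -> b * f = f * b * f ->
    \tr (f * (a * b)) = \tr (f * a * f * (f * b * f)).
  move=> af bf; rewrite mulrBr linearB /= (H a b af bf) (H b a bf af).
  by rewrite [X in _ - X]mxtrace_mulC subrr.
move=> _ bf; have -> : f * (a * b) = f * (f * (a * b)) by rewrite [RHS]mulrA ff.
transitivity (\tr (f * (a * b) * f)); first exact: mxtrace_mulC.
by rewrite -!mulrA (mulrA f f) ff !mulrA -[in LHS]mulrA bf !mulrA.
Qed.

(** It is enough that one factor of the commutator commutes with [e]. *)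
Lemma mxtrace_comm0 n (e a b : 'M[F]_n) : a * e = e * a ->
  \tr (e * (a * b - b * a)) = 0.
Proof.
move=> ae; rewrite mulrBr linearB /= !mulrA -ae.
by rewrite [\tr (e * b * a)]mxtrace_mulC mulmxE mulrA subrr.
Qed.

End MatrixTrace.

Section Spectral.
Variable F : fieldType.

(** [horner_mx] in every dimension, zero included, since a module may be zero. *)
Definition hmx n (A : 'M[F]_n) (p : {poly F}) : 'M[F]_n :=
  \sum_(i < size p) p`_i *: A ^+ i.

Lemma hmxE n' (A : 'M[F]_n'.+1) p : hmx A p = horner_mx A p.
Proof.
rewrite -[p in RHS]coefK poly_def rmorph_sum; apply: eq_bigr => i _.
by rewrite -mul_polyC rmorphM rmorphXn /= horner_mx_C horner_mx_X -mulmxE mul_scalar_mx.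
Qed.

Lemma hmxM n (A : 'M[F]_n) p q : hmx A (p * q) = hmx A p * hmx A q.
Proof. by case: n A => [|n] A; [rewrite !thinmx0 ?flatmx0|rewrite !hmxE rmorphM]. Qed.

Lemma hmxD n (A : 'M[F]_n) p q : hmx A (p + q) = hmx A p + hmx A q.
Proof. by case: n A => [|n] A; [rewrite !thinmx0 ?flatmx0|rewrite !hmxE rmorphD]. Qed.

Lemma hmxB n (A : 'M[F]_n) p q : hmx A (p - q) = hmx A p - hmx A q.
Proof. by case: n A => [|n] A; [rewrite !thinmx0 ?flatmx0|rewrite !hmxE rmorphB]. Qed.

Lemma hmx_sum n (A : 'M[F]_n) (I : eqType) (r : seq I) (p : I -> {poly F}) :
  hmx A (\sum_(i <- r) p i) = \sum_(i <- r) hmx A (p i).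
Proof.
elim: r => [|i r IH]; last by rewrite !big_cons hmxD IH.
by rewrite !big_nil /hmx size_poly0 big_ord0.
Qed.

Lemma hmxC n (A : 'M[F]_n) c : hmx A c%:P = c%:M.
Proof.
by case: n A => [|n] A; [rewrite !thinmx0 ?flatmx0|rewrite !hmxE horner_mx_C].
Qed.

Lemma hmx1 n (A : 'M[F]_n) : hmx A 1 = 1.
Proof. exact: hmxC. Qed.

Lemma hmxXn n (A : 'M[F]_n) c k : hmx A (('X - c%:P) ^+ k) = (A - c%:M) ^+ k.
Proof.
case: n A => [|n] A; first by rewrite !thinmx0 ?flatmx0.
by rewrite hmxE rmorphXn rmorphB /= horner_mx_X horner_mx_C.
Qed.

Lemma hmx_comm n (A B : 'M[F]_n) p : A * B = B * A -> hmx A p * B = B * hmx A p.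
Proof.
move=> AB; rewrite mulr_suml mulr_sumr; apply: eq_bigr => i _.
by rewrite -mulmxE -scalemxAl -scalemxAr mulmxE; congr (_ *: _); apply/esym/commrX.
Qed.

Let pw (k : nat) (c : F) : {poly F} := ('X - c%:P) ^+ k.

Lemma coprimep_pw k c d : c != d -> coprimep (pw k c) (pw k d).
Proof.
move=> cd; apply/coprimep_expl/coprimep_expr; rewrite coprimep_XsubC root_XsubC.
by rewrite eq_sym.
Qed.

Lemma coprimep_pw_prod k c (cs : seq F) : c \notin cs ->
  coprimep (pw k c) (\prod_(d <- cs) pw k d).
Proof.
elim: cs => [|d cs IH]; first by rewrite big_nil coprimep1.
rewrite inE negb_or => /andP[cd ccs]; rewrite big_cons coprimepMr IH // andbT.
exact: coprimep_pw.
Qed.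

Lemma dvdp_prod_pw k (cs : seq F) (p : {poly F}) : uniq cs ->
  (forall c, c \in cs -> pw k c %| p) -> \prod_(c <- cs) pw k c %| p.
Proof.
elim: cs => [|c cs IH] /=; first by rewrite big_nil dvd1p.
move=> /andP[ccs ucs] H; rewrite big_cons Gauss_dvdp ?coprimep_pw_prod //.
rewrite H ?mem_head //= IH // => d dcs; apply: H; rewrite inE dcs orbT //.
Qed.

(** The idempotents of the Chinese remainder theorem for the coprime powers [pw k c], read off a
    Bezout relation. *)
Lemma partial_fractions k (cs : seq F) : uniq cs ->
  exists q : F -> {poly F}, forall c d, c \in cs -> d \in cs ->
    pw k d %| (c == d)%:R - q c.
Proof.
move=> ucs; suff H c : exists q : {poly F}, c \in cs ->
    forall d, d \in cs -> pw k d %| (c == d)%:R - q.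
  by have [q qP] := choice H; exists q => c d /qP; apply.
have [ccs|] := boolP (c \in cs); last by exists 0.
have [|[u v] uv] := @Bezout_eq1_coprimepP _ (pw k c) (\prod_(d <- rem c cs) pw k d) _.
  by apply: coprimep_pw_prod; rewrite mem_rem_uniq // inE eqxx.
have PE : \prod_(d <- cs) pw k d = pw k c * \prod_(d <- rem c cs) pw k d.
  by rewrite (perm_big _ (perm_to_rem ccs)) big_cons.
exists (v * \prod_(d <- rem c cs) pw k d) => _ d dcs.
have [<-|cd] := eqVneq c d; first by rewrite -[true%:R]uv /= addrK dvdp_mull.
rewrite sub0r dvdpNr dvdp_mull // (perm_big _ (perm_to_rem (_ : d \in rem c cs))).
  by rewrite big_cons dvdp_mulr.
by rewrite mem_rem_uniq // inE eq_sym cd.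
Qed.

(** The projections onto the generalized eigenspaces are polynomials in [A], so they commute with
    whatever commutes with [A]. The exponent [size rs] bounds all multiplicities, hence
    [char_poly A] divides the product of the powers. *)
Lemma spectral_projections n (A : 'M[F]_n) (rs : seq F) :
  char_poly A = \prod_(z <- rs) ('X - z%:P) ->
  exists (cs : seq F) (p : F -> {poly F}) (k : nat),
  [/\ uniq cs, \sum_(c <- cs) hmx A (p c) = 1,
      forall c, c \in cs -> hmx A (p c) * hmx A (p c) = hmx A (p c)
    & forall c, c \in cs -> (A - c%:M) ^+ k * hmx A (p c) = 0].
Proof.
case: n A => [|n] A Ars.
  by exists [::], (fun=> 0), 0%N; split=> //; rewrite !thinmx0.
pose cs := undup rs; pose k := size rs; have ucs : uniq cs := undup_uniq rs.
have A0 p : \prod_(c <- cs) pw k c %| p -> hmx A p = 0.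
  case/dvdpP => q ->; suff /dvdpP[r ->] : char_poly A %| \prod_(c <- cs) pw k c.
    by rewrite !hmxM [hmx A (char_poly A)]hmxE Cayley_Hamilton !mulr0.
  rewrite Ars prodrXl /k; have H z : z \in rs -> ('X - z%:P) %| \prod_(c <- cs) ('X - c%:P).
    rewrite -mem_undup => zcs; rewrite (perm_big _ (perm_to_rem zcs)) big_cons.
    exact: dvdp_mulr.
  elim: (rs) H => [|z r IH] H; first by rewrite big_nil dvd1p.
  rewrite big_cons /= exprS dvdp_mul ?IH ?H ?mem_head // => y yr.
  by rewrite H // inE yr orbT.
have [q qP] := partial_fractions k ucs; exists cs, q, k.
have q1 c : c \in cs -> \prod_(d <- cs) pw k d %| pw k c * q c.
  move=> ccs; rewrite (perm_big _ (perm_to_rem ccs)) big_cons dvdp_mul //.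
  apply: dvdp_prod_pw => [|d]; first exact: rem_uniq.
  rewrite mem_rem_uniq // inE => /andP[dc dcs].
  by have := qP c d ccs dcs; rewrite eq_sym (negbTE dc) sub0r dvdpNr.
split=> // [|c ccs|c ccs].
- apply/eqP; rewrite -subr_eq0 -hmx_sum -(hmx1 A) -hmxB A0 // -dvdpNr opprB.
  apply: dvdp_prod_pw => // d dcs; rewrite (bigD1_seq d) //= opprD addrA dvdp_add //.
    by have := qP d d dcs dcs; rewrite eqxx.
  rewrite dvdpNr big_seq_cond; elim/big_rec: _ => [|c p /andP[ccs cd] H].
    exact: dvdp0.
  by rewrite dvdp_add //; have := qP c d ccs dcs; rewrite (negbTE cd) sub0r dvdpNr.
- apply/eqP; rewrite -subr_eq0 -hmxM -hmxB A0 // -[X in _ - X]mul1r -mulrBl -dvdpNr -mulNr opprB.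
  apply: dvdp_prod_pw => // d dcs; have := qP c d ccs dcs.
  have [_ H|_] := eqVneq; first by rewrite dvdp_mulr.
  by rewrite sub0r dvdpNr; apply: dvdp_mull.
rewrite -hmxXn -hmxM; exact/A0/q1.
Qed.
Lemma mxtrace_generalized_eigen n (A e : 'M[F]_n) c k : A * e = e * A -> e * e = e ->
  (A - c%:M) ^+ k * e = 0 -> \tr (A * e) = c * (\rank e)%:R.
Proof.
move=> Ae ee Ak; rewrite -(mxtrace_idem ee) -mxtraceZ -mul_scalar_mx.
apply/eqP; rewrite -subr_eq0 -linearB -mulrBl; apply/eqP/(@mxtrace_nilp _ _ _ k.+1).
have ce : (A - c%:M) * e = e * (A - c%:M).
  by rewrite -!mulmxE mulmxBl mulmxBr scalar_mxC mulmxE Ae.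
rewrite exprMn_comm // exprS -mulrA.
have -> : e ^+ k.+1 = e by elim: (k) => [|j IH]; rewrite ?expr1 // exprS IH ee.
by rewrite Ak mulr0.
Qed.

(** Fitting decomposition at the eigenvalue 0: [e] projects onto the part where [u] is invertible,
    and [hmx u p] inverts [u] there. *)
Lemma fitting_inverse n (u : 'M[F]_n) : (forall k, u ^+ k != 0) ->
  exists p : {poly F}, let e := hmx u p * u in e * e = e /\ e != 0.
Proof.
case: n u => [|n] u unil.
  by have := unil 0%N; rewrite (flatmx0 (u ^+ 0)) flatmx0 eqxx.
have [m [g /implyP/(_ (monic_neq0 (char_poly_monic u))) g0 uE]] := multiplicity_XsubC (char_poly u) 0.
(* The exponent [m.+1], rather than the multiplicity [m], leaves a factor [u] to split off even if
   [m = 0]. *)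
have [|[a b] /= ab] := @Bezout_eq1_coprimepP _ ('X ^+ m.+1) g _.
  by rewrite -['X]subr0 coprimep_expl // coprimep_sym coprimep_XsubC.
have hX k : hmx u ('X ^+ k) = u ^+ k by rewrite -['X]subr0 hmxXn raddf0 subr0.
exists (a * 'X ^+ m); set e := _ * u => /=.
have eE : e = hmx u (a * 'X ^+ m.+1) by rewrite /e exprSr mulrA [RHS]hmxM (hX 1%N) expr1.
have bE : 1 - e = hmx u (b * g) by rewrite eE -(hmx1 u) -hmxB -ab addrAC subrr add0r.
have cu : hmx u ('X ^+ m.+1 * g) = 0.
  rewrite polyC0 subr0 in uE; rewrite exprS -mulrA hmxM [_ ^+ m * _]mulrC.
  by rewrite -uE [hmx u (char_poly u)]hmxE Cayley_Hamilton mulr0.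
split.
  apply/esym/eqP; rewrite -subr_eq0 -[X in X - _]mulr1 -mulrBr bE eE -hmxM.
  by rewrite mulrACA hmxM cu mulr0.
apply: contraNneq (unil m.+1) => e0.
rewrite e0 subr0 in bE; rewrite -hX -[X in X == 0]mulr1 bE -hmxM.
by rewrite mulrCA hmxM cu mulr0.
Qed.
End Spectral.

Lemma closed_spectral_projections (F : closedFieldType) n (A : 'M[F]_n) :
  exists (cs : seq F) (p : F -> {poly F}) (k : nat),
  [/\ uniq cs, \sum_(c <- cs) hmx A (p c) = 1,
      forall c, c \in cs -> hmx A (p c) * hmx A (p c) = hmx A (p c)
    & forall c, c \in cs -> (A - c%:M) ^+ k * hmx A (p c) = 0].
Proof.
have [rs] := closed_field_poly_normal (char_poly A).
by rewrite (monicP (char_poly_monic A)) scale1r => /spectral_projections.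
Qed.

(** A form of Jacobson's lemma. The spectral projection [e] of [a] at [c] commutes with every [u i],
    so [a e] has trace 0; but this trace is [c] times the rank of [e]. *)
Lemma sum_comm_nilpotent (C : numClosedFieldType) n (a : 'M[C]_n) (I : Type) (r : seq I)
    (u v : I -> 'M[C]_n) :
  (forall i, a * u i = u i * a) -> a = \sum_(i <- r) (u i * v i - v i * u i) ->
  exists k, a ^+ k = 0.
Proof.
move=> au aE; have [cs [p [k [ucs e1 ee ak]]]] := closed_spectral_projections a.
have e0 c : c \in cs -> c != 0 -> hmx a (p c) = 0.
  move=> ccs c0; set e := hmx a (p c).
  have ue i : u i * e = e * u i by rewrite /e hmx_comm.
  have : \tr (a * e) = 0.
    rewrite mxtraceC {1}aE mulr_sumr linear_sum big1 // => i _ /=.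
    exact: mxtrace_comm0.
  rewrite (@mxtrace_generalized_eigen _ _ _ _ c k) ?ee ?ak ?hmx_comm // => /eqP.
  by rewrite mulf_eq0 (negbTE c0) pnatr_eq0 mxrank_eq0 => /eqP.
exists k; rewrite -[LHS]mulr1 -e1 mulr_sumr big_seq big1 // => c ccs.
have [c0|c0] := eqVneq c 0; last by rewrite e0 ?mulr0.
by rewrite -(ak c ccs) c0 raddf0 subr0.
Qed.

Lemma mulmx_exprB_comm0 (F : fieldType) m n (v : 'M[F]_(m, n)) (A B : 'M_n) k :
  A * B = B * A -> v *m A ^+ k = 0 -> v *m B ^+ k = 0 ->
  v *m (A - B) ^+ (k + k) = 0.
Proof.
move=> AB vA vB.
suff H l i j : (k + k <= i + j + l)%N -> v *m A ^+ i *m B ^+ j *m (A - B) ^+ l = 0.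
  by have := H (k + k)%N 0%N 0%N (leqnn _); rewrite !expr0 !mulmx1.
elim: l i j => [|l IH] i j.
  rewrite addn0 mulmx1 => le; have [ki|ik] := leqP k i.
    by rewrite -(subnKC ki) exprD -mulmxE !mulmxA vA !mul0mx.
  have kj : (k <= j)%N by rewrite -(leq_add2l k) (leq_trans le) // leq_add2r ltnW.
  rewrite -mulmxA mulmxE (commrX j (commr_sym (commrX i (commr_sym AB)))).
  by rewrite -(subnKC kj) exprD -!mulmxE !mulmxA vB !mul0mx.
rewrite exprS -mulmxE mulmxA mulmxBr mulmxBl => le.
have -> : v *m A ^+ i *m B ^+ j *m A = v *m A ^+ i.+1 *m B ^+ j.
  by rewrite exprSr -!mulmxA !mulmxE -(commrX j AB) mulrA.
rewrite -[v *m _ *m _ *m B]mulmxA mulmxE -exprSr !IH ?subr0 //.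
  by rewrite addnS addSn -addnS.
by rewrite !addSn -addnS.
Qed.

(** * Cartan's criterion and Engel's theorem *)

Section TraceFormNilpotent.
Variables (F : fieldType) (C : numClosedFieldType) (f : {rmorphism F -> C}).
Variables (n : nat) (P : 'M[F]_n -> Prop).
Hypothesis P_trace : forall y z, P y -> P z -> \tr (y * z) = 0.
Hypothesis P_comm : forall y z, P y -> P z -> P (y * z - z * y).

Let adm (X : 'M[C]_n) : 'M[C]_(n * n) := lin_mx (mulmx X) - lin_mx (mulmxr X).

(** For spectral projections [e a], [e b] of [X], this places [e a * z * e b] in the generalized
    eigenspace of [ad X] at [a - b]: left and right multiplication by [X] commute. *)
Let adm_genE (X w : 'M[C]_n) a b k :
  (X - a%:M) ^+ k * w = 0 -> w * (X - b%:M) ^+ k = 0 ->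
  mxvec w *m (adm X - (a - b)%:M) ^+ (k + k) = 0.
Proof.
move=> Xa Xb; set L := lin_mx (mulmx X) : 'M_(n * n); set M := lin_mx (mulmxr X) : 'M_(n * n).
have LE v : mxvec v *m (L - a%:M) = mxvec ((X - a%:M) * v).
  rewrite mulmxBr mul_vec_lin mul_mx_scalar -linearZ -linearB /= mulrBl.
  by rewrite -[a%:M * v]/(a%:M *m v) mul_scalar_mx.
have ME v : mxvec v *m (M - b%:M) = mxvec (v * (X - b%:M)).
  rewrite mulmxBr mul_vec_lin mul_mx_scalar -linearZ -linearB /= mulrBr.
  by rewrite -[v * b%:M]/(v *m b%:M) mul_mx_scalar.
have LXE j v : mxvec v *m (L - a%:M) ^+ j = mxvec ((X - a%:M) ^+ j * v).
  elim: j v => [|j IH] v; first by rewrite !expr0 mulmx1 mul1r.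
  by rewrite exprS exprSr -mulmxE mulmxA LE IH mulrA.
have MXE j v : mxvec v *m (M - b%:M) ^+ j = mxvec (v * (X - b%:M) ^+ j).
  elim: j v => [|j IH] v; first by rewrite !expr0 mulmx1 mulr1.
  by rewrite [in LHS]exprS [in RHS]exprS -mulmxE mulmxA ME IH mulrA.
have -> : adm X - (a - b)%:M = (L - a%:M) - (M - b%:M).
  by rewrite raddfB /= opprB opprD opprK [b%:M - _]addrC addrACA.
apply: mulmx_exprB_comm0; rewrite ?LXE ?MXE ?Xa ?Xb ?linear0 //.
apply/row_matrixP => i; rewrite !rowE -[delta_mx 0 i]vec_mxK.
by rewrite -!mulmxE !mulmxA LE ME ME LE mulrA.
Qed.

(** Let [Y] have the spectral projections of [X] and the conjugate eigenvalues. Since [ad Y] is a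
    polynomial in [ad X], the relation [tr ([z1, z2] Y) = tr (z1 [z2, Y])] gives [tr (X Y) = 0].
    This trace is the sum of the [|c|^2], weighted by the ranks, so only the eigenvalue 0 occurs. *)
Lemma trace_form_nilpotent (x : 'M[F]_n) (r : seq ('M[F]_n * 'M[F]_n)) : P x ->
    (forall z, z \in r -> P z.1 /\ P z.2) ->
    x = \sum_(z <- r) (z.1 * z.2 - z.2 * z.1) ->
  exists k, x ^+ k = 0.
Proof.
move=> Px rP xE; pose X := map_mx f x.
have [cs [p [k [ucs e1 ee Xe]]]] := closed_spectral_projections X.
pose e c := hmx X (p c).
have Xec c : X * e c = e c * X by rewrite hmx_comm.
have Xce c c' : (X - c'%:M) * e c = e c * (X - c'%:M).
  by rewrite -!mulmxE mulmxBl mulmxBr scalar_mxC mulmxE Xec.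
pose Y := \sum_(c <- cs) c^* *: e c.
pose ds := undup [seq a - b | a <- cs, b <- cs].
have [q qP] := partial_fractions (k + k) (undup_uniq _ : uniq ds).
(* [Q] interpolates conjugation at the eigenvalues [a - b] of [ad X], to an order high enough that
   [Q (ad X)] is the diagonalizable [ad Y] although [ad X] need not be diagonalizable. *)
pose Q := \sum_(d <- ds) d^* *: q d.
have QP d : d \in ds -> ('X - d%:P) ^+ (k + k) %| Q - (d^*)%:P.
  move=> dds; rewrite /Q (bigD1_seq d) ?undup_uniq //= addrAC dvdp_add //.
    have := qP d d dds dds; rewrite eqxx => H.
    by rewrite -[d^*%:P]mulr1 mul_polyC -scalerBr -mul_polyC dvdp_mull // -dvdpNr opprB.
  rewrite big_seq_cond; elim/big_rec: _ => [|d' s /andP[d'ds d'd] H].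
    exact: dvdp0.
  rewrite dvdp_add // -mul_polyC dvdp_mull //.
  by have := qP d' d d'ds dds; rewrite (negbTE d'd) sub0r dvdpNr.
have Kw z a b : a \in cs -> b \in cs ->
    mxvec (e a * z * e b) *m hmx (adm X) Q = (a - b)^* *: mxvec (e a * z * e b).
  move=> acs bcs; have ads : a - b \in ds by rewrite mem_undup; apply: (allpairs_f (fun a b => a - b)).
  have /dvdpP[g gE] := QP _ ads.
  apply/eqP; rewrite -subr_eq0 -mul_mx_scalar -mulmxBr -(hmxC (adm X)) -hmxB gE mulrC.
  rewrite hmxM hmxXn -mulmxE mulmxA adm_genE ?mul0mx //.
    by rewrite !mulrA Xe // !mul0r.
  rewrite -mulrA (_ : e b * _ = 0) ?mulr0 // -(Xe b bcs).
  exact: (commrX k (esym (Xce b b))).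
have Kz z : mxvec z *m hmx (adm X) Q = mxvec (Y * z - z * Y).
  have zE : z = \sum_(a <- cs) \sum_(b <- cs) e a * z * e b.
    rewrite -[LHS]mulr1 -[LHS]mul1r -e1 !mulr_suml; apply: eq_bigr => a _.
    by rewrite mulrA mulr_sumr.
  have YzE : Y * z - z * Y = \sum_(a <- cs) \sum_(b <- cs) (a - b)^* *: (e a * z * e b).
    have eZl c A B : (c *: A : 'M[C]_n) * B = c *: (A * B) by rewrite -mulmxE scalemxAl.
    have eZr c A B : A * (c *: B : 'M[C]_n) = c *: (A * B) by rewrite -mulmxE scalemxAr.
    have -> : Y * z = \sum_(a <- cs) \sum_(b <- cs) a^* *: (e a * z * e b).
      rewrite -[LHS]mulr1 -e1 !mulr_suml; apply: eq_bigr => a _.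
      by rewrite mulr_sumr; apply: eq_bigr => b _; rewrite !eZl.
    have -> : z * Y = \sum_(a <- cs) \sum_(b <- cs) b^* *: (e a * z * e b).
      rewrite -[LHS]mul1r -e1 mulr_suml; apply: eq_bigr => a _.
      by rewrite mulrA mulr_sumr; apply: eq_bigr => b _; rewrite !eZr.
    rewrite -sumrB; apply: eq_bigr => a _; rewrite -sumrB; apply: eq_bigr => b _.
    by rewrite rmorphB scalerBl.
  rewrite YzE [in LHS]zE !(linear_sum mxvec) mulmx_suml big_seq [RHS]big_seq /=.
  apply: eq_bigr => a acs; rewrite !(linear_sum mxvec) mulmx_suml big_seq [RHS]big_seq /=.
  by apply: eq_bigr => b bcs; rewrite Kw // -linearZ.
(* The orthogonal of [P] for the trace form is a complex subspace stable under [ad X]; it spares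
   forming the complex span of [P]. *)
pose S (w : 'rV[C]_(n * n)) := forall y, P y -> \tr (map_mx f y * vec_mx w) = 0.
have SK w : S w -> S (w *m adm X).
  move=> Sw y Py; have := Sw _ (P_comm Py Px).
  rewrite -[w]vec_mxK mulmxBr !mul_vec_lin !mxvecK /= linearB /= !mxvecK.
  rewrite rmorphB /= !rmorphM /= mulrBl mulrBr !linearB /= -!mulrA.
  move=> <-; congr (_ - _); rewrite mulmxE.
  by rewrite [X in \tr X = _]mulrA [LHS]mxtraceC.
have SQ w : S w -> S (w *m hmx (adm X) Q).
  move=> Sw; rewrite /hmx mulmx_sumr => y Py.
  rewrite linear_sum mulr_sumr linear_sum big1 //= => i _.
  rewrite -scalemxAr linearZ /= -mulmxE -scalemxAr linearZ /=.
  suff H j : S (w *m adm X ^+ j) by rewrite -/S mulmxE H // mulr0.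
  by elim: j => [|j IH]; rewrite ?expr0 ?mulmx1 // exprSr -mulmxE mulmxA; apply: SK.
have trXY : \tr (X * Y) = 0.
  have -> : X = \sum_(z <- r) (map_mx f z.1 * map_mx f z.2 - map_mx f z.2 * map_mx f z.1).
    by rewrite /X xE rmorph_sum; apply: eq_bigr => z _; rewrite rmorphB !rmorphM.
  rewrite mulr_suml linear_sum big_seq big1 //= => z /rP[P1 P2].
  have : S (mxvec (map_mx f z.2)).
    by move=> y Py; rewrite mxvecK -rmorphM /= trace_map_mx P_trace ?rmorph0.
  move/SQ/(_ _ P1); rewrite Kz mxvecK mulrBr linearB /= => /eqP; rewrite subr_eq0 => /eqP H.
  by rewrite mulrBl linearB /= -!mulrA -H -mulmxE [X in _ - X]mxtrace_mulC -mulmxA subrr.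
have trXe c : c \in cs -> \tr (X * e c) = c * (\rank (e c))%:R.
  by move=> ccs; apply: (@mxtrace_generalized_eigen _ _ _ _ _ k); rewrite ?ee ?Xe.
have e0 c : c \in cs -> c != 0 -> e c = 0.
  move=> ccs c0; apply/eqP; rewrite -mxrank_eq0.
  have : \sum_(c <- cs) `|c| ^+ 2 * (\rank (e c))%:R == 0 :> C.
    rewrite -[X in _ == X]trXY mulr_sumr linear_sum /= big_seq [X in _ == X]big_seq; apply/eqP.
    apply: eq_bigr => d dcs; rewrite -mulmxE -scalemxAr mulmxE linearZ /= trXe //.
    by rewrite normCKC mulrA.
  rewrite psumr_eq0 => [/allP/(_ c ccs)|d _]; last by rewrite mulr_ge0 ?exprn_ge0.
  by rewrite /= mulf_eq0 expf_eq0 normr_eq0 (negbTE c0) /= pnatr_eq0.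
exists k; apply: (@map_mx_inj _ _ f); rewrite map_mx0 rmorphXn /= -/X.
rewrite -[LHS]mulr1 -e1 mulr_sumr big_seq big1 // => c ccs.
have [c0|c0] := eqVneq c 0; first by rewrite -(Xe c ccs) c0 raddf0 subr0.
by rewrite -/(e c) e0 ?mulr0.
Qed.
End TraceFormNilpotent.

Section Engel.
Variables (F : fieldType) (n : nat).
Implicit Types (Q P : {vspace 'M[F]_n}) (v : 'rV[F]_n).

(** The associative form of Engel's conclusion, equivalent to a common strictly triangular form. *)
Definition products_vanish Q N : Prop := forall s : seq 'M[F]_n,
  size s = N -> {subset s <= Q} -> \prod_(x <- s) x = 0.

(** An ascending filtration of the row vectors, lowered by [Q] and preserved by the normalizer of
    [Q]. *)
Let K Q r v := forall s : seq 'M[F]_n,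
  size s = r -> {subset s <= Q} -> v *m \prod_(x <- s) x = 0.

Let K_lin Q r a v w : K Q r v -> K Q r w -> K Q r (a *: v + w).
Proof.
by move=> Kv Kw s sr sQ; rewrite mulmxDl -scalemxAl Kv // Kw // scaler0 addr0.
Qed.

Let K_step Q r v q : K Q r.+1 v -> q \in Q -> K Q r (v *m q).
Proof.
move=> Kv qQ s sr sQ; have := Kv (q :: s); rewrite big_cons -mulmxE mulmxA; apply.
  by rewrite /= sr.
by move=> x; rewrite inE => /orP[/eqP->|/sQ].
Qed.

(** Moving [z] to the right through a product replaces one factor at a time by a commutator, again
    in [Q], so the number of factors does not drop. *)
Let K_norm Q r v z : (forall q, q \in Q -> z * q - q * z \in Q) ->
  K Q r v -> K Q r (v *m z).
Proof.
move=> zQ Kv s; suff H t u : (size u + size t = r)%N -> {subset u <= Q} ->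
    {subset t <= Q} -> v *m \prod_(x <- u) x *m z *m \prod_(x <- t) x = 0.
  by move=> sr sQ; rewrite -(H s [::]) //= big_nil mulmx1.
elim: t u => [|q t IH] u /=; rewrite ?addn0 => ur uQ tQ.
  by rewrite big_nil mulmx1 Kv ?mul0mx.
have qQ : q \in Q by rewrite tQ ?mem_head.
have tQ' : {subset t <= Q} by move=> x xt; rewrite tQ // inE xt orbT.
have zq : z * q = q * z + (z * q - q * z) by rewrite addrC subrK.
have prodr w : \prod_(x <- rcons u w) x = \prod_(x <- u) x *m w.
  by rewrite big_rcons mulmxE.
have rQ w : w \in Q -> {subset rcons u w <= Q}.
  by move=> wQ x; rewrite mem_rcons inE => /orP[/eqP->|/uQ].
rewrite big_cons -mulmxE mulmxA -[_ *m z *m q]mulmxA [z *m q]zq mulmxDr mulmxDl.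
rewrite -[v *m _ *m (q * z)]/(v *m _ *m (q *m z)) [v *m _ *m (q *m z)]mulmxA.
rewrite -[v *m _ *m q]mulmxA -prodr IH ?add0r ?size_rcons ?addSn -?addnS //; last exact: rQ.
rewrite -[v *m _ *m _]mulmxA -prodr -mulmxA mulmxE -big_cat /= Kv //.
  by rewrite size_cat size_rcons addSn -addnS.
by move=> x; rewrite mem_cat => /orP[/(rQ _ (zQ _ qQ))|/tQ'].
Qed.

Let K0 Q v : K Q 0 v -> v = 0.
Proof. by move/(_ [::] erefl); rewrite big_nil mulmx1; apply. Qed.

(** [a] lowers the filtration and [z] preserves it. *)
Lemma products_vanish_mul_nilp Q N a z : products_vanish Q N -> a \in Q ->
  (forall q, q \in Q -> z * q - q * z \in Q) -> (a * z) ^+ N = 0.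
Proof.
move=> QN aQ zQ; apply/row_matrixP => i; rewrite row0 rowE.
have : K Q N (delta_mx 0 i) by move=> s sN sQ; rewrite QN ?mulmx0.
elim: N {QN} (delta_mx 0 i) => [|N IH] v Kv; first by rewrite (K0 Kv) mul0mx.
by rewrite exprS -mulmxE mulmxA; apply: IH; rewrite mulmxA; apply/K_norm/K_step.
Qed.

(** Modulo the next lower step of the filtration every element of [Q + <[z]>] acts as a multiple of
    [z]. So [m] factors lower the filtration by one step. *)
Let products_vanish_add Q N z m : products_vanish Q N -> z ^+ m = 0 ->
  (forall q, q \in Q -> z * q - q * z \in Q) ->
  products_vanish (Q + <[z]>)%VS (N * m).
Proof.
move=> QN zm zQ s sN sQ; apply/row_matrixP => i; rewrite row0 rowE.
have : K Q N (delta_mx 0 i) by move=> t tN tQ; rewrite QN ?mulmx0.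
have Kmono r v : K Q r v -> K Q r.+1 v.
  move=> Kv [//|x t] [tr] tQ; rewrite lastI big_rcons /= -mulmxE mulmxA Kv ?mul0mx //.
    by rewrite size_belast.
  by move=> y /mem_belast/tQ.
have Kstab r v x : K Q r v -> x \in (Q + <[z]>)%VS -> K Q r (v *m x).
  move=> Kv /memv_addP[q qQ [w /vlineP[b ->] ->]].
  rewrite addrC mulmxDr -scalemxAr; apply: K_lin; first exact: K_norm.
  exact/K_step/qQ/Kmono.
have Kprod r v t : K Q r v -> {subset t <= (Q + <[z]>)%VS} -> K Q r (v *m \prod_(x <- t) x).
  elim: t v => [|x t IH] v Kv tQ; first by rewrite big_nil mulmx1.
  rewrite big_cons -mulmxE mulmxA; apply: IH => [|y yt]; last by rewrite tQ // inE yt orbT.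
  by apply: Kstab => //; rewrite tQ ?mem_head.
have H r v t : K Q r.+1 v -> {subset t <= (Q + <[z]>)%VS} ->
    exists c, K Q r (v *m \prod_(x <- t) x - c *: (v *m z ^+ size t)).
  elim: t v => [|x t IH] v Kv tQ.
    by exists 1; rewrite big_nil scale1r subrr => u _ _; exact: mul0mx.
  have tQ' : {subset t <= (Q + <[z]>)%VS} by move=> y yt; rewrite tQ // inE yt orbT.
  have /memv_addP[q qQ [w /vlineP[b ->] xE]] := tQ x (mem_head _ _).
  have [c Kc] := IH (v *m z) (K_norm zQ Kv) tQ'.
  exists (b * c); rewrite big_cons /= exprS -!mulmxE !mulmxA xE mulmxDr mulmxDl.
  rewrite -scalemxAr -scalemxAl -scalerA -addrA -scalerBr addrC.
  exact/K_lin/Kprod/tQ'/K_step.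
elim: N s sN sQ {QN} (delta_mx 0 i) => [|N IH] s sN sQ v Kv; first by rewrite (K0 Kv) mul0mx.
rewrite -(cat_take_drop m s) big_cat /= -mulmxE mulmxA; apply: IH.
- by rewrite size_drop sN mulSn addKn.
- by move=> x /mem_drop/sQ.
have [x /mem_take/sQ|c] := H N v (take m s) Kv; first by [].
by rewrite size_takel ?zm ?mulmx0 ?scaler0 ?subr0 // sN mulSn leq_addr.
Qed.

(** A subalgebra [Q] with vanishing products is enlarged, as long as it differs from [P], by an
    element of [P] that normalizes it. *)
Lemma engel P : (forall x y, x \in P -> y \in P -> x * y - y * x \in P) ->
  (forall x, x \in P -> exists k, x ^+ k = 0) -> exists N, products_vanish P N.
Proof.
move=> PP Pnil.
suff H d Q N : (\dim P - \dim Q <= d)%N -> (Q <= P)%VS ->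
    (forall x y, x \in Q -> y \in Q -> x * y - y * x \in Q) -> products_vanish Q N ->
    exists N, products_vanish P N.
  apply: (H _ 0%VS 1%N (leqnn _)); first exact: sub0v.
    by move=> x y; rewrite !memv0 => /eqP-> /eqP->; rewrite mulr0 subrr.
  by move=> [|x []] // _ x0; rewrite big_seq1; apply/eqP; rewrite -memv0 x0 ?mem_head.
elim: d Q N => [|d IH] Q N dQ QP QQ QN.
  suff -> : P = Q by exists N.
  by apply/esym/eqP; rewrite eqEdim QP -subn_eq0 -leqn0.
have [PQ|/subvPn[z0 z0P z0Q]] := boolP (P <= Q)%VS.
  suff -> : P = Q by exists N.
  by apply/eqP; rewrite eqEsubv QP PQ.
have [z [zP zQ zn]] : exists z, [/\ z \in P, z \notin Q &
    forall q, q \in Q -> z * q - q * z \in Q].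
  (* If [Q] were its own normalizer in [P], iterated commutators of [z0] with elements of [Q] could
     stay outside [Q] for any length. But after [N + N] of them every term has [N] factors from [Q]
     on one side of [z0], hence vanishes. *)
  apply: contrapT => no.
  pose ad s z := foldr (fun x w : 'M[F]_n => x * w - w * x) z s.
  have H j : exists2 s, size s = j /\ {subset s <= Q} & ad s z0 \in P /\ ad s z0 \notin Q.
    elim: j => [|j [s [sj sQ] [sP snQ]]]; first by exists [::].
    have [q qQ qn] : exists2 q, q \in Q & ad (q :: s) z0 \notin Q.
      apply: contrapT => no'; apply: no; exists (ad s z0); split=> // q qQ.
      apply: contrapT => /negP nQ; apply: no'; exists q => //.
      by rewrite -memvN opprB.
    exists (q :: s); split=> //; rewrite /= ?sj //.
      by move=> x; rewrite inE => /orP[/eqP->|/sQ].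
    by apply: PP => //; apply: (subvP QP).
  have Z s u t : {subset s <= Q} -> {subset u <= Q} -> {subset t <= Q} ->
      (N + N <= size s + size u + size t)%N ->
      \prod_(x <- u) x * ad s z0 * \prod_(x <- t) x = 0.
    elim: s u t => [|x s IHs] u t sQ uQ tQ le /=.
      have big_vanish r : {subset r <= Q} -> (N <= size r)%N -> \prod_(x <- r) x = 0.
        move=> rQ Nr; rewrite -(cat_take_drop N r) big_cat /= QN ?mul0r ?size_takel //.
        by move=> x /mem_take/rQ.
      have [Nu|uN] := leqP N (size u); first by rewrite big_vanish // !mul0r.
      rewrite [X in _ * X]big_vanish ?mulr0 // -(leq_add2l N) (leq_trans le) //.
      by rewrite leq_add2r ltnW.
    have xQ : x \in Q by rewrite sQ ?mem_head.
    have sQ' : {subset s <= Q} by move=> y ys; rewrite sQ // inE ys orbT.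
    rewrite mulrBr mulrBl -(mulrA _ (ad s z0 * x)) -[ad s z0 * x * _]mulrA.
    have -> : x * \prod_(y <- t) y = \prod_(y <- x :: t) y by rewrite big_cons.
    have -> : \prod_(y <- u) y * (x * ad s z0) = \prod_(y <- rcons u x) y * ad s z0.
      by rewrite big_rcons mulrA.
    rewrite IHs ?mulrA ?IHs ?subr0 //.
    - by move=> y; rewrite inE => /orP[/eqP->|/tQ].
    - by rewrite /= addnS -!addSn.
    - by move=> y; rewrite mem_rcons inE => /orP[/eqP->|/uQ].
    - by rewrite size_rcons addnS -addSn.
  have [s [sN sQ] [_ /negP[]]] := H (N + N)%N.
  have := Z s [::] [::]; rewrite big_nil mul1r mulr1 => -> //; first exact: mem0v.
  by rewrite sN !addn0.
have [m zm] := Pnil z zP.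
apply: (IH (Q + <[z]>)%VS (N * m)%N).
- rewrite -ltnS (leq_trans _ dQ) // ltn_sub2l //.
    by rewrite ltnNge; apply: contra zQ => le; rewrite (_ : Q = P) //; apply/eqP; rewrite eqEdim QP.
  rewrite ltnNge; apply: contra zQ => le.
  have /eqP-> : Q == (Q + <[z]>)%VS by rewrite eqEdim addvSl.
  by apply: (subvP (addvSr _ _)); rewrite memv_line.
- by rewrite subv_add QP -memvE.
- move=> x y /memv_addP[q qQ [w /vlineP[a ->] ->]] /memv_addP[q' q'Q [w' /vlineP[b ->] ->]].
  apply: (subvP (addvSl Q _)).
  have -> : (q + a *: z) * (q' + b *: z) - (q' + b *: z) * (q + a *: z) =
      (q * q' - q' * q) + (a *: (z * q' - q' * z) - b *: (z * q - q * z)).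
    rewrite -!mulmxE !mulmxDl !mulmxDr -!scalemxAl -!scalemxAr !scalerBr.
    rewrite !scalerA [b * a]mulrC.
    zmod.
  by rewrite memvD ?QQ // memvB // memvZ ?zn.
exact: products_vanish_add.
Qed.

(** Writing one factor as a sum of commutators turns a product of [j.+1] elements into products of
    [j.+2], so the vanishing length given by Engel's theorem descends to 1. *)
Lemma perfect_nilpotent P :
  (forall x, x \in P -> exists2 r : seq ('M[F]_n * 'M[F]_n),
     forall z, z \in r -> z.1 \in P /\ z.2 \in P &
     x = \sum_(z <- r) (z.1 * z.2 - z.2 * z.1)) ->
  (forall x y, x \in P -> y \in P -> x * y - y * x \in P) ->
  (forall x, x \in P -> exists k, x ^+ k = 0) -> forall x, x \in P -> x = 0.
Proof.
move=> Pperf PP Pnil; have [N] := engel PP Pnil.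
have S j : products_vanish P j.+2 -> products_vanish P j.+1.
  move=> Pj [|x s] //= [sj] sP; rewrite big_cons.
  have [r rP ->] := Pperf x (sP x (mem_head _ _)).
  rewrite mulr_suml big_seq big1 // => z /rP[z1 z2].
  have Ps a b : a \in P -> b \in P -> a * b * \prod_(y <- s) y = 0.
    move=> aP bP; have := Pj [:: a, b & s]; rewrite !big_cons mulrA; apply.
      by rewrite /= sj.
    move=> y; rewrite !inE => /or3P[/eqP->|/eqP->|ys] //.
    by rewrite sP // inE ys orbT.
  by rewrite mulrBl !Ps ?subrr.
move=> PN x xP; suff P1 : products_vanish P 1.
  by rewrite -(P1 [:: x]) ?big_seq1 // => y; rewrite inE => /eqP->.
case: N PN => [|N]; last by elim: N => [|N IH] // /S.
move=> P0 s _ _; have := P0 [::] erefl; rewrite big_nil => z1.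
by rewrite -[LHS]mulr1 z1 ?mulr0.
Qed.

End Engel.

Lemma cartan_criterion (F : fieldType) (C : numClosedFieldType) (f : {rmorphism F -> C})
    n (P : {vspace 'M[F]_n}) :
  (forall x, x \in P -> exists2 r : seq ('M[F]_n * 'M[F]_n),
     forall z, z \in r -> z.1 \in P /\ z.2 \in P &
     x = \sum_(z <- r) (z.1 * z.2 - z.2 * z.1)) ->
  (forall x y, x \in P -> y \in P -> x * y - y * x \in P) ->
  (forall x y, x \in P -> y \in P -> \tr (x * y) = 0) -> forall x, x \in P -> x = 0.
Proof.
move=> Pperf PP Ptr; apply: perfect_nilpotent => // x xP.
have [r rP xE] := Pperf x xP.
exact: (@trace_form_nilpotent _ _ f n (fun z => z \in P) Ptr PP x r xP rP xE).
Qed.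

(** * Linear maps as matrices, and bilinear forms *)

Section LinearMaps.
Variable F : fieldType.

(** A predicate, because brackets, actions and [J] are plain functions and several operators are
    obtained by choice. *)
Definition lin_map (V W : lmodType F) (f : V -> W) : Prop :=
  forall a x y, f (a *: x + y) = a *: f x + f y.

Section Basic.
Variables (V W : lmodType F) (f : V -> W).
Hypothesis f_lin : lin_map f.

Lemma lin_mapD x y : f (x + y) = f x + f y.
Proof. by have := f_lin 1 x y; rewrite !scale1r. Qed.

Lemma lin_map0 : f 0 = 0.
Proof. by apply: (addrI (f 0)); rewrite -lin_mapD !addr0. Qed.

Lemma lin_mapZ a x : f (a *: x) = a *: f x.
Proof. by have := f_lin a x 0; rewrite lin_map0 !addr0. Qed.

Lemma lin_mapN x : f (- x) = - f x.
Proof. by rewrite -scaleN1r lin_mapZ scaleN1r. Qed.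

Lemma lin_mapB x y : f (x - y) = f x - f y.
Proof. by rewrite lin_mapD lin_mapN. Qed.

Lemma lin_map_sum (I : Type) (r : seq I) (P : pred I) (x : I -> V) :
  f (\sum_(i <- r | P i) x i) = \sum_(i <- r | P i) f (x i).
Proof. by elim/big_rec2: _ => [|i u v _ <-]; rewrite ?lin_map0 ?lin_mapD. Qed.

End Basic.

Section Matrix.
Variable V : vectType F.
Implicit Types (f g : V -> V) (U : {vspace V}).

Definition bvec (i : 'I_(dim V)) : V := r2v (delta_mx 0 i).

(** Columns, so that [opmx] sends a composite to the product in the same order. *)
Definition colv (v : V) : 'cV[F]_(dim V) := (v2r v)^T.

Definition opmx f : 'M[F]_(dim V) := \matrix_(i, j) v2r (f (bvec j)) 0 i.

Lemma colv_lin : lin_map colv.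
Proof. by move=> a x y; rewrite /colv !linearP. Qed.

Lemma colv_inj : injective colv.
Proof. by move=> x y /trmx_inj/(can_inj v2rK). Qed.

Lemma bvec_sum v : v = \sum_i v2r v 0 i *: bvec i.
Proof.
rewrite -{1}[v]v2rK [v2r v in LHS]row_sum_delta linear_sum; apply: eq_bigr => i _.
by rewrite linearZ.
Qed.

Lemma colv_op f v : lin_map f -> colv (f v) = opmx f *m colv v.
Proof.
move=> fl; rewrite {1}[v]bvec_sum (lin_map_sum fl) (lin_map_sum colv_lin).
apply/matrixP => i j; rewrite ord1 summxE !mxE; apply: eq_bigr => k _.
by rewrite (lin_mapZ fl) (lin_mapZ colv_lin) !mxE mulrC.
Qed.

Lemma opmx_lin a f g : opmx (fun v => a *: f v + g v) = a *: opmx f + opmx g.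
Proof. by apply/matrixP => i j; rewrite !mxE linearP !mxE. Qed.

Lemma opmx_eq f g : (forall v, f v = g v) -> opmx f = opmx g.
Proof. by move=> fg; apply/matrixP => i j; rewrite !mxE fg. Qed.

Lemma opmx_comp f g : lin_map f -> opmx (fun v => f (g v)) = opmx f * opmx g.
Proof.
move=> fl; apply/matrixP => i j; have := colv_op (g (bvec j)) fl.
move=> /matrixP/(_ i 0); rewrite mxE !mxE => ->; apply: eq_bigr => k _.
by rewrite !mxE.
Qed.

Lemma opmxB f g : opmx (fun v => f v - g v) = opmx f - opmx g.
Proof. by apply/matrixP => i j; rewrite !mxE linearB !mxE. Qed.

Lemma opmx_inj f g : lin_map f -> lin_map g -> opmx f = opmx g -> forall v, f v = g v.
Proof. by move=> fl gl fg v; apply: colv_inj; rewrite !colv_op // fg. Qed.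

Lemma opmx_id : opmx id = 1.
Proof.
by apply/matrixP => i j; rewrite !mxE r2vK mxE eqxx /= eq_sym.
Qed.

Definition mxop (M : 'M[F]_(dim V)) (v : V) : V := r2v (M *m colv v)^T.

Lemma colv_mxop M v : colv (mxop M v) = M *m colv v.
Proof. by rewrite /colv r2vK trmxK. Qed.

Lemma mxop_lin M : lin_map (mxop M).
Proof.
move=> a x y; apply: colv_inj.
by rewrite colv_mxop !colv_lin !colv_mxop mulmxDr scalemxAr.
Qed.

Lemma mxopK M : opmx (mxop M) = M.
Proof.
by apply/matrixP => i j; rewrite mxE /mxop r2vK mxE /colv r2vK trmx_delta -colE mxE.
Qed.

(** Vectors of [P] are added one at a time until the dimension stops growing. Subspaces given by
    predicates become accessible to [projv] and to dimension arguments. *)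
Lemma linear_subset_vspace (P : V -> Prop) :
  P 0 -> (forall a x y, P x -> P y -> P (a *: x + y)) ->
  exists U, forall x, x \in U <-> P x.
Proof.
move=> P0 Plin.
suff H d U : (dim V - \dim U <= d)%N -> (forall x, x \in U -> P x) ->
    exists U', forall x, x \in U' <-> P x.
  by apply: (H _ 0%VS (leqnn _)) => x; rewrite memv0 => /eqP->.
elim: d U => [|d IH] U dU UP.
  exists U => x; split=> [/UP//|_].
  suff -> : U = fullv by rewrite memvf.
  by apply/eqP; rewrite eqEdim subvf /= dimvf -subn_eq0 -leqn0.
have [UP'|/existsNP[x /not_implyP[Px xU]]] := pselect (forall x, P x -> x \in U).
  by exists U => x; split=> [/UP|/UP'].
apply: (IH (U + <[x]>)%VS); last first.
  by move=> y /memv_addP[u uU [w /vlineP[a ->] ->]]; rewrite addrC; apply: Plin (UP _ uU).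
rewrite -ltnS (leq_trans _ dU) // ltn_sub2l //.
  rewrite ltnNge; apply/negP => le; apply: xU.
  suff -> : U = fullv by rewrite memvf.
  by apply/eqP; rewrite eqEdim subvf /= dimvf.
rewrite ltnNge; apply/negP => le; apply: xU.
have /eqP-> : U == (U + <[x]>)%VS by rewrite eqEdim addvSl.
by apply: (subvP (addvSr _ _)); rewrite memv_line.
Qed.

End Matrix.

Section Forms.
Variables (V : vectType F) (b : V -> V -> F).
Hypothesis b_linl : forall y, lin_map (fun x => b x y : F^o).
Hypothesis b_linr : forall x, lin_map (fun y => b x y : F^o).
Hypothesis b_nondeg : forall x, (forall y, b x y = 0) -> x = 0.

Lemma form_riesz (phi : V -> F) : lin_map (phi : V -> F^o) ->
  exists z, forall y, b z y = phi y.
Proof.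
move=> phil; pose G : 'M[F]_(dim V) := \matrix_(i, j) b (bvec i) (bvec j).
have GE (v : 'rV_(dim V)) j : (v *m G) 0 j = b (r2v v) (bvec j).
  rewrite [in RHS](bvec_sum (r2v v)) (lin_map_sum (b_linl _)) mxE r2vK.
  by apply: eq_bigr => i _; rewrite (lin_mapZ (b_linl _)) mxE.
have Gu : G \in unitmx.
  rewrite -row_free_unit; apply: inj_row_free => v vG.
  apply: (can_inj r2vK); rewrite linear0; apply: b_nondeg => y.
  rewrite (bvec_sum y) (lin_map_sum (b_linr _)) big1 // => i _.
  by rewrite (lin_mapZ (b_linr _)) -GE vG mxE; exact: mulr0.
exists (r2v ((\row_j phi (bvec j)) *m invmx G)) => y.
rewrite (bvec_sum y) (lin_map_sum (b_linr _)) (lin_map_sum phil).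
apply: eq_bigr => i _; rewrite (lin_mapZ (b_linr _)) (lin_mapZ phil).
by rewrite -GE mulmxKV // mxE.
Qed.

(** The coordinates of [y - projv U y] are linear forms vanishing on [U], and each is represented by
    a vector orthogonal to [U]. *)
Lemma form_double_orth (U : {vspace V}) x :
  (forall y, (forall u, u \in U -> b y u = 0) -> b y x = 0) -> x \in U.
Proof.
move=> H; suff x0 : x - projv U x = 0.
  by rewrite -(subrK (projv U x) x) x0 add0r memv_proj.
apply: (can_inj v2rK); rewrite linear0; apply/rowP => j; rewrite [RHS]mxE.
have [|z zE] := @form_riesz (fun y => v2r (y - projv U y) 0 j).
  move=> a u v; rewrite linearP opprD addrACA -scalerBr linearP /= mxE.
  by rewrite [in LHS]mxE.
rewrite -zE; apply: H => u uU; rewrite zE projv_id // subrr linear0.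
by rewrite mxE.
Qed.

Hypothesis b_sym : forall x y, b x y = b y x.

Lemma form_dual_basis : exists dv : 'I_(dim V) -> V,
  [/\ forall x, x = \sum_i b x (dv i) *: bvec i,
      forall x, x = \sum_i b x (bvec i) *: dv i
    & forall f : V -> V, \tr (opmx f) = \sum_i b (f (bvec i)) (dv i)].
Proof.
have H i : exists z : V, forall y, b z y = v2r y 0 i.
  by apply: form_riesz => a x y; rewrite linearP !mxE.
have [dv dvE] := choice H; exists dv.
have E1 x : x = \sum_i b x (dv i) *: bvec i.
  by rewrite {1}[x]bvec_sum; apply: eq_bigr => i _; rewrite b_sym dvE.
split=> // [x|f].
  apply/eqP; rewrite -subr_eq0; apply/eqP/b_nondeg => y.
  rewrite (lin_mapB (b_linl _)) (lin_map_sum (b_linl _)) [y in b x y]bvec_sum.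
  rewrite (lin_map_sum (b_linr _)) -sumrB big1 // => i _.
  by rewrite (lin_mapZ (b_linr _)) (lin_mapZ (b_linl _)) dvE [_ *: _]mulrC subrr.
by apply: eq_bigr => i _; rewrite b_sym dvE mxE.
Qed.

End Forms.
End LinearMaps.

(** * The Killing form *)

Section Killing.
Variables (F : fieldType) (V : vectType F) (A : lie_algebra V).

Lemma lie_linr x : lin_map (br A x). Proof. by move=> a y z; apply: br_linr. Qed.

Lemma lie_linl y : lin_map ((br A)^~ y). Proof. by move=> a x z; apply: br_linl. Qed.

Lemma lie_anti x y : br A x y = - br A y x.
Proof.
apply/eqP; rewrite -addr_eq0; apply/eqP; have := br_alt A (x + y).
rewrite (lin_mapD (lie_linl _)) !(lin_mapD (lie_linr _)) !br_alt => <-.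
by rewrite add0r addr0.
Qed.

Lemma lie_jacobi x y z : br A (br A x y) z = br A x (br A y z) - br A y (br A x z).
Proof.
have := br_jacobi A x y z.
rewrite (lie_anti z x) (lin_mapN (lie_linr _)) (lie_anti z (br A x y)) => /eqP.
by rewrite subr_eq0 => /eqP <-.
Qed.

Definition ad x : 'M[F]_(dim V) := opmx (br A x).

Lemma ad_lin : lin_map ad.
Proof.
move=> a x y; rewrite -opmx_lin; apply: opmx_eq => v; exact: lie_linl.
Qed.

Lemma ad_br x y : ad (br A x y) = ad x * ad y - ad y * ad x.
Proof.
rewrite -!opmx_comp; try exact: lie_linr.
by rewrite -opmxB; apply: opmx_eq => v; exact: lie_jacobi.
Qed.

Definition killing x y : F := \tr (ad x * ad y).

Lemma killingC x y : killing x y = killing y x.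
Proof. exact: mxtraceC. Qed.

Lemma killing_linl y : lin_map (fun x => killing x y : F^o).
Proof.
by move=> a x z; rewrite /killing ad_lin mulrDl linearD /= -mulmxE -scalemxAl linearZ.
Qed.

Lemma killing_linr x : lin_map (fun y => killing x y : F^o).
Proof. by move=> a y z; rewrite !(killingC x); apply: killing_linl. Qed.

Lemma killing_br x y z : killing (br A x y) z = killing x (br A y z).
Proof.
rewrite /killing !ad_br mulrBl mulrBr !linearB /= !mulrA; congr (_ - _).
by rewrite -[ad y * ad x * ad z]mulrA mxtraceC.
Qed.

Lemma killing_brC x y z : killing (br A x y) z = - killing y (br A x z).
Proof. by rewrite lie_anti (lin_mapN (killing_linl _)) killing_br. Qed.

Lemma ideal_killing_orth I : ideal A I ->
  ideal A [set x | forall y, I y -> killing x y = 0].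
Proof.
move=> [I0 Il Ib]; split=> [y _|a x z Hx Hz y Iy|x z Hz y Iy].
- exact: (lin_map0 (killing_linl _)).
- by rewrite killing_linl Hx // Hz // scaler0 addr0.
- by rewrite killing_brC Hz ?oppr0 //; apply: Ib.
Qed.

Variables (C : numClosedFieldType) (f : {rmorphism F -> C}).

(** The radical of the Killing form is an ideal. Its derived series stabilizes, for dimension
    reasons, at a perfect [D N]; Cartan's criterion gives [ad = 0] on it, so the next term is zero
    and the radical is solvable. *)
Lemma semisimple_killing_nondeg : semisimple A ->
  forall x, (forall y, killing x y = 0) -> x = 0.
Proof.
move=> ss x Hx; pose k : set V := fun x => forall y, killing x y = 0.
have kI : ideal A k.
  have [//|a b c] := @ideal_killing_orth (fun=> True).
  split=> [y|a' u v Hu Hv y|u v Hv y]; first exact: (a y).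
    exact: (b a' u v (fun z _ => Hu z) (fun z _ => Hv z) y I).
  exact: (c u v (fun z _ => Hv z) y I).
apply: (ss k kI _ x Hx); case: kI => k0 kl kb.
pose D := derived_series A k.
have Dlin n : D n 0 /\ (forall a x y, D n x -> D n y -> D n (a *: x + y)).
  case: n => [|n] /=; first by split.
  by split; [exact: lspan0|move=> a u v; exact: lspan_lin].
have D_sub n : (D n.+1 `<=` D n)%classic.
  elim: n => [|n IH] u; apply: lspan_ind.
  - exact: k0.
  - by move=> a v w [v1 [v2 [_ Hv2 ->]]] _ Hw; apply: kl => //; apply: kb.
  - by case: (Dlin n.+1).
  - move=> a v w [v1 [v2 [H1 H2 ->]]] _ Hw; case: (Dlin n.+1) => _; apply=> //.
    by apply: lspan_sub; exists v1, v2; split=> //; apply: IH.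
have [U UE] := choice (fun n => linear_subset_vspace (proj1 (Dlin n)) (proj2 (Dlin n))).
have [N NE] : exists N, (D N `<=` D N.+1)%classic.
  apply: contrapT => no.
  have lt n : (\dim (U n.+1) < \dim (U n))%N.
    rewrite ltnNge; apply/negP => le; apply: no; exists n => u /UE; suff -> : U n = U n.+1 by move/UE.
    apply/esym/eqP; rewrite eqEdim le andbT; apply/subvP => w /UE/D_sub Dw.
    exact/UE.
  have le n : (\dim (U n) + n <= \dim (U 0%N))%N.
    by elim: n => [|n IH]; rewrite ?addn0 // addnS -addSn (leq_trans _ IH) // leq_add2r.
  have := le (\dim (U 0%N)).+1; rewrite leqNgt => /negP; apply.
  by rewrite addnS ltnS leq_addl.
have [|P PE] := @linear_subset_vspace _ _ (fun M => exists2 u, D N u & M = ad u)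
  (ex_intro2 _ _ 0 (proj1 (Dlin N)) (esym (lin_map0 ad_lin))) _.
  move=> a _ _ [u Du ->] [v Dv ->]; exists (a *: u + v); last by rewrite ad_lin.
  exact: (proj2 (Dlin N)).
have Dbr u v : D N u -> D N v -> D N (br A u v).
  by move=> Du Dv; apply: D_sub; apply: lspan_sub; exists u, v.
have Dk u : D N u -> k u.
  by elim: (N) u => [//|n IH] u /D_sub/IH.
have ad0 u : D N u -> ad u = 0.
  move=> Du; apply: (cartan_criterion f (P := P)); last by apply/PE; exists u.
  - move=> _ /PE[v /NE Dv ->]; case: Dv => r rD ->.
    have [r' r'P ->] : exists2 r' : seq (F * (V * V)),
        (forall z, z \in r' -> D N z.2.1 /\ D N z.2.2) &
        \sum_(z <- r) z.1 *: z.2 = \sum_(z <- r') z.1 *: br A z.2.1 z.2.2.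
      elim: r rD => [|z r IH] rD; first by exists [::]; rewrite ?big_nil.
      have [|r' r'P E] := IH; first by move=> w wr; apply: rD; rewrite inE wr orbT.
      have [v1 [v2 [D1 D2 zE]]] := rD z (mem_head _ _).
      exists ((z.1, (v1, v2)) :: r'); last by rewrite !big_cons E zE.
      by move=> w; rewrite inE => /orP[/eqP->|/r'P].
    exists [seq (z.1 *: ad z.2.1, ad z.2.2) | z <- r'].
      move=> _ /mapP[z /r'P[D1 D2] ->] /=; split; apply/PE; last by exists z.2.2.
      exists (z.1 *: z.2.1); last by rewrite (lin_mapZ ad_lin).
      by rewrite -[_ *: _]addr0; apply: (proj2 (Dlin N)) => //; case: (Dlin N).
    rewrite big_map (lin_map_sum ad_lin); apply: eq_bigr => z _.
    by rewrite (lin_mapZ ad_lin) ad_br /= -!mulmxE -scalemxAl -scalemxAr scalerBr.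
  - by move=> _ _ /PE[v Dv ->] /PE[w Dw ->]; apply/PE; exists (br A v w); [exact: Dbr|rewrite ad_br].
  - by move=> _ _ /PE[v Dv ->] /PE[w Dw ->]; apply: Dk.
exists N.+1; apply: (@lspan_ind _ _ _ (fun u => u = 0)) => // a v w [v1 [v2 [D1 D2 ->]]] _ ->.
rewrite addr0 -(lin_mapZ (lie_linl _)).
have := colv_op v2 (lie_linr (a *: v1)); rewrite -/(ad _) (lin_mapZ ad_lin) (ad0 _ D1).
rewrite scaler0 mul0mx => H; apply: colv_inj.
by rewrite H (lin_map0 (@colv_lin _ _)).
Qed.

End Killing.

(** * Whitehead's lemma *)

Section Whitehead.
Variables (F : fieldType) (C : numClosedFieldType) (f : {rmorphism F -> C}).
Variables (V : vectType F) (A : lie_algebra V).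
Hypothesis nondeg : forall x, (forall y, killing A x y = 0) -> x = 0.

Lemma natr_eq0_embedded n : (n%:R == 0 :> F) = (n == 0)%N.
Proof. by rewrite -(fmorph_eq0 f) rmorph_nat pnatr_eq0. Qed.

Lemma lie_center0 x : (forall y, br A x y = 0) -> x = 0.
Proof.
move=> Hx; apply: nondeg => y; rewrite /killing (_ : ad A x = 0) ?mul0r ?mxtrace0 //.
by apply/matrixP => i j; rewrite !mxE Hx linear0 mxE.
Qed.

(** The Killing orthogonal of the derived algebra is the center, which is zero. *)
Lemma lie_perfect x : exists r : seq (V * V), x = \sum_(z <- r) br A z.1 z.2.
Proof.
have [||U UE] := @linear_subset_vspace _ _ (fun x => exists r : seq (V * V), x = \sum_(z <- r) br A z.1 z.2).
- by exists [::]; rewrite big_nil.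
- move=> a _ _ [r ->] [t ->]; exists ([seq (a *: z.1, z.2) | z <- r] ++ t).
  rewrite big_cat big_map scaler_sumr; congr (_ + _).
  by apply: eq_bigr => z _; rewrite (lin_mapZ (lie_linl _ _)).
apply/UE; apply: (form_double_orth (killing_linl A) (killing_linr A) nondeg) => y yU.
suff -> : y = 0 by exact: (lin_map0 (killing_linl _ _)).
apply: lie_center0 => z; apply: nondeg => w; rewrite killing_br; apply: yU.
by apply/UE; exists [:: (z, w)]; rewrite big_seq1.
Qed.

(** An ideal commutes with its orthogonal. Hence [ad x * ad y * ad x = 0] for [x] in both, and
    [ad x * ad y] is nilpotent. *)
Lemma ideal_cap_orth0 I x : ideal A I -> I x -> (forall y, I y -> killing A x y = 0) -> x = 0.
Proof.
move=> II Ix Ox; have [I0 Il Ib] := II; have [O0 Ol Ob] := ideal_killing_orth II.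
have Ibr u v : I u -> I (br A u v).
  by move=> Iu; rewrite lie_anti -scaleN1r -[_ *: _]addr0; apply: Il => //; apply: Ib.
have ab u v : I u -> (forall y, I y -> killing A v y = 0) -> br A u v = 0.
  by move=> Iu Ov; apply: nondeg => y; rewrite killing_brC Ov ?oppr0 //; apply: Ibr.
apply: nondeg => y; apply: (@mxtrace_nilp _ _ _ 2).
rewrite expr2 mulrA (_ : _ * ad A x = 0) ?mul0r //.
rewrite -mulrA -(opmx_comp _ (lie_linr A y)) -(opmx_comp _ (lie_linr A x)).
apply/matrixP => i j; rewrite !mxE ab ?linear0 ?mxE //.
by apply: (Ob); rewrite lie_anti -scaleN1r -[_ *: _]addr0; apply: Ol => //; apply: Ob.
Qed.

Section Module.
Variables (N : nat) (sg : V -> 'M[F]_N).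
Hypothesis sg_lin : lin_map sg.
Hypothesis sg_br : forall x y, sg (br A x y) = sg x * sg y - sg y * sg x.

Section Stable.
Variable e : 'M[F]_N.
Hypothesis ee : e * e = e.
Hypothesis se : forall x, sg x * e = e * sg x * e.

(** The trace form of the submodule [im e]. Submodules are given by idempotents that need not
    commute with the action, since no invariant complement is available yet. *)
Let Be x y : F := \tr (e * (sg x * sg y)).

Let Be_linl y : lin_map (fun x => Be x y : F^o).
Proof.
move=> a x z; rewrite /Be sg_lin mulrDl mulrDr linearD /=.
by rewrite -!mulmxE -scalemxAl -scalemxAr linearZ.
Qed.

Let Be_linr y : lin_map (fun x => Be y x : F^o).
Proof.
move=> a x z; rewrite /Be sg_lin !mulrDr linearD /=.
by rewrite -!mulmxE -!scalemxAr linearZ.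
Qed.

Let es x : e * (sg x * e) = sg x * e.
Proof. by rewrite se !mulrA ee. Qed.

Let tr_e M : \tr (e * M) = \tr (e * (M * e)).
Proof. by rewrite mulrA [RHS]mxtraceC mulrA ee. Qed.

Let BeC x y : Be x y = Be y x.
Proof.
have H u v : Be u v = \tr (e * sg u * e * (e * sg v * e)).
  by rewrite /Be tr_e -!mulrA !es.
by rewrite !H mxtraceC.
Qed.

Let Be_br x y z : Be (br A x y) z = - Be y (br A x z).
Proof.
rewrite /Be !sg_br mulrBl !mulrBr !linearB /= opprB.
suff -> : \tr (e * (sg x * sg y * sg z)) = \tr (e * (sg y * (sg z * sg x))).
  by rewrite !mulrA.
have eM : sg y * sg z * e = e * (sg y * sg z * e).
  have -> : sg y * sg z * e = sg y * e * (sg z * e) by rewrite -!mulrA es.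
  by rewrite -[in LHS](es y) -mulrA.
rewrite mxtraceC [RHS]mxtraceC.
have -> : sg x * sg y * sg z * e = sg x * e * (sg y * sg z * e).
  by rewrite -[sg x * e * _]mulrA -eM !mulrA.
by rewrite mxtraceC -!mulrA es.
Qed.

(** [th] measures the trace form against the Killing form; as both are invariant, it is an
    endomorphism of the adjoint module. *)
Lemma trace_form_operator : exists th : V -> V,
  [/\ lin_map th, forall x y, Be x y = killing A (th x) y
    & forall x y, th (br A x y) = br A x (th y)].
Proof.
have H x : exists z, forall y, killing A z y = Be x y.
  exact: (form_riesz (killing_linl A) (killing_linr A) nondeg (Be_linr x)).
have [th thE] := choice H; exists th; split=> //.
- move=> a x y; apply/eqP; rewrite -subr_eq0; apply/eqP/nondeg => z.
  rewrite (lin_mapB (killing_linl _ _)) (killing_linl A) !thE (Be_linl z).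
  by rewrite subrr.
- move=> x y; apply/eqP; rewrite -subr_eq0; apply/eqP/nondeg => z.
  by rewrite (lin_mapB (killing_linl _ _)) killing_brC !thE Be_br subrr.
Qed.

(** Invariance of the Casimir tensor, the sum of the tensors of [bvec i] and [dv i]. *)
Lemma invariant_sum (W : lmodType F) (g : V -> V -> W) (dv : 'I_(dim V) -> V) x :
    (forall y, lin_map (g^~ y)) -> (forall y, lin_map (g y)) ->
    (forall v, v = \sum_i killing A v (dv i) *: bvec i) ->
    (forall v, v = \sum_i killing A v (bvec i) *: dv i) ->
  \sum_i (g (br A x (bvec i)) (dv i) + g (bvec i) (br A x (dv i))) = 0.
Proof.
move=> gl gr E1 E2; rewrite big_split /=.
under eq_bigr => i _ do rewrite [br A x (bvec i)]E1 (lin_map_sum (gl _)).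
under [X in _ + X]eq_bigr => i _ do rewrite [br A x (dv i)]E2 (lin_map_sum (gr _)).
rewrite exchange_big -big_split big1 //= => i _.
rewrite -big_split big1 //= => j _.
rewrite (lin_mapZ (gl _)) (lin_mapZ (gr _)) -scalerDl killing_brC.
by rewrite [killing A (bvec j) _]killingC addNr scale0r.
Qed.

(** The trace form may be degenerate, so [th] is inverted only on its Fitting component. This is
    nonzero: [ker th] is an ideal orthogonal to [im th], so they meet in 0 and [th] is not
    nilpotent. The trace of [th] after [h] is then a nonzero rank. *)
Lemma equivariant_multiplier th : lin_map th ->
    (forall x y, Be x y = killing A (th x) y) ->
    (forall x y, th (br A x y) = br A x (th y)) -> (exists x, th x <> 0) ->
  exists h : V -> V, [/\ lin_map h, forall x y, h (br A x y) = br A x (h y)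
    & \tr (opmx (fun v => th (h v))) != 0].
Proof.
move=> thl thB thbr [x0 x0P]; pose T := opmx th.
have kerI : ideal A (fun x => th x = 0).
  split; [exact: lin_map0|move=> a x y Hx Hy|move=> x y Hy].
    by rewrite thl Hx Hy scaler0 addr0.
  by rewrite thbr Hy (lin_map0 (lie_linr A x)).
have ker_im u : th (th u) = 0 -> th u = 0.
  move=> uu; apply: (ideal_cap_orth0 kerI) => // y y0.
  by rewrite -thB BeC thB y0 (lin_map0 (killing_linl _ _)).
have Tn k : T ^+ k != 0.
  have itE j v : colv (iter j th v) = T ^+ j *m colv v.
    elim: j => [|j IH]; first by rewrite expr0 mul1mx.
    by rewrite iterS (colv_op _ thl) IH exprS -mulmxE mulmxA.
  have itn j : iter j.+1 th x0 <> 0.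
    by elim: j => [|j IH] //; rewrite iterS /= => /ker_im.
  apply/negP => /eqP Tk; apply: (itn k); apply: colv_inj.
  by rewrite itE exprS Tk mulr0 mul0mx (lin_map0 (@colv_lin _ _)).
have [p [eT eT0]] := fitting_inverse Tn.
exists (mxop (hmx T p)); split; first exact: mxop_lin.
  move=> x y; apply: colv_inj; rewrite colv_mxop !(colv_op _ (lie_linr A x)) colv_mxop.
  rewrite !mulmxA !mulmxE hmx_comm // -!opmx_comp //; last exact: lie_linr.
  by apply: opmx_eq => v; rewrite thbr.
rewrite (opmx_comp _ thl) mxopK -/T -hmx_comm // mxtrace_idem //.
by rewrite natr_eq0_embedded mxrank_eq0.
Qed.

End Stable.

Variable fc : V -> 'cV[F]_N.
Hypothesis fc_lin : lin_map fc.

(** Induction on the dimension of the submodule [im e]. If its trace form is zero, Cartan's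
    criterion makes the action zero and perfectness kills the cocycle. Otherwise a Casimir operator
    that is not nilpotent splits off a nonzero part on which it is invertible, and the cocycle is
    solved there. *)
Theorem whitehead (e : 'M[F]_N) : e * e = e ->
    (forall x, sg x * e = e * sg x * e) ->
    (forall x y, e *m fc (br A x y) = sg x *m (e *m fc y) - sg y *m (e *m fc x)) ->
  exists2 m, e *m m = m & forall x, e *m fc x = sg x *m m.
Proof.
have [r] := ubnP (\rank e); elim: r e => // r IH e /ltnSE er ee se fcb.
have es x : e * (sg x * e) = sg x * e by rewrite se !mulrA ee.
have [Be0|/existsNP[x0 /existsNP[y0 B0]]] :=
    pselect (forall x y, \tr (e * (sg x * sg y)) = 0).
  have sg0 x : sg x * e = 0.
    have [||P PE] := @linear_subset_vspace _ _ (fun M => exists x, M = sg x * e).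
    - by exists 0; rewrite (lin_map0 sg_lin) mul0r.
    - move=> a _ _ [u ->] [v ->]; exists (a *: u + v).
      by rewrite sg_lin mulrDl -mulmxE -scalemxAl.
    have PB u v : sg u * e * (sg v * e) - sg v * e * (sg u * e) = sg (br A u v) * e.
      by rewrite sg_br mulrBl -!mulrA !es.
    apply: (cartan_criterion f (P := P)); last by apply/PE; exists x.
    - move=> _ /PE[u ->]; have [t ->] := lie_perfect u.
      exists [seq (sg z.1 * e, sg z.2 * e) | z <- t].
        by move=> _ /mapP[z _ ->] /=; split; apply/PE; [exists z.1|exists z.2].
      rewrite big_map (lin_map_sum sg_lin) mulr_suml; apply: eq_bigr => z _.
      by rewrite PB.
    - by move=> _ _ /PE[u ->] /PE[v ->]; apply/PE; exists (br A u v); rewrite PB.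
    move=> _ _ /PE[u ->] /PE[v ->].
    by rewrite -!mulrA es mulrA mxtraceC Be0.
  exists 0 => [|x]; rewrite mulmx0 //; have [t ->] := lie_perfect x.
  rewrite (lin_map_sum fc_lin) mulmx_sumr big1 // => z _.
  by rewrite fcb !mulmxA !mulmxE !sg0 !mul0mx subrr.
have [th [thl thB thbr]] := trace_form_operator ee se.
have [|h [hl hbr htr]] := equivariant_multiplier ee se thl thB thbr.
  exists x0 => t0; apply: B0; rewrite thB t0; exact: (lin_map0 (killing_linl _ _)).
have [dv [E1 E2 E3]] :=
  form_dual_basis (killing_linl A) (killing_linr A) nondeg (@killingC _ _ A).
(* The Casimir operator twisted by [h], and the vector obtained by putting the cocycle in place of
   its second factor: applying [sg x] to [mh] gives [Om] applied to the cocycle, so [mh] solves the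
   equation up to [Om]. *)
pose Om := \sum_i sg (h (bvec i)) * sg (dv i).
pose mh := \sum_i sg (h (bvec i)) *m (e *m fc (dv i)).
have sgl2 (v : V) : lin_map (fun u => sg (h u) * sg v).
  by move=> a u w; rewrite hl sg_lin mulrDl -mulmxE -scalemxAl.
have sgr2 (u : V) : lin_map (fun v => sg (h u) * sg v).
  by move=> a v w; rewrite sg_lin mulrDr -mulmxE -scalemxAr.
have fcl2 (v : V) : lin_map (fun u => sg (h u) *m (e *m fc v)).
  by move=> a u w; rewrite hl sg_lin mulmxDl -scalemxAl.
have fcr2 (u : V) : lin_map (fun v => sg (h u) *m (e *m fc v)).
  by move=> a v w; rewrite fc_lin !mulmxDr -!scalemxAr.
have OmC x : sg x * Om = Om * sg x.
  apply/eqP; rewrite -subr_eq0 mulr_sumr mulr_suml -sumrB; apply/eqP.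
  rewrite -[RHS](invariant_sum x sgl2 sgr2 E1 E2); apply: eq_bigr => i _.
  rewrite hbr !sg_br mulrBl mulrBr !mulrA; zmod.
have mhC x : sg x *m mh = Om *m (e *m fc x).
  apply/eqP; rewrite -subr_eq0 mulmx_sumr mulmx_suml -sumrB; apply/eqP.
  rewrite -[RHS](invariant_sum x fcl2 fcr2 E1 E2); apply: eq_bigr => i _.
  by rewrite hbr !sg_br fcb mulmxBl mulmxBr -!mulmxE !mulmxA; zmod.
have es2 x y : e * (sg x * (sg y * e)) = sg x * (sg y * e).
  by rewrite -[in LHS](es y) (mulrA (sg x)) (mulrA e) es -mulrA es.
have [u uE] : exists u, u = Om * e by exists (Om * e).
have eu : e * u = u.
  rewrite uE mulr_suml mulr_sumr; apply: eq_bigr => i _.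
  by rewrite -mulrA es2.
have ue : u * e = u by rewrite uE -mulrA ee.
have emh : e *m mh = mh.
  rewrite mulmx_sumr; apply: eq_bigr => i _.
  by rewrite !mulmxA !mulmxE -mulrA es.
have tru : \tr (opmx (fun v => th (h v))) = \tr u.
  rewrite E3 uE mulr_suml linear_sum; apply: eq_bigr => i _.
  by rewrite -thB mxtraceC.
have un k : u ^+ k != 0.
  by apply: contraNneq htr => /mxtrace_nilp; rewrite tru => ->.
(* [e1] projects onto the Fitting component of the Casimir operator and [W] inverts the operator
   there. *)
have [p [e1e e1n0]] := fitting_inverse un.
set W := hmx u p in e1e e1n0; set e1 := W * u in e1e e1n0.
have Wu : W * u = u * W by rewrite /W hmx_comm.
have e1l : e * e1 = e1 by rewrite /e1 Wu mulrA eu.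
have e1r : e1 * e = e1 by rewrite /e1 -mulrA ue.
have sue x : sg x * u = u * (sg x * e).
  by rewrite uE mulrA OmC -!mulrA es.
have suk x k : sg x * (u ^+ k * e) = u ^+ k * (sg x * e).
  elim: k => [|k IHk]; first by rewrite expr0 !mul1r.
  have -> : u ^+ k.+1 * e = u ^+ k * e * u by rewrite exprSr -!mulrA ue eu.
  by rewrite mulrA IHk -!mulrA eu sue exprSr mulrA.
have sWe x : sg x * (W * e) = W * (sg x * e).
  rewrite /W /hmx !mulr_suml !mulr_sumr; apply: eq_bigr => i _.
  by rewrite -!mulmxE -!scalemxAl -!scalemxAr !mulmxE suk.
have se1 x : sg x * e1 = e1 * (sg x * e).
  have {1}-> : e1 = W * e * u by rewrite -mulrA eu.
  by rewrite mulrA sWe -!mulrA eu sue mulrA.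
have [e0 e0E] : exists e0, e0 = e - e1 by exists (e - e1).
have e0e : e0 * e0 = e0.
  by rewrite e0E mulrBl !mulrBr ee e1l e1r e1e; zmod.
have e0l : e0 * e = e0 by rewrite e0E mulrBl ee e1r.
have se0 x : sg x * e0 = e0 * (sg x * e).
  by rewrite e0E mulrBr mulrBl es se1.
have se0' x : sg x * e0 = e0 * sg x * e0.
  have H : e0 * (sg x * e1) = 0 by rewrite se1 mulrA e0E mulrBl e1l e1e subrr mul0r.
  by rewrite {3}e0E mulrBr -[e0 * sg x * e1]mulrA H subr0 -mulrA se0.
have [||m em mE] := IH e0 _ e0e se0'.
(* The ranks are compared through traces of idempotents, which add up; [F] has characteristic 0
   because of [f]. *)
- apply: leq_trans er; rewrite -subn_gt0.
  have : (\rank e)%:R = (\rank e0 + \rank e1)%:R :> F.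
    by rewrite natrD -!mxtrace_idem // e0E linearB subrK.
  move/eqP; rewrite -(fmorph_eq f) !rmorph_nat eqr_nat => /eqP->.
  by rewrite addKn lt0n mxrank_eq0.
- move=> x y; have H z w : sg z *m (e0 *m fc w) = e0 *m (sg z *m (e *m fc w)).
    by rewrite !mulmxA !mulmxE se0 mulrA.
  by rewrite !H -mulmxBr -fcb mulmxA mulmxE e0l.
have eWe : e * (W * e) = W * e.
  rewrite /W /hmx !mulr_suml !mulr_sumr; apply: eq_bigr => i _.
  rewrite -!mulmxE -!scalemxAl -!scalemxAr !mulmxE; congr (_ *: _).
  by case: (val i) => [|k]; rewrite ?expr0 ?mul1r ?ee // exprS !mulrA eu.
exists (m + W *m mh) => [|x].
  rewrite mulmxDr -{1}em mulmxA mulmxE (_ : e * e0 = e0) ?em; last first.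
    by rewrite e0E mulrBr ee e1l.
  by rewrite -emh !mulmxA !mulmxE -mulrA eWe.
rewrite mulmxDr -mE.
have -> : sg x *m (W *m mh) = e1 *m fc x.
  rewrite -emh !mulmxA !mulmxE -mulrA sWe -!mulmxE -!mulmxA emh mhC.
  by rewrite !mulmxA !mulmxE -mulrA uE.
by rewrite e0E mulmxBl subrK.
Qed.

End Module.
End Whitehead.

(** * Graded modules *)

Section HomogeneousComponents.
Variables (F : fieldType).

Section Lmod.
Variables (V : lmodType F) (g : gradation V).

Lemma homog0 p : gr g p 0. Proof. exact: gr0. Qed.

Lemma homogD p x y : gr g p x -> gr g p y -> gr g p (x + y).
Proof. by move=> px py; have := gr_lin 1 px py; rewrite scale1r. Qed.

Lemma homogZ p a x : gr g p x -> gr g p (a *: x).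
Proof. by move=> px; have := gr_lin a px (homog0 p); rewrite addr0. Qed.

Lemma homogN p x : gr g p x -> gr g p (- x).
Proof. by rewrite -scaleN1r; apply: homogZ. Qed.

Lemma homogB p x y : gr g p x -> gr g p y -> gr g p (x - y).
Proof. by move=> px /homogN; apply: homogD. Qed.

Lemma homog_decomposition v : exists fr : (int -> V) * seq int,
  [/\ uniq fr.2, forall p, gr g p (fr.1 p), forall p, p \notin fr.2 -> fr.1 p = 0
    & v = \sum_(p <- fr.2) fr.1 p].
Proof.
move: v (gr_span g v); apply: lspan_ind => [|a x y [p px] _ [[fv r] /= [ur fP f0 ->]]].
  by exists (fun=> 0, [::]); split=> //= [p|]; [exact: homog0|rewrite big_nil].
pose r' := undup (p :: r); pose f' q := (if q == p then a *: x else 0) + fv q.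
exists (f', r'); split=> /= [|q|q|].
- exact: undup_uniq.
- by apply: homogD => //; case: eqVneq => [->|_]; [exact: homogZ|exact: homog0].
- rewrite mem_undup inE negb_or => /andP[qp qr]; rewrite /f' (negbTE qp) f0 ?addr0 //.
rewrite big_split /=; congr (_ + _).
  rewrite (bigD1_seq p) ?undup_uniq ?mem_undup ?mem_head //= eqxx big1 ?addr0 //.
  by move=> q /negbTE->.
rewrite [RHS](bigID (mem r)) /= [X in _ + X]big1 ?addr0; last by move=> q /f0.
rewrite -[RHS]big_filter; apply: perm_big; apply: uniq_perm => //.
  exact/filter_uniq/undup_uniq.
by move=> q; rewrite mem_filter mem_undup inE /=; case: (q \in r); rewrite ?orbT.
Qed.

Definition component (p : int) (v : V) : V := (sval (cid (homog_decomposition v))).1 p.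

Lemma component_homog p v : gr g p (component p v).
Proof. by rewrite /component; case: cid => fr [_ H _ _] /=. Qed.

Lemma component_unique v (r : seq int) (h : int -> V) : uniq r ->
  (forall p, gr g p (h p)) -> (forall p, p \notin r -> h p = 0) ->
  v = \sum_(p <- r) h p -> forall p, component p v = h p.
Proof.
move=> ur hP h0 vE p; rewrite /component; case: cid => -[h' r'] /= [ur' hP' h0' vE'].
pose u := undup (p :: r ++ r'); have uu : uniq u := undup_uniq _.
have ext (t : seq int) k : uniq t -> {subset t <= u} -> (forall q, q \notin t -> k q = 0 :> V) ->
    \sum_(q <- t) k q = \sum_(q <- u) k q.
  move=> ut tu k0; rewrite [RHS](bigID (mem t)) /= [X in _ + X]big1 ?addr0 //.
  rewrite -[RHS]big_filter; apply: perm_big; apply: uniq_perm => //; first exact: filter_uniq.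
  by move=> q; rewrite mem_filter /=; case: (boolP (q \in t)) => // /tu.
apply/eqP; rewrite -subr_eq0; apply/eqP.
apply: (gr_free (g := g) (f := fun q => h' q - h q) uu) => [q||].
- exact: homogB.
- rewrite sumrB -(ext r') // => [|q qr]; last by rewrite mem_undup inE mem_cat qr !orbT.
  rewrite -(ext r) // => [|q qr]; last by rewrite mem_undup inE mem_cat qr !orbT.
  by rewrite -vE -vE' subrr.
- by rewrite mem_undup mem_head.
Qed.

Lemma component_lin p : lin_map (component p).
Proof.
move=> a x y; have [[f r] /= [ur fP f0 xE]] := homog_decomposition x.
have [[f' r'] /= [ur' fP' f0' yE]] := homog_decomposition y.
rewrite (component_unique ur fP f0 xE) (component_unique ur' fP' f0' yE).
pose u := undup (r ++ r').
have ext (t : seq int) k : uniq t -> {subset t <= u} -> (forall q, q \notin t -> k q = 0 :> V) ->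
    \sum_(q <- t) k q = \sum_(q <- u) k q.
  move=> ut tu k0; rewrite [RHS](bigID (mem t)) /= [X in _ + X]big1 ?addr0 //.
  rewrite -[RHS]big_filter; apply: perm_big; apply: uniq_perm => //; first exact/filter_uniq/undup_uniq.
  by move=> q; rewrite mem_filter /=; case: (boolP (q \in t)) => // /tu.
apply: (@component_unique _ u (fun q => a *: f q + f' q)) => [|q|q|].
- exact: undup_uniq.
- exact: gr_lin.
- by rewrite mem_undup mem_cat negb_or => /andP[/f0-> /f0'->]; rewrite scaler0 addr0.
rewrite big_split -scaler_sumr xE yE -(ext r) // => [|q qr]; last by rewrite mem_undup mem_cat qr.
by rewrite -(ext r') // => q qr; rewrite mem_undup mem_cat qr orbT.
Qed.

Lemma component_id p v : gr g p v -> component p v = v.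
Proof.
move=> pv; rewrite (@component_unique v [:: p] (fun q => if q == p then v else 0)) ?eqxx //.
- by move=> q; case: eqVneq => [->|_] //; exact: homog0.
- by move=> q; rewrite inE => /negbTE->.
by rewrite big_seq1 eqxx.
Qed.

Lemma component_neq p q v : gr g q v -> p != q -> component p v = 0.
Proof.
move=> qv pq; rewrite (@component_unique v [:: q] (fun p => if p == q then v else 0)) ?(negbTE pq) //.
- by move=> k; case: eqVneq => [->|_] //; exact: homog0.
- by move=> k; rewrite inE => /negbTE->.
by rewrite big_seq1 eqxx.
Qed.

End Lmod.

Section Vect.
Variables (V : vectType F) (g : gradation V).

Lemma finite_support : exists ps : seq int, [/\ uniq ps,
  forall v, v = \sum_(p <- ps) component g p v &
  forall p v, p \notin ps -> component g p v = 0].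
Proof.
have /choice[r rP] : forall v : V, exists r : seq int, uniq r /\
    (forall p, p \notin r -> component g p v = 0) /\ v = \sum_(p <- r) component g p v.
  move=> v; have [[f r] /= [ur fP f0 vE]] := homog_decomposition g v.
  have fE := component_unique ur fP f0 vE.
  exists r; split=> //; split=> [p /f0 <-|] //; rewrite {1}vE; exact: eq_bigr.
pose ps := undup (flatten [seq r (@bvec _ V i) | i : 'I_(dim V)]).
have c0 p v : p \notin ps -> component g p v = 0.
  rewrite mem_undup => /flatten_mapP pps; rewrite (bvec_sum v) (lin_map_sum (component_lin g p)).
  rewrite big1 // => i _; rewrite (lin_mapZ (component_lin g p)).
  have [_ [-> //]] := rP (@bvec _ V i); first by rewrite scaler0.
  by apply/negP => pr; apply: pps; exists i => //; rewrite mem_enum.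
exists ps; split=> // [|v]; first exact: undup_uniq.
have [ur [r0 vE]] := rP v; rewrite {1}vE (bigID (mem ps)) /= [X in _ + X]big1 ?addr0; last first.
  by move=> p /c0.
rewrite [RHS](bigID (mem (r v))) /= [X in _ = _ + X]big1 ?addr0; last by move=> p /r0.
rewrite -[LHS]big_filter -[RHS]big_filter; apply: perm_big; apply: uniq_perm; first exact: filter_uniq.
  exact/filter_uniq/undup_uniq.
by move=> p; rewrite !mem_filter andbC.
Qed.

Definition gsupp : seq int := sval (cid finite_support).

Lemma gsupp_uniq : uniq gsupp.
Proof. by rewrite /gsupp; case: cid => ps /= []. Qed.

Lemma component_sum v : v = \sum_(p <- gsupp) component g p v.
Proof. by rewrite /gsupp; case: cid => ps /= []. Qed.

Lemma component_nsupp p v : p \notin gsupp -> component g p v = 0.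
Proof. by rewrite /gsupp; case: cid => ps /= [_ _]; apply. Qed.

Lemma homog_ext (W : lmodType F) (f h : V -> W) : lin_map f -> lin_map h ->
  (forall p v, gr g p v -> f v = h v) -> forall v, f v = h v.
Proof.
move=> fl hl fh v; rewrite (component_sum v) (lin_map_sum fl) (lin_map_sum hl).
by apply: eq_bigr => p _; apply/fh/component_homog.
Qed.

Definition degree_op (v : V) : V := \sum_(p <- gsupp) p%:~R *: component g p v.

Lemma degree_op_lin : lin_map degree_op.
Proof.
move=> a x y; rewrite /degree_op scaler_sumr -big_split; apply: eq_bigr => p _ /=.
by rewrite component_lin scalerDr !scalerA [a * _]mulrC.
Qed.

Lemma degree_opE p v : gr g p v -> degree_op v = p%:~R *: v.
Proof.
move=> pv; rewrite {2}(component_sum v) scaler_sumr; apply: eq_bigr => q _.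
by have [->//|qp] := eqVneq q p; rewrite (component_neq pv qp) !scaler0.
Qed.

End Vect.
End HomogeneousComponents.

Section GradedModules.
Variables (F : numFieldType) (s : lmodType F) (S : graded_lie s).

Section Lmod.
Variables (l : lmodType F) (L : graded_module S l).

Lemma act_lin x : lin_map (act L x). Proof. by move=> a y z; apply: act_linr. Qed.

Lemma actl_lin y : lin_map ((act L)^~ y). Proof. by move=> a x z; apply: act_linl. Qed.

Lemma component_act p k x y : gr S p x ->
  component L k (act L x y) = act L x (component L (k - p) y).
Proof.
move=> px; move: y (gr_span L y); apply: lspan_ind => [|a y z [q qy] _ IH].
  by rewrite !(lin_map0 (component_lin _ _)) (lin_map0 (act_lin _)) (lin_map0 (component_lin _ _)).
rewrite act_lin !component_lin act_lin IH; congr (_ *: _ + _).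
have [kE|kE] := eqVneq (k - p) q.
  rewrite kE (component_id qy); have <- : p + q = k by rewrite -kE addrC subrK.
  exact/component_id/gm_act.
rewrite (component_neq qy kE) (lin_map0 (act_lin _)).
rewrite (component_neq (gm_act px qy)) //; apply: contraNneq kE => ->.
by rewrite addrAC subrr add0r.
Qed.

(** Only [s_(-1)] and [s_0] are used as generators. Stability under [s_1] follows by commuting it to
    the right, where it kills the singular vectors, and all degrees stay at most [-2]. *)
Inductive singular_span : l -> Prop :=
| SingularSpan0 : singular_span 0
| SingularSpanLin a x y : singular_span x -> singular_span y -> singular_span (a *: x + y)
| SingularSpanGen k y : k <= - 2 -> gr L k y ->
    (forall x, gr S 1 x -> act L x y = 0) -> singular_span y
| SingularSpanAct p x y : p = - 1 \/ p = 0 -> gr S p x -> singular_span y ->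
    singular_span (act L x y).

Lemma singular_span_raise x y : gr S 1 x -> singular_span y -> singular_span (act L x y).
Proof.
move=> x1 sy; elim: sy x x1 => [|a u v _ IHu _ IHv|k u _ _ u0|p u v pE pu sv IH] x x1.
- by rewrite (lin_map0 (act_lin _)); exact: SingularSpan0.
- by rewrite act_lin; apply: SingularSpanLin; [exact: IHu|exact: IHv].
- by rewrite u0 //; exact: SingularSpan0.
have -> : act L x (act L u v) = 1 *: act L (br S x u) v + act L u (act L x v).
  by rewrite act_br scale1r subrK.
apply: SingularSpanLin; last by apply: SingularSpanAct pE pu (IH _ x1).
have := gl_br x1 pu; case: pE => -> xu; last exact: IH.
by apply: (@SingularSpanAct 0) => //; right.
Qed.

Lemma singular_span_component y p : singular_span y ->
  singular_span (component L p y) /\ (- 2 < p -> component L p y = 0).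
Proof.
move=> sy; elim: sy p => [|a u v _ IHu _ IHv|k u k2 ku u0|q u v qE qu sv IH] p.
- by rewrite (lin_map0 (component_lin _ _)); split=> //; exact: SingularSpan0.
- rewrite component_lin; have [su u0] := IHu p; have [svv v0] := IHv p.
  split=> [|p2]; first exact: SingularSpanLin.
  by rewrite u0 // v0 // scaler0 addr0.
- have [->|pk] := eqVneq p k.
    rewrite component_id //; split; first exact: SingularSpanGen k2 ku u0.
    by rewrite ltNge k2.
  by rewrite (component_neq ku) //; split=> //; exact: SingularSpan0.
rewrite (component_act _ _ qu); have [sc c0] := IH (p - q).
split=> [|p2]; first exact: SingularSpanAct qE qu sc.
rewrite c0 ?(lin_map0 (act_lin _)) // (lt_le_trans p2) // lerDl oppr_ge0.
by case: qE => ->.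
Qed.

End Lmod.

Section Vect.
Variables (l : vectType F) (L : graded_module S l).

Definition rho x : 'M[F]_(dim l) := opmx (act L x).

Lemma rho_lin : lin_map rho.
Proof. by move=> a x y; rewrite -opmx_lin; apply: opmx_eq => v; exact: actl_lin. Qed.

Lemma rho_br x y : rho (br S x y) = rho x * rho y - rho y * rho x.
Proof.
rewrite -!opmx_comp; try exact: act_lin.
by rewrite -opmxB; apply: opmx_eq => v; exact: act_br.
Qed.

Definition degree_mx : 'M[F]_(dim l) := opmx (degree_op L).

Lemma degree_mx_rho p x : gr S p x -> degree_mx * rho x = rho x * degree_mx + p%:~R *: rho x.
Proof.
move=> px; rewrite -!opmx_comp; try exact: act_lin; last exact: degree_op_lin.
rewrite addrC -opmx_lin; apply: opmx_eq.
apply: (homog_ext (g := L)) => [a u v|a u v|q v qv].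
- by rewrite act_lin degree_op_lin.
- rewrite degree_op_lin !act_lin !scalerDr addrACA.
  by congr (_ + _ + _); rewrite !scalerA mulrC.
rewrite (degree_opE qv) (lin_mapZ (act_lin L _)) (degree_opE (gm_act px qv)).
by rewrite intrD scalerDl.
Qed.

Definition component_mx p : 'M[F]_(dim l) := opmx (component L p).

Lemma degree_mxE : degree_mx = \sum_(p <- gsupp L) p%:~R *: component_mx p.
Proof.
rewrite /degree_mx /degree_op; apply/matrixP => i j; rewrite mxE linear_sum summxE !summxE.
by apply: eq_bigr => p _; rewrite linearZ !mxE.
Qed.

Lemma component_mx_idem p : component_mx p * component_mx p = component_mx p.
Proof.
rewrite -opmx_comp; last exact: component_lin.
by apply: opmx_eq => v; rewrite component_id //; exact: component_homog.
Qed.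

End Vect.
End GradedModules.

(** * Semisimple graded algebras *)

Section SemisimpleGraded.
Variables (R : rcfType) (s : vectType R) (S : graded_lie s).
Hypothesis nondeg : forall x, (forall y, killing S x y = 0) -> x = 0.

Lemma degree_mx_ad p x : gr S p x ->
  degree_mx (adjoint S) * ad S x = ad S x * degree_mx (adjoint S) + p%:~R *: ad S x.
Proof. exact: (@degree_mx_rho _ _ _ _ (adjoint S)). Qed.

(** The commutator of the degree operator with [ad x * ad y] is [p + q] times this product, and has
    trace 0. *)
Lemma killing_degree p q x y : gr S p x -> gr S q y -> p + q != 0 -> killing S x y = 0.
Proof.
move=> px qy pq; set D := degree_mx (adjoint S).
have : D * (ad S x * ad S y) - ad S x * ad S y * D = (p + q)%:~R *: (ad S x * ad S y).
  rewrite mulrA (degree_mx_ad px) mulrDl -[ad S x * D * ad S y]mulrA (degree_mx_ad qy) mulrDr.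
  rewrite -!mulmxE -scalemxAl -!scalemxAr !mulmxE -!mulrA intrD scalerDl; zmod.
move/(congr1 mxtrace); rewrite linearB /= [X in _ - X]mxtraceC subrr linearZ /=.
by move/esym/eqP; rewrite mulf_eq0 intr_eq0 (negbTE pq) => /eqP.
Qed.

Lemma killing_component p x y : gr S p x -> killing S x y = killing S x (component S (- p) y).
Proof.
move=> px; rewrite {1}(component_sum S y) (lin_map_sum (killing_linr S x)).
have [ps|ps] := boolP (- p \in gsupp S).
  rewrite (bigD1_seq (- p)) ?gsupp_uniq //= big1 ?addr0 // => q qp.
  apply: (killing_degree px (component_homog S q y)); apply: contraNneq qp => /eqP.
  by rewrite addrC addr_eq0.
rewrite big_seq big1 => [|q qs].
  by rewrite component_nsupp // (lin_map0 (killing_linr _ _)).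
apply: (killing_degree px (component_homog S q y)); apply: contraNneq ps => /eqP.
by rewrite addrC addr_eq0 => /eqP<-.
Qed.

Lemma killing_homog_nondeg p x : gr S p x ->
  (forall y, gr S (- p) y -> killing S x y = 0) -> x = 0.
Proof.
move=> px H; apply: nondeg => y; rewrite (killing_component y px) H //.
exact: component_homog.
Qed.

Lemma killing_riesz_homog p (phi : s -> R) : lin_map (phi : s -> R^o) ->
  exists2 z, gr S p z & forall y, gr S (- p) y -> killing S z y = phi y.
Proof.
move=> phil; have [z zE] := form_riesz (killing_linl S) (killing_linr S) nondeg phil.
exists (component S p z) => [|y py]; first exact: component_homog.
rewrite -zE killingC [RHS]killingC [in RHS](killing_component z py).
by rewrite opprK.
Qed.

(** The degree derivation is inner: [z] represents the form sending [x] to [tr (D * ad x)], and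
    testing [[z, x]] against [y] gives the trace of [D * [ad x, ad y]], which is [p] times the
    Killing form. *)
Lemma grading_element : exists2 E, gr S 0 E & forall p x, gr S p x -> br S E x = p%:~R *: x.
Proof.
pose D := degree_mx (adjoint S); have [|z zE] := form_riesz (killing_linl S) (killing_linr S) nondeg
  (phi := fun x => \tr (D * ad S x)).
  by move=> a x y; rewrite ad_lin mulrDr linearD /= -mulmxE -scalemxAr linearZ.
have zbr p x : gr S p x -> br S z x = p%:~R *: x.
  move=> px; apply/eqP; rewrite -subr_eq0; apply/eqP/nondeg => y.
  rewrite (lin_mapB (killing_linl _ _)) (lin_mapZ (killing_linl _ _)) killing_br zE ad_br.
  apply/eqP; rewrite subr_eq0 mulrBr linearB /= !mulrA (degree_mx_ad px) mulrDl linearD /=.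
  rewrite -[D * ad S y * ad S x]mulrA [\tr (D * _)]mxtraceC.
  have -> : \tr (ad S x * D * ad S y) = \tr (ad S y * ad S x * D).
    by rewrite mxtraceC mulrA.
  by rewrite addrAC subrr add0r -mulmxE -scalemxAl linearZ.
exists (component S 0 z) => [|p x px]; first exact: component_homog.
have := @component_act _ _ _ _ (adjoint S) p p x z px.
rewrite subrr /= lie_anti (zbr _ _ px) => H.
rewrite lie_anti -H (lin_mapN (component_lin _ _)) opprK component_id //.
exact: homogZ.
Qed.

Section Transitive.
Hypothesis tr : transitive_algebra S.

(** An element of [s_0] orthogonal to all these brackets annihilates [s_(-1)] by invariance, and is
    zero by transitivity. *)
Lemma degree0_brackets x : gr S 0 x ->
  exists2 r : seq (s * s), forall z, z \in r -> gr S 1 z.1 /\ gr S (-1) z.2 &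
    x = \sum_(z <- r) br S z.1 z.2.
Proof.
move=> x0.
have [||U UE] := @linear_subset_vspace _ _ (fun x => exists2 r : seq (s * s),
  forall z, z \in r -> gr S 1 z.1 /\ gr S (-1) z.2 & x = \sum_(z <- r) br S z.1 z.2).
- by exists [::]; rewrite ?big_nil.
- move=> a _ _ [r rP ->] [t tP ->]; exists ([seq (a *: z.1, z.2) | z <- r] ++ t).
    move=> z; rewrite mem_cat => /orP[/mapP[w /rP[w1 w2] ->]|/tP //].
    by split=> //; apply: homogZ.
  rewrite big_cat big_map scaler_sumr; congr (_ + _).
  by apply: eq_bigr => z _; rewrite (lin_mapZ (lie_linl _ _)).
apply/UE; apply: (form_double_orth (killing_linl S) (killing_linr S) nondeg) => y yU.
rewrite killingC (killing_component _ x0) oppr0; set y0 := component S 0 y.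
suff -> : y0 = 0 by exact: (lin_map0 (killing_linr _ _)).
have y00 : gr S 0 y0 := component_homog S 0 y.
apply: contrapT => yn; have [u u1 un] := tr (lexx _) y00 yn; apply: un => /=.
rewrite lie_anti; apply/eqP; rewrite oppr_eq0; apply/eqP.
apply: (@killing_homog_nondeg (-1)) => [|v v1].
  by have := gl_br y00 u1; rewrite add0r.
rewrite opprK in v1; have uv0 : gr S 0 (br S v u) by have := gl_br v1 u1; rewrite subrr.
have : killing S y (br S v u) = 0.
  by apply: yU; apply/UE; exists [:: (v, u)]; rewrite ?big_seq1 // => z; rewrite inE => /eqP->.
rewrite killingC (killing_component _ uv0) oppr0 -/y0 killingC => H.
by rewrite killing_br lie_anti (lin_mapN (killing_linr _ _)) H oppr0.
Qed.

(** The span [U] of singular vectors is stable under [s_1] and [s_(-1)], so the grading element, a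
    sum of their brackets, has trace 0 on [U]. The degrees on [U] being at most [-2], every
    component of [U] is zero. [U] is not known to be an ideal at this point. *)
Lemma singular_adjoint0 k y : k <= - 2 -> gr S k y ->
  (forall x, gr S 1 x -> br S x y = 0) -> y = 0.
Proof.
move=> k2 ky y0.
have [||U UE] := @linear_subset_vspace _ _ (singular_span (adjoint S)).
- exact: SingularSpan0.
- exact: SingularSpanLin.
have projl : lin_map (projv U) by move=> a u v; rewrite linearP.
pose Pi := opmx (projv U); pose D := degree_mx (adjoint S).
have stable (g : s -> s) : lin_map g -> (forall u, u \in U -> g u \in U) ->
    opmx g * Pi = Pi * opmx g * Pi.
  move=> gl gU; rewrite -mulrA -!opmx_comp //.
  by apply: opmx_eq => v; rewrite [RHS]projv_id // gU // memv_proj.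
have PiPi : Pi * Pi = Pi.
  by rewrite -opmx_comp //; apply: opmx_eq => v; rewrite [LHS]projv_id // memv_proj.
have ad1 x : gr S 1 x -> ad S x * Pi = Pi * ad S x * Pi.
  move=> x1; apply: stable; first exact: lie_linr.
  by move=> u /UE su; apply/UE; apply: (singular_span_raise x1 su).
have adm1 x : gr S (-1) x -> ad S x * Pi = Pi * ad S x * Pi.
  move=> x1; apply: stable; first exact: lie_linr.
  by move=> u /UE su; apply/UE; apply: (@SingularSpanAct _ _ _ _ (adjoint S) (-1)) => //; left.
have [E E0 EE] := grading_element.
have DE : D = ad S E.
  apply: opmx_eq; apply: (homog_ext (g := S)); [exact: degree_op_lin|exact: lie_linr|].
  by move=> p v pv; rewrite (EE p) //; exact: (@degree_opE _ _ (adjoint S)).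
have trD : \tr (Pi * D) = 0.
  rewrite DE; have [r rP ->] := degree0_brackets E0.
  rewrite (lin_map_sum (ad_lin S)) mulr_sumr linear_sum big_seq big1 //= => z /rP[z1 z2].
  by rewrite ad_br; apply: mxtrace_idem_comm => //; [exact: ad1|exact: adm1].
pose P p := component_mx (adjoint S) p.
have P_Pi p : P p * Pi = Pi * P p * Pi.
  apply: stable; first exact: component_lin.
  by move=> u /UE/(singular_span_component p)[su _]; apply/UE.
have Phigh p : - 2 < p -> P p * Pi = 0.
  move=> p2; rewrite -opmx_comp; last exact: component_lin.
  apply/matrixP => i j; rewrite !mxE.
  have /UE/(singular_span_component p)[_ ->//] := memv_proj U (bvec j).
  by rewrite linear0 mxE.
have trP p : \tr (Pi * P p) = (\rank (P p * Pi)%R)%:R.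
  rewrite mxtraceC mxtrace_idem // -mulrA [Pi * _]mulrA -P_Pi mulrA component_mx_idem //.
have : \sum_(p <- gsupp (adjoint S)) (- p)%:~R * (\rank (P p * Pi)%R)%:R == 0 :> R.
  rewrite -oppr_eq0 -sumrN -[X in _ == X]trD /D degree_mxE mulr_sumr linear_sum /=; apply/eqP.
  apply: eq_bigr => p _; rewrite -mulmxE -scalemxAr linearZ /= mulmxE trP.
  by rewrite -mulNr -rmorphN /= opprK.
rewrite psumr_eq0 => [/allP Z|p _]; last first.
  have [p2|p2] := ltP (- 2) p; first by rewrite Phigh // mxrank0 mulr0.
  rewrite mulr_ge0 // ler0z oppr_ge0; exact: (le_trans p2).
have PPi p : P p * Pi = 0.
  have [p2|p2] := ltP (- 2) p; first exact: Phigh.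
  have [/Z|ps] := boolP (p \in gsupp (adjoint S)).
    rewrite /= mulf_eq0 intr_eq0 oppr_eq0 pnatr_eq0 mxrank_eq0 => /orP[/eqP p0|/eqP //].
    by rewrite p0 in p2.
  by rewrite [P p](_ : _ = 0) ?mul0r //; apply/matrixP => i j; rewrite !mxE component_nsupp // linear0 mxE.
have yU : y \in U by apply/UE; apply: (@SingularSpanGen _ _ _ _ (adjoint S) k).
rewrite -(projv_id yU) (component_sum (adjoint S) (projv U y)) big1 // => p _.
apply: colv_inj; rewrite (lin_map0 (@colv_lin _ _)) (colv_op _ (component_lin _ p)) (colv_op _ projl).
by rewrite mulmxA mulmxE [_ * _]PPi mul0mx.
Qed.

(** Killing dual of [singular_adjoint0]: an element of degree [- k] orthogonal to the brackets is
    annihilated by [s_1]. *)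
Lemma positive_brackets k x : 2 <= k -> gr S k x ->
  exists2 r : seq (s * s), forall z, z \in r -> gr S 1 z.1 /\ gr S (k - 1) z.2 &
    x = \sum_(z <- r) br S z.1 z.2.
Proof.
move=> k2 kx.
have [||U UE] := @linear_subset_vspace _ _ (fun x => exists2 r : seq (s * s),
  forall z, z \in r -> gr S 1 z.1 /\ gr S (k - 1) z.2 & x = \sum_(z <- r) br S z.1 z.2).
- by exists [::]; rewrite ?big_nil.
- move=> a _ _ [r rP ->] [t tP ->]; exists ([seq (a *: z.1, z.2) | z <- r] ++ t).
    move=> z; rewrite mem_cat => /orP[/mapP[w /rP[w1 w2] ->]|/tP //].
    by split=> //; apply: homogZ.
  rewrite big_cat big_map scaler_sumr; congr (_ + _).
  by apply: eq_bigr => z _; rewrite (lin_mapZ (lie_linl _ _)).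
apply/UE; apply: (form_double_orth (killing_linl S) (killing_linr S) nondeg) => y yU.
rewrite killingC (killing_component _ kx); set yk := component S (- k) y.
suff -> : yk = 0 by exact: (lin_map0 (killing_linr _ _)).
have ykk : gr S (- k) yk := component_homog S (- k) y.
apply: (singular_adjoint0 _ ykk); first by rewrite lerN2.
move=> u u1; apply: (@killing_homog_nondeg (1 - k)) => [|v v1]; first exact: (gl_br u1 ykk).
rewrite opprB in v1.
have uvk : gr S k (br S u v) by have := gl_br u1 v1; rewrite addrC subrK.
have : killing S y (br S u v) = 0.
  by apply: yU; apply/UE; exists [:: (u, v)]; rewrite ?big_seq1 // => z; rewrite inE => /eqP->.
rewrite killingC (killing_component _ uvk) -/yk killingC => H.
by rewrite killing_brC H oppr0.
Qed.

End Transitive.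


End SemisimpleGraded.

(** * Singular vectors *)

Section SingularVectors.
Variables (R : rcfType) (s : vectType R) (S : graded_lie s).
Hypothesis nondeg : forall x, (forall y, killing S x y = 0) -> x = 0.
Hypothesis tr : transitive_algebra S.
Hypothesis Sfund : fundamental_algebra S.
Variables (l : vectType R) (L : graded_module S l).
Hypothesis Lfund : fundamental_module L.

(** [s] is generated by its degrees [-1], [0] and [1]: downwards because it is fundamental, upwards
    by [positive_brackets]. *)
Lemma singular_span_act x y : singular_span L y -> singular_span L (act L x y).
Proof.
pose P x := forall y, singular_span L y -> singular_span L (act L x y).
have P0 : P 0 by move=> z _; rewrite (lin_map0 (actl_lin L z)); exact: SingularSpan0.
have Plin a u v : P u -> P v -> P (a *: u + v).
  by move=> Pu Pv z sz; rewrite actl_lin; apply: SingularSpanLin; [exact: Pu|exact: Pv].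
have Pbr u v : P u -> P v -> P (br S u v).
  move=> Pu Pv z sz; rewrite act_br addrC -scaleN1r.
  by apply: SingularSpanLin; [exact/Pv/Pu|exact/Pu/Pv].
have Psum (r : seq (s * s)) : (forall z, z \in r -> P z.1 /\ P z.2) ->
    P (\sum_(z <- r) br S z.1 z.2).
  move=> rP; rewrite big_seq; elim/big_rec: _ => [|z u zr Pu]; first exact: P0.
  by rewrite -[br S _ _]scale1r; apply: Plin => //; have [] := rP z zr; exact: Pbr.
have Ppos n u : gr S n%:Z u -> P u.
  elim: n u => [|[|n] IH] u nu.
  - by move=> z; apply: SingularSpanAct nu; right.
  - by move=> z; exact: singular_span_raise.
  have [//|r rP ->] := positive_brackets nondeg tr _ nu.
  apply: Psum => z /rP[z1 z2]; split; first by move=> w; exact: singular_span_raise.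
  by apply: IH; rewrite (_ : n.+1%:Z = n.+2%:Z - 1) // -addn1 PoszD addrK.
have Pneg n u : gr S (- n.+1%:Z) u -> P u.
  elim: n u => [|n IH] u nu; first by move=> z; apply: SingularSpanAct nu; left.
  have : gr S (- n.+1%:Z - 1) u by rewrite -opprD -PoszD addn1.
  have -> // := Sfund (_ : - n.+1%:Z < 0).
  move: u {nu}; apply: lspan_ind => [//|a u v [z [w [z1 w1 ->]]] _ Pv].
  by apply: Plin => //; apply: Pbr; [move=> t; apply: SingularSpanAct z1; left|exact: IH].
suff Px : P x by exact: Px.
rewrite (component_sum S x); elim/big_rec: _ => [|p u _ Pu]; first exact: P0.
rewrite -[component _ _ _]scale1r; apply: Plin => //.
by have := component_homog S p x; case: p => n; rewrite ?NegzE; [exact: Ppos|exact: Pneg].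
Qed.

(** Weyl's theorem. The commutators of the action with any projection [Pi] onto [U] form a cocycle
    in [W], the space of maps from [l / U] to [U]. Whitehead's lemma yields [M0] in [W] with the
    same commutators, and [Pi - M0] is an equivariant projection onto [U]. *)
Lemma equivariant_projection (U : {vspace l}) :
    (forall x u, u \in U -> act L x u \in U) ->
  exists M : 'M[R]_(dim l), [/\ forall x, M * rho L x = rho L x * M,
    forall u, u \in U -> M *m colv u = colv u & forall v, @mxop _ l M v \in U].
Proof.
move=> Ustab; set n := dim l.
have projl : lin_map (projv U) by move=> a u v; rewrite linearP.
pose Pi : 'M[R]_n := opmx (projv U).
have PiPi : Pi * Pi = Pi.
  by rewrite -opmx_comp //; apply: opmx_eq => v; rewrite [LHS]projv_id // memv_proj.
have rPi x : rho L x * Pi = Pi * rho L x * Pi.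
  have rl := act_lin L x; rewrite -mulrA -!opmx_comp //.
  by apply: opmx_eq => v; rewrite [RHS]projv_id // Ustab // memv_proj.
have [||W WE] := @linear_subset_vspace _ _ (fun M : 'M[R]_n => M * Pi = 0 /\ Pi * M = M).
- by rewrite mul0r mulr0.
- move=> a M N [M1 M2] [N1 N2].
  by rewrite mulrDl mulrDr -mulmxE -scalemxAl -scalemxAr !mulmxE M1 M2 N1 N2 scaler0 addr0.
pose ct x (M : 'M[R]_n) : 'M[R]_n := rho L x * M - M * rho L x.
have ctl x : lin_map (ct x).
  move=> a M N; rewrite /ct mulrDl mulrDr -mulmxE -scalemxAl -scalemxAr scalerBr; zmod.
pose sg x := opmx (ct x).
have sgl : lin_map sg.
  move=> a x y; rewrite /sg -opmx_lin; apply: opmx_eq => M.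
  rewrite /ct rho_lin mulrDl mulrDr -mulmxE -scalemxAl -scalemxAr scalerBr; zmod.
have sgb x y : sg (br S x y) = sg x * sg y - sg y * sg x.
  rewrite /sg -!opmx_comp // -opmxB; apply: opmx_eq => M.
  by rewrite /ct rho_br !(mulrBl, mulrBr, mulrA); zmod.
pose fc x := colv (ct x Pi).
have fcl : lin_map fc.
  move=> a x y; rewrite /fc -colv_lin; congr colv.
  by rewrite /ct rho_lin mulrDl mulrDr -mulmxE -scalemxAl -scalemxAr scalerBr; zmod.
have Wl : lin_map (projv W) by move=> a u v; rewrite linearP.
pose e := opmx (projv W).
have ee : e * e = e.
  by rewrite -opmx_comp //; apply: opmx_eq => v; rewrite [LHS]projv_id // memv_proj.
have Wstab x M : M \in W -> ct x M \in W.
  move/WE => [M1 M2]; apply/WE; split; rewrite /ct.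
    rewrite mulrBl -!mulrA M1 mulr0 rPi.
    by rewrite !mulrA M1 !mul0r subrr.
  by rewrite mulrBr [Pi * (M * _)]mulrA M2 -{1}M2 !mulrA -rPi -mulrA M2.
have se x : sg x * e = e * sg x * e.
  rewrite -mulrA -!opmx_comp //.
  by apply: opmx_eq => v; rewrite [RHS]projv_id // Wstab // memv_proj.
have fcW x : ct x Pi \in W.
  apply/WE; rewrite /ct mulrBl mulrBr; split.
    by rewrite -mulrA PiPi -rPi subrr.
  by rewrite !mulrA PiPi -rPi.
have efc x : e *m fc x = fc x by rewrite -colv_op // projv_id.
have [|m em mE] := whitehead (real_complex R) nondeg sgl sgb fcl ee se.
  move=> x y; rewrite !efc /fc -!colv_op //.
  rewrite -[RHS](lin_mapB (@colv_lin _ _)); congr colv.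
  by rewrite /ct rho_br !(mulrBl, mulrBr, mulrA); zmod.
pose M0 : 'M[R]_n := r2v m^T; have M0E : colv M0 = m by rewrite /colv r2vK trmxK.
have [M0Pi PiM0] : M0 * Pi = 0 /\ Pi * M0 = M0.
  apply/WE; suff -> : M0 = projv W M0 by exact: memv_proj.
  by apply: colv_inj; rewrite (colv_op _ Wl) M0E em.
exists (Pi - M0); split=> [x|u uU|v].
- have : ct x Pi = ct x M0 by apply: colv_inj; rewrite (colv_op M0) // M0E -mE efc.
  rewrite /ct mulrBl mulrBr => /eqP; rewrite -subr_eq0 => /eqP H; apply/eqP.
  rewrite -subr_eq0 -oppr_eq0 -[X in _ == X]H; apply/eqP; zmod.
- have PuE : Pi *m colv u = colv u by rewrite -colv_op // projv_id.
  by rewrite mulmxBl PuE -PuE mulmxA [M0 *m Pi]M0Pi mul0mx subr0.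
suff -> : @mxop _ l (Pi - M0) v = projv U (@mxop _ l (Pi - M0) v) by exact: memv_proj.
apply: colv_inj; rewrite (colv_op _ projl) colv_mxop mulmxA; congr (_ *m _).
by rewrite mulmxBr [Pi *m Pi]PiPi [Pi *m M0]PiM0.
Qed.

(** An equivariant projection onto the singular span has no degree [-1] component, and [l_(-1)]
    generates the lower degrees. So its degree-preserving part kills all negative degrees, while the
    projection fixes [y]. *)
Lemma singular_eq0 k y : k <= - 2 -> gr L k y -> (forall x, gr S 1 x -> act L x y = 0) -> y = 0.
Proof.
move=> k2 ky y0.
have [||U UE] := @linear_subset_vspace _ _ (singular_span L).
- exact: SingularSpan0.
- exact: SingularSpanLin.
have [M [Mr MU Mv]] := equivariant_projection (fun x u uU => proj2 (UE _) (singular_span_act x (proj1 (UE _) uU))).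
have Mact x v : @mxop _ l M (act L x v) = act L x (mxop M v).
  apply: colv_inj; rewrite colv_mxop !(colv_op _ (act_lin L x)) colv_mxop.
  by rewrite !mulmxA; congr (_ *m _); exact: Mr.
pose q p v := component L p (@mxop _ l M v).
have ql p : lin_map (q p) by move=> a u v; rewrite /q mxop_lin component_lin.
have q0 n v : gr L (- n.+1%:Z) v -> q (- n.+1%:Z) v = 0.
  elim: n v => [|n IH] v nv.
    by have /UE/singular_span_component-/(_ (-1))[_ H] := Mv v; exact: H.
  have nE : - n.+1%:Z - 1 = - n.+2%:Z by rewrite -opprD -PoszD addn1.
  have : gr L (- n.+1%:Z - 1) v by rewrite nE.
  have -> // := Lfund (_ : - n.+1%:Z < 0).
  move: v {nv}; apply: lspan_ind => [|a u v [x [w [x1 nw ->]]] _ qv].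
    exact: (lin_map0 (ql _)).
  rewrite ql qv addr0 /q Mact (@component_act _ _ _ _ L (-1) _ x _ x1) -nE opprK subrK -/(q _ w) IH //.
  by rewrite (lin_map0 (act_lin L x)) scaler0.
have yU : y \in U by apply/UE; exact: (SingularSpanGen k2 ky y0).
have yE : @mxop _ l M y = y by apply: colv_inj; rewrite colv_mxop MU.
case: k k2 ky => [//|n] k2; rewrite NegzE => ky.
by rewrite -(component_id ky) -{1}yE -/(q _ y) q0.
Qed.

End SingularVectors.

(** * Extension of J to negative degrees *)

Section ExtendJ.
Variables (F : numFieldType) (s : lmodType F) (S : graded_lie s).
Variables (l : vectType F) (L : graded_module S l).
Variables (J d : s -> s) (JL : l -> l).
Hypothesis J_stable : forall x, gr S (-1) x -> gr S (-1) (J x).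
Hypothesis J_comm : forall b x, gr S 0 b -> gr S (-1) x -> br S b (J x) = J (br S b x).
Hypothesis d_stable : forall a, gr S 1 a -> gr S 1 (d a).
Hypothesis d_br : forall a x, gr S 1 a -> gr S (-1) x -> br S (d a) x = - br S a (J x).
Hypothesis JL_stable : forall y, gr L (-1) y -> gr L (-1) (JL y).
Hypothesis JL_lin : forall a y z, gr L (-1) y -> gr L (-1) z -> JL (a *: y + z) = a *: JL y + JL z.
Hypothesis JL_comm : forall b y, gr S 0 b -> gr L (-1) y -> act L b (JL y) = JL (act L b y).
Hypothesis JL_act : forall x y, gr S (-1) x -> gr L (-1) y -> act L x (JL y) = - act L (J x) y.
Hypothesis JL_act0 : forall x y, gr S (-1) x -> gr L 0 y -> JL (act L x y) = act L (J x) y.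
Hypothesis JL_raise : forall a y, gr S 1 a -> gr L (-1) y -> act L a (JL y) = - act L (d a) y.
Hypothesis Lfund : fundamental_module L.
Hypothesis no_singular : forall k y, k <= - 2 -> gr L k y ->
  (forall x, gr S 1 x -> act L x y = 0) -> y = 0.

(* The graph, in degree [- n.+1], of the extension of [JL] to the negative part of [l]. *)
Inductive ext_graph : nat -> l -> l -> Prop :=
| ExtBase y : gr L (-1) y -> ext_graph 0 y (JL y)
| ExtZero n : ext_graph n 0 0
| ExtLin n a y y' z z' : ext_graph n y y' -> ext_graph n z z' ->
    ext_graph n (a *: y + z) (a *: y' + z')
| ExtStep n x y y' : gr S (-1) x -> ext_graph n y y' ->
    ext_graph n.+1 (act L x y) (act L (J x) y + act L x y').

Lemma ext_graphD n y y' z z' : ext_graph n y y' -> ext_graph n z z' ->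
  ext_graph n (y + z) (y' + z').
Proof. by move=> gy gz; have := ExtLin 1 gy gz; rewrite !scale1r. Qed.

Lemma ext_graph_degree n y y' : ext_graph n y y' -> gr L (Negz n) y /\ gr L (Negz n) y'.
Proof.
elim=> {n y y'} [y y1|n|n a y y' z z' _ [y1 y2] _ [z1 z2]|n x y y' x1 _ [y1 y2]].
- by split=> //; exact: JL_stable.
- by split; exact: homog0.
- by split; exact: gr_lin.
have -> : Negz n.+1 = -1 + Negz n by rewrite !NegzE -opprD -PoszD.
split; first exact: gm_act.
by apply: homogD; apply: gm_act => //; exact: J_stable.
Qed.

Lemma act_actC x y z : act L x (act L y z) = act L (br S x y) z + act L y (act L x z).
Proof. by rewrite act_br subrK. Qed.

Lemma ext_graph_degree0 n y y' b : gr S 0 b -> ext_graph n y y' ->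
  ext_graph n (act L b y) (act L b y').
Proof.
move=> b0; elim=> {n y y'} [y y1|n|n a y y' z z' _ IHy _ IHz|n x y y' x1 gy IH].
- rewrite JL_comm //; apply: ExtBase; have := gm_act b0 y1; by rewrite add0r.
- by rewrite (lin_map0 (act_lin L b)); exact: ExtZero.
- by rewrite !act_lin; exact: ExtLin.
have bx1 : gr S (-1) (br S b x) by have := gl_br b0 x1; rewrite add0r.
rewrite act_actC (lin_mapD (act_lin L b)) !(act_actC b) J_comm //.
have -> : act L (J (br S b x)) y + act L (J x) (act L b y)
      + (act L (br S b x) y' + act L x (act L b y')) =
    act L (J (br S b x)) y + act L (br S b x) y'
      + (act L (J x) (act L b y) + act L x (act L b y')) by zmod.
by apply: ext_graphD; exact: ExtStep.
Qed.

Lemma ext_graph0 y y' : ext_graph 0 y y' -> y' = JL y.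
Proof.
have JL0 : JL 0 = 0.
  have := JL_lin 1 (homog0 L (-1)) (homog0 L (-1)); rewrite !scale1r addr0 => /eqP.
  by rewrite -subr_eq0 opprD addNKr oppr_eq0 => /eqP.
move En : 0%N => n gy; elim: gy En => {n y y'} [y y1|n|n a y y' z z' gy IHy gz IHz|] // n0.
rewrite IHy // IHz // JL_lin //; first by have [] := ext_graph_degree gy; rewrite -n0.
by have [] := ext_graph_degree gz; rewrite -n0.
Qed.

(** Elements of [s_1] carry the graph to the previous level; this reduces single-valuedness in one
    degree to the degree above. *)
Lemma ext_graph_raise n y y' a : gr S 1 a -> ext_graph n.+1 y y' ->
  ext_graph n (act L a y) (act L a y' + act L (d a) y).
Proof.
move=> a1; move En : n.+1 => m gy; elim: gy n En => {m y y'}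
  [//|m|m c y y' z z' gy IHy gz IHz|m x y y' x1 gy IH] n En.
- by rewrite !(lin_map0 (act_lin L _)) addr0; exact: ExtZero.
- rewrite !act_lin (_ : _ + _ + _ = c *: (act L a y' + act L (d a) y) + (act L a z' + act L (d a) z)).
    by apply: ExtLin; [exact: IHy|exact: IHz].
  by rewrite scalerDr; zmod.
have [y1 _] := ext_graph_degree gy.
case: En gy IH y1 => <-; have ax0 : gr S 0 (br S a x) by exact: (gl_br a1 x1).
have da1 := d_stable a1; have Jx1 := J_stable x1.
case: n => [|n] gy IH y1.
  (* In degree [-2] the extension is zero, by the compatibility of [J] with the brackets; what
     remains is an identity in [l_(-1)]. *)
  rewrite (ext_graph0 gy) JL_act // addrN (lin_map0 (act_lin L _)) add0r.
  have ay0 : gr L 0 (act L a y) by exact: (gm_act a1 y1).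
  suff <- : JL (act L a (act L x y)) = act L (d a) (act L x y).
    apply: ExtBase; have := gm_act a1 (gm_act x1 y1); by rewrite addrA subrr add0r.
  have axy1 : gr L (-1) (act L (br S a x) y) by have := gm_act ax0 y1; rewrite add0r.
  have xay1 : gr L (-1) (act L x (act L a y)) by have := gm_act x1 ay0; rewrite addr0.
  rewrite act_actC -[act L (br S a x) y]scale1r JL_lin // scale1r -JL_comm // JL_act0 //.
  rewrite [RHS]act_actC d_br // -[act L (d a) y]opprK -JL_raise //.
  rewrite (lin_mapN (act_lin L x)) (lin_mapN (actl_lin L _)).
  have H := act_actC a (J x) y; have H' := act_actC a x (JL y).
  rewrite JL_act // (lin_mapN (act_lin L a)) H in H'.
  by apply: (addrI (act L x (act L a (JL y)))); rewrite addrA [_ + act L (br S a x) _]addrC -H'; zmod.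
have -> : act L a (act L (J x) y + act L x y') + act L (d a) (act L x y) =
    act L (br S a x) y' + (act L (J x) (act L a y) + act L x (act L a y' + act L (d a) y)).
  rewrite !(lin_mapD (act_lin L _)) !(act_actC a) (act_actC (d a)) d_br //.
  by rewrite (lin_mapN (actl_lin L _)); zmod.
rewrite act_actC; apply: ext_graphD; first exact: ext_graph_degree0.
by apply: ExtStep => //; exact: IH.
Qed.

(** If the graph contains [(0, y')], then [s_1] maps [y'] to values at 0 one level up, which vanish
    by induction; so [y'] is singular. *)
Lemma ext_graph_functional n y' : ext_graph n 0 y' -> y' = 0.
Proof.
elim: n y' => [|n IH] y' gy.
  by rewrite (ext_graph0 gy) -(ext_graph0 (ExtZero 0)).
have [_ y1] := ext_graph_degree gy; apply: no_singular y1 _ => [|x x1].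
  by rewrite NegzE lerN2.
apply: IH; have := ext_graph_raise x1 gy.
by rewrite !(lin_map0 (act_lin L _)) addr0.
Qed.

Lemma ext_graph_total n y : gr L (Negz n) y -> exists y', ext_graph n y y'.
Proof.
elim: n y => [|n IH] y ny; first by exists (JL y); exact: ExtBase.
have : gr L (Negz n - 1) y by rewrite (_ : _ - 1 = Negz n.+1) // !NegzE -opprD -PoszD addn1.
have -> // := Lfund (_ : Negz n < 0).
move: y {ny}; apply: lspan_ind => [|a u v [x [w [x1 nw ->]]] _ [v' gv]].
  by exists 0; exact: ExtZero.
have [w' gw] := IH w nw; eexists; apply: ExtLin gv; exact: ExtStep gw.
Qed.

Lemma extension_of_J : exists D : l -> l,
  [/\ lin_map D, forall p y, gr L p y -> gr L p (D y),
      forall y, gr L (-1) y -> D y = JL y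
    & forall p x y, p < 0 -> gr S (-1) x -> gr L p y ->
      D (act L x y) = act L (J x) y + act L x (D y)].
Proof.
have /choice[h hP] : forall n, exists h : l -> l, forall y, gr L (Negz n) y -> ext_graph n y (h y).
  move=> n; have /choice[h hP] : forall y, exists y', gr L (Negz n) y -> ext_graph n y y'.
    move=> y; have [/ext_graph_total[y' gy]|ny] := pselect (gr L (Negz n) y); first by exists y'.
    by exists 0.
  by exists h.
have uniq_g n y y' y'' : ext_graph n y y' -> ext_graph n y y'' -> y' = y''.
  move=> g1 g2; apply/eqP; rewrite -subr_eq0; apply/eqP; apply: (@ext_graph_functional n).
  have := ExtLin (-1) g2 g1; rewrite !scaleN1r addNr addrC; exact.
(* In nonnegative degrees [D] is set to 0: nothing but linearity and preservation of degrees is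
   asked there. *)
pose D0 (p : int) y := if p is Negz n then h n (component L p y) else 0.
have D0l p : lin_map (D0 p).
  case: p => n a y z; rewrite /D0 ?scaler0 ?addr0 //.
  apply: (@uniq_g n (component L (Negz n) (a *: y + z))).
    exact/hP/component_homog.
  by rewrite component_lin; apply: ExtLin; apply/hP/component_homog.
pose D y := \sum_(p <- gsupp L) D0 p y.
have Dl : lin_map D.
  move=> a y z; rewrite /D scaler_sumr -big_split; apply: eq_bigr => p _; exact: D0l.
have DE n y : gr L (Negz n) y -> D y = h n y.
  move=> ny; rewrite /D.
  have D0n p : p != Negz n -> D0 p y = 0.
    case: p => m // mn; rewrite /D0 (component_neq ny) //.
    by apply: (@uniq_g m 0); [apply/hP/homog0|exact: ExtZero].
  have [ns|ns] := boolP (Negz n \in gsupp L).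
    by rewrite (bigD1_seq (Negz n)) ?gsupp_uniq //= big1 // addr0 component_id.
  have y0 : y = 0 by rewrite -(component_id ny) component_nsupp.
  rewrite big_seq big1 => [|p ps]; last by apply: D0n; apply: contraNneq ns => <-.
  by apply: (@uniq_g n y); [rewrite y0; exact: ExtZero|exact: hP].
exists D; split=> // [p y py|y y1|p x y p0 x1 py].
- case: p py => n ny.
    rewrite /D big1 => [|p _]; first exact: homog0.
    case: p => m //; rewrite /D0 (component_neq ny) //.
    by apply: (@uniq_g m 0); [apply/hP/homog0|exact: ExtZero].
  by rewrite (DE n) //; have [] := ext_graph_degree (hP _ _ ny).
- by rewrite (DE 0%N) //; apply/ext_graph0/hP.
case: p p0 py => // n _ ny; rewrite (DE n y) // (DE n.+1); last first.
  by have := gm_act x1 ny; rewrite !NegzE -opprD -PoszD.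
apply: (@uniq_g n.+1 (act L x y)); last exact: (ExtStep x1 (hP _ _ ny)).
by apply: hP; have := gm_act x1 ny; rewrite !NegzE -opprD -PoszD.
Qed.

End ExtendJ.

(** * Complexification *)

Lemma mulmx_complex (F : fieldType) (im : F) n (X1 X2 Y1 Y2 : 'M[F]_n) : im ^+ 2 = -1 ->
  (X1 + im *: X2) * (Y1 + im *: Y2) = (X1 * Y1 - X2 * Y2) + im *: (X1 * Y2 + X2 * Y1).
Proof.
move=> im2; rewrite mulrDl !mulrDr -!mulmxE -!scalemxAl -!scalemxAr scalerA -expr2 im2.
by rewrite scaleN1r scalerDr; zmod.
Qed.

Lemma commmx_complex (F : fieldType) (im : F) n (X1 X2 Y1 Y2 : 'M[F]_n) : im ^+ 2 = -1 ->
  ((X1 * Y1 - Y1 * X1) - (X2 * Y2 - Y2 * X2)) + im *: ((X1 * Y2 - Y2 * X1) + (X2 * Y1 - Y1 * X2)) =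
  (X1 + im *: X2) * (Y1 + im *: Y2) - (Y1 + im *: Y2) * (X1 + im *: X2).
Proof.
by move=> im2; rewrite !mulmx_complex // !(scalerDr, scalerN); zmod.
Qed.

Lemma comm_sum_brackets (T : pzRingType) (I : eqType) (r : seq I) (a : T) (u v : I -> T) :
  (forall i, i \in r -> a * u i = u i * a /\ a * v i = v i * a) ->
  a * (\sum_(i <- r) (u i * v i - v i * u i)) = (\sum_(i <- r) (u i * v i - v i * u i)) * a.
Proof.
move=> auv; rewrite mulr_sumr mulr_suml big_seq [RHS]big_seq; apply: eq_bigr => i /auv[au av].
by rewrite mulrBl mulrBr !mulrA au av -!mulrA av au.
Qed.

Section Complexification.
Variables (R : rcfType) (s : vectType R) (S : graded_lie s).

(* A pair [(x, y)] stands for the element [x + i y] of the complexification. *)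
Definition cbr (x y : s * s) : s * s :=
  (br S x.1 y.1 - br S x.2 y.2, br S x.1 y.2 + br S x.2 y.1).

Section Action.
Variables (l : vectType R) (L : graded_module S l).

Definition crho (x : s * s) : 'M[R[i]]_(dim l) :=
  locked (map_mx (real_complex R) (rho L x.1) + 'i *: map_mx (real_complex R) (rho L x.2)).

Lemma crhoE x : crho x =
  map_mx (real_complex R) (rho L x.1) + 'i *: map_mx (real_complex R) (rho L x.2).
Proof. by rewrite /crho -lock. Qed.

Lemma crhoD x y : crho (x + y) = crho x + crho y.
Proof. by rewrite !crhoE !(lin_mapD (rho_lin L)) !map_mxD scalerDr; zmod. Qed.

Lemma crhoZ a x : crho (a *: x) = (a%:C)%C *: crho x.
Proof.
by rewrite !crhoE !(lin_mapZ (rho_lin L)) !map_mxZ scalerDr !scalerA mulrC.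
Qed.

Lemma crho0 : crho 0 = 0.
Proof. by rewrite -(scale0r 0) crhoZ scale0r. Qed.

Lemma crho_i x y : crho (- y, x) = 'i *: crho (x, y).
Proof.
rewrite !crhoE /= (lin_mapN (rho_lin L)) map_mxN scalerDr scalerA -expr2 sqrCi.
by rewrite scaleN1r addrC.
Qed.

Lemma crho_sum (I : Type) (r : seq I) (x : I -> s * s) :
  crho (\sum_(i <- r) x i) = \sum_(i <- r) crho (x i).
Proof. by elim/big_rec2: _ => [|i u v _ <-]; rewrite ?crho0 ?crhoD. Qed.

Lemma crho_br x y : crho (cbr x y) = crho x * crho y - crho y * crho x.
Proof.
rewrite !crhoE /= (lin_mapB (rho_lin L)) (lin_mapD (rho_lin L)) !rho_br.
rewrite !(map_mxB, map_mxD, map_mxM); apply: commmx_complex; exact: sqrCi.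
Qed.

End Action.

Hypothesis nondeg : forall x, (forall y, killing S x y = 0) -> x = 0.
Variable J : s -> s.
Hypothesis J_cr : is_cr S J.

Lemma cr_J0 : J 0 = 0.
Proof.
have := cr_lin J_cr 1 (homog0 S (-1)) (homog0 S (-1)); rewrite !scale1r addr0 => /eqP.
by rewrite -subr_eq0 opprD addNKr oppr_eq0 => /eqP.
Qed.

Lemma cr_JN x : gr S (-1) x -> J (- x) = - J x.
Proof.
by move=> x1; have := cr_lin J_cr (-1) x1 (homog0 S (-1)); rewrite cr_J0 !addr0 !scaleN1r.
Qed.

Lemma cr_JZ a x : gr S (-1) x -> J (a *: x) = a *: J x.
Proof. by move=> x1; have := cr_lin J_cr a x1 (homog0 S (-1)); rewrite cr_J0 !addr0. Qed.

Lemma cr_JB x y : gr S (-1) x -> gr S (-1) y -> J (x - y) = J x - J y.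
Proof.
move=> x1 y1; have := cr_lin J_cr (-1) y1 x1.
by rewrite !scaleN1r addrC => ->; rewrite addrC.
Qed.

Lemma exists_dual_J : exists d : s -> s, forall a, gr S 1 a -> gr S 1 (d a) /\
  forall x, gr S (-1) x -> killing S (d a) x = - killing S a (J x).
Proof.
have /choice[d dP] : forall a, exists z, gr S 1 a -> gr S 1 z /\
    forall x, gr S (-1) x -> killing S z x = - killing S a (J x).
  move=> a; have [|z z1 zE] := @killing_riesz_homog _ _ _ nondeg 1
    (fun y => - killing S a (J (component S (-1) y))).
    move=> c u v; rewrite component_lin (cr_lin J_cr) ?(killing_linr S a) ?opprD ?scalerN //;
    exact: component_homog.
  exists z => _; split=> // x x1; rewrite zE ?component_id //.
by exists d.
Qed.

Variable d : s -> s.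
Hypothesis dP : forall a, gr S 1 a -> gr S 1 (d a) /\
  forall x, gr S (-1) x -> killing S (d a) x = - killing S a (J x).

(** Both sides have degree 0 and are compared by the Killing form with [s_0], which commutes with
    [J]. *)
Lemma dual_J_br a x : gr S 1 a -> gr S (-1) x -> br S (d a) x = - br S a (J x).
Proof.
move=> a1 x1; have [da1 daE] := dP a1; have Jx1 := cr_stable J_cr x1.
apply/eqP; rewrite -addr_eq0; apply/eqP; apply: (killing_homog_nondeg nondeg (p := 0)) => [|b].
  by apply: homogD; [exact: (gl_br da1 x1)|exact: (gl_br a1 Jx1)].
rewrite oppr0 => b0; rewrite (lin_mapD (killing_linl S b)) !killing_br daE; last first.
  by have := gl_br x1 b0; rewrite addr0.
rewrite lie_anti [br S (J x) b]lie_anti (cr_comm J_cr b0 x1).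
have bx1 : gr S (-1) (br S b x) by have := gl_br b0 x1; rewrite add0r.
by rewrite cr_JN // addNr.
Qed.

(** As [a + i d a] commutes with [s^(0,1)], the bracket of [x + i J x] with [a - i d a] equals its
    bracket with [2 a]. *)
Lemma cbr_ab x a : gr S (-1) x -> gr S 1 a ->
  cbr (x, J x) (a, - d a) = 2%:R *: (br S x a, br S (J x) a).
Proof.
move=> x1 a1; have Jx1 := cr_stable J_cr x1.
have H : br S (J x) (d a) = br S x a.
  rewrite lie_anti (dual_J_br a1 Jx1) (cr_sqr J_cr x1) (lin_mapN (lie_linr S a)) opprK.
  by rewrite lie_anti opprK.
have H' : br S x (d a) = - br S (J x) a.
  by rewrite lie_anti (dual_J_br a1 x1) opprK lie_anti.
apply: pairP; rewrite /cbr /= !(lin_mapN (lie_linr S _)) ?H ?H' !opprK scaler_nat mulr2n //.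
Qed.

(* [c.1 + i c.2] annihilates [s^(0,1)], the span of the [x + i J x] with [x] in [s_(-1)]. *)
Definition centralizes (c : s * s) : Prop :=
  [/\ gr S 0 c.1, gr S 0 c.2 & forall x, gr S (-1) x -> br S c.1 x = J (br S c.2 x)].

(* If the element [c] of degree [0] acts on [s^(0,1)] as the scalar [-k], then it acts
   on the dual part of [s_1] as [k]. *)
Lemma cbr_degree1 (c : s * s) (k : R) : gr S 0 c.1 -> gr S 0 c.2 ->
    (forall x, gr S (-1) x -> br S c.1 x - J (br S c.2 x) = - (k *: x)) ->
  (forall x, gr S (-1) x -> cbr c (x, J x) = - (k *: (x, J x))) /\
  (forall a, gr S 1 a -> cbr c (a, - d a) = k *: (a, - d a)).
Proof.
move=> c1 c2 cE; have br1 c' x : gr S 0 c' -> gr S (-1) x -> gr S (-1) (br S c' x).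
  by move=> H x1; have := gl_br H x1; rewrite add0r.
have cJ x : gr S (-1) x -> J (br S c.1 x) + br S c.2 x = - (k *: J x).
  move=> x1; rewrite -cr_JZ // -cr_JN; last exact: homogZ.
  rewrite -(cE x x1) cr_JB ?(cr_sqr J_cr) ?opprK //; try exact: br1.
  by apply: (cr_stable J_cr); apply: br1.
split=> [x x1|a a1].
  apply: pairP; rewrite /cbr /= !(cr_comm J_cr) ?cE ?cJ //.
have [da1 daE] := dP a1.
have k1 c' y : gr S 0 c' -> gr S 1 y -> gr S 1 (br S c' y).
  by move=> H y1; have := gl_br H y1; rewrite add0r.
have kr u := killing_linr S u; have kl u := killing_linl S u.
have cK x u : gr S (-1) x -> killing S u (br S c.1 x) - killing S u (J (br S c.2 x)) = - (k * killing S u x).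
  by move=> x1; rewrite -(lin_mapB (kr u)) cE // (lin_mapN (kr u)) (lin_mapZ (kr u)).
have cK' x u : gr S (-1) x -> killing S u (J (br S c.1 x)) + killing S u (br S c.2 x) = - (k * killing S u (J x)).
  by move=> x1; rewrite -(lin_mapD (kr u)) cJ // (lin_mapN (kr u)) (lin_mapZ (kr u)).
have ka1 : gr S 1 (k *: a) by exact: homogZ.
have kda1 : gr S 1 (k *: - d a) by exact/homogZ/homogN.
apply: pairP; apply/eqP; rewrite -subr_eq0; apply/eqP; apply: (killing_homog_nondeg nondeg (p := 1)).
- rewrite /= (lin_mapN (lie_linr S _)) opprK; apply: homogB => //.
  by apply: homogD; exact: k1.
- move=> x x1; rewrite /= (lin_mapN (lie_linr S _)) opprK.
  rewrite (lin_mapB (kl x)) (lin_mapD (kl x)) (lin_mapZ (kl x)) !killing_brC.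
  rewrite (daE _ (br1 _ _ c2 x1)) opprK; apply/eqP.
  by rewrite subr_eq0 -[k *: _]/(k * _) -[X in _ == X]opprK -cK // opprB addrC.
- rewrite /= (lin_mapN (lie_linr S _)); apply: homogB => //.
  by apply: homogD; [apply: homogN|]; exact: k1.
move=> x x1; rewrite /= (lin_mapN (lie_linr S _)).
rewrite (lin_mapB (kl x)) (lin_mapD (kl x)) (lin_mapZ (kl x)) !(lin_mapN (kl x)) !killing_brC.
rewrite (daE _ (br1 _ _ c1 x1)) (daE _ x1) !opprK; apply/eqP.
by rewrite subr_eq0 -[k *: _]/(k * _) -[X in _ == X]opprK -cK' // opprD.
Qed.

(** The space [[s^(0,1), s_1]]: each term is the bracket of [x + i J x] with a real [a]. It is a
    complex subspace, since multiplication by [i] replaces [x] by [- J x]. *)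
Definition bracket_pair (c : s * s) : Prop := exists2 r : seq (s * s),
  forall z, z \in r -> gr S (-1) z.1 /\ gr S 1 z.2 &
  c = \sum_(z <- r) (br S z.1 z.2, br S (J z.1) z.2).

Lemma bracket_pair_degree c : bracket_pair c -> gr S 0 c.1 /\ gr S 0 c.2.
Proof.
move=> [r rP ->]; rewrite big_seq; elim/big_rec: _ => [|z c' zr [c1 c2]].
  by split; exact: homog0.
have [z1 z2] := rP z zr; split; apply: homogD => //.
  exact: (gl_br z1 z2).
exact: (gl_br (cr_stable J_cr z1) z2).
Qed.

Lemma bracket_pair_lin a c c' : bracket_pair c -> bracket_pair c' -> bracket_pair (a *: c + c').
Proof.
move=> [r rP ->] [t tP ->]; exists ([seq (z.1, a *: z.2) | z <- r] ++ t).
  move=> z; rewrite mem_cat => /orP[/mapP[w /rP[w1 w2] ->]|/tP //].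
  by split=> //; apply: homogZ.
rewrite big_cat big_map scaler_sumr; congr (_ + _); apply: eq_bigr => z _.
by rewrite !(lin_mapZ (lie_linr S _)).
Qed.

Lemma bracket_pair_i c : bracket_pair c -> bracket_pair (- c.2, c.1).
Proof.
move=> [r rP ->]; exists [seq (- J z.1, z.2) | z <- r].
  move=> _ /mapP[z /rP[z1 z2] ->]; split=> //; apply/homogN; exact: (cr_stable J_cr z1).
rewrite big_map; apply: pairP => /=.
  rewrite (raddf_sum snd) [RHS](raddf_sum fst) -sumrN big_seq [RHS]big_seq.
  by apply: eq_bigr => z /rP[z1 z2] /=; rewrite (lin_mapN (lie_linl S _)).
rewrite (raddf_sum fst) [RHS](raddf_sum snd) big_seq [RHS]big_seq.
apply: eq_bigr => z /rP[z1 z2] /=.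
by rewrite (cr_JN (cr_stable J_cr z1)) (cr_sqr J_cr z1) opprK.
Qed.

Lemma bracket_pair_ad c b : gr S 0 b -> bracket_pair c ->
  bracket_pair (br S b c.1, br S b c.2).
Proof.
move=> b0 [r rP ->]; exists ([seq (br S b z.1, z.2) | z <- r] ++ [seq (z.1, br S b z.2) | z <- r]).
  move=> z; rewrite mem_cat => /orP[] /mapP[w /rP[w1 w2] ->]; split=> //=.
    by have := gl_br b0 w1; rewrite add0r.
  by have := gl_br b0 w2; rewrite add0r.
apply: pairP => /=.
  rewrite (raddf_sum fst) [RHS](raddf_sum fst) (lin_map_sum (lie_linr S b)) big_cat !big_map /=.
  by rewrite -big_split; apply: eq_bigr => z _ /=; rewrite lie_jacobi; zmod.
rewrite (raddf_sum snd) [RHS](raddf_sum snd) (lin_map_sum (lie_linr S b)) big_cat !big_map /=.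
rewrite -big_split big_seq [RHS]big_seq; apply: eq_bigr => z /rP[z1 z2] /=.
by rewrite -(cr_comm J_cr b0 z1) lie_jacobi; zmod.
Qed.

Lemma centralizes_lin a c c' : centralizes c -> centralizes c' -> centralizes (a *: c + c').
Proof.
move=> [c1 c2 cE] [c'1 c'2 c'E]; split=> [||x x1]; [exact: gr_lin|exact: gr_lin|].
rewrite /= !(lie_linl S) cE // c'E // (cr_lin J_cr) //.
  by have := gl_br c2 x1; rewrite add0r.
by have := gl_br c'2 x1; rewrite add0r.
Qed.

Lemma centralizes_i c : centralizes c -> centralizes (- c.2, c.1).
Proof.
move=> [c1 c2 cE]; split=> //= [|x x1]; first exact: homogN.
rewrite cE // (cr_sqr J_cr) ?(lin_mapN (lie_linl S _)) //.
by have := gl_br c2 x1; rewrite add0r.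
Qed.

Lemma centralizes_ad c b : gr S 0 b -> centralizes c -> centralizes (br S b c.1, br S b c.2).
Proof.
move=> b0 [c1 c2 cE].
have H c' : gr S 0 c' -> gr S 0 (br S b c') by move=> c'0; have := gl_br b0 c'0; rewrite addr0.
have H1 c' x : gr S 0 c' -> gr S (-1) x -> gr S (-1) (br S c' x).
  by move=> c'0 x1; have := gl_br c'0 x1; rewrite add0r.
split=> [||x x1] /=; [exact: H|exact: H|rewrite !lie_jacobi].
rewrite cE // (cE (br S b x)); last exact: H1.
rewrite (cr_comm J_cr b0); last exact: H1.
by rewrite cr_JB //; [have := gl_br b0 (H1 _ _ c2 x1); rewrite add0r|apply: (H1 _ _ c2); have := gl_br b0 x1; rewrite add0r].
Qed.

Local Notation K := (crho (adjoint S)).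

Lemma centralizes_comm c x a t : centralizes c -> gr S (-1) x -> gr S 1 a ->
  K c * K (x, J x) = K (x, J x) * K c /\
  K c * K (t *: (a, - d a)) = K (t *: (a, - d a)) * K c.
Proof.
move=> [c1 c2 cE] x1 a1; have [|Hx Ha] := @cbr_degree1 c 0 c1 c2.
  by move=> y y1; rewrite cE // subrr scale0r oppr0.
have ex : cbr c (x, J x) = 0 by rewrite Hx // scale0r oppr0.
have ea : cbr c (t *: (a, - d a)) = 0.
  have -> : cbr c (t *: (a, - d a)) = t *: cbr c (a, - d a).
    by rewrite /cbr /= !(lin_mapZ (lie_linr S _)) -scalerBr -scalerDr.
  by rewrite Ha // scale0r scaler0.
have := crho_br (adjoint S) c (x, J x); rewrite ex crho0 => /esym/subr0_eq Kx.
have := crho_br (adjoint S) c (t *: (a, - d a)); rewrite ea crho0 => /esym/subr0_eq Ka.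
exact: (conj Kx Ka).
Qed.

(** Each real [a] is replaced by [(a - i d a) / 2], the part of it that [s^(0,1)] sees; unlike [a],
    this is an eigenvector of the elements considered in [cbr_degree1]. *)
Lemma crho_bracket_pair (l : vectType R) (L : graded_module S l) (r : seq (s * s)) :
  (forall z, z \in r -> gr S (-1) z.1 /\ gr S 1 z.2) ->
  crho L (\sum_(z <- r) (br S z.1 z.2, br S (J z.1) z.2)) =
  \sum_(z <- r) (crho L (z.1, J z.1) * crho L (2^-1 *: (z.2, - d z.2))
               - crho L (2^-1 *: (z.2, - d z.2)) * crho L (z.1, J z.1)).
Proof.
move=> rP; rewrite crho_sum big_seq [RHS]big_seq; apply: eq_bigr => z /rP[z1 z2].
rewrite -crho_br; congr (crho L _).
have -> : cbr (z.1, J z.1) (2^-1 *: (z.2, - d z.2)) = 2^-1 *: cbr (z.1, J z.1) (z.2, - d z.2).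
  by rewrite /cbr /= !(lin_mapZ (lie_linr S _)) -scalerBr -scalerDr.
by rewrite cbr_ab // scalerA mulVf ?scale1r // pnatr_eq0.
Qed.

(** Such a [c] commutes with the factors of the commutators whose sum it is, hence is ad-nilpotent.
    The intersection is abelian and normalized by [s_0], so Engel's theorem makes [ad c * ad b]
    nilpotent for [b] in [s_0]; nondegeneracy in degree 0 concludes. *)
Lemma bracket_pair_cap_centralizes c : bracket_pair c -> centralizes c -> c = 0.
Proof.
move=> Hc Cc; pose Q c := bracket_pair c /\ centralizes c.
have Qnil c' : Q c' -> exists k, K c' ^+ k = 0.
  move=> [Hc' Cc']; have [r rP rE] := Hc'.
  (* The value 0 outside [r] makes the commutation hold for every index. *)
  pose u (z : s * s) := if z \in r then K (z.1, J z.1) else 0.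
  apply: (@sum_comm_nilpotent _ _ _ _ r u (fun z => K (2^-1 *: (z.2, - d z.2)))).
    move=> z; rewrite /u; case: ifP => [/rP[z1 z2]|_]; last by rewrite mulr0 mul0r.
    exact: (proj1 (centralizes_comm 0 Cc' z1 z2)).
  rewrite {1}rE (crho_bracket_pair (adjoint S) rP) big_seq [RHS]big_seq.
  by apply: eq_bigr => z zr; rewrite /u zr.
have Qcomm c1 c2 : Q c1 -> Q c2 -> K c1 * K c2 - K c2 * K c1 = 0.
  move=> [[r rP rE] _] [_ C2]; rewrite rE (crho_bracket_pair (adjoint S) rP).
  apply/eqP; rewrite subr_eq0; apply/eqP/esym/comm_sum_brackets => z /rP[z1 z2].
  exact: centralizes_comm.
have [||P PE] := @linear_subset_vspace _ _ (fun M => exists2 c, Q c & M = K c).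
- exists 0; rewrite ?crho0 //; split; first by exists [::] => //; rewrite big_nil.
  split=> [||x x1]; [exact: homog0|exact: homog0|].
  by rewrite (lin_map0 (lie_linl S x)) cr_J0.
- move=> a _ _ [c1 [H1 C1] ->] [c2 [H2 C2] ->].
  exists (complex.Re a *: c1 + (complex.Im a *: (- c1.2, c1.1) + c2)).
    split; first by do 2?[apply: bracket_pair_lin => //]; exact: bracket_pair_i.
    by do 2?[apply: centralizes_lin => //]; exact: centralizes_i.
  rewrite !crhoD !crhoZ crho_i -surjective_pairing addrA scalerA -scalerDl.
  by rewrite {1}[a]complexE complexiE ['i * _]mulrC.
have [N PN] : exists N, products_vanish P N.
  apply: engel => [_ _ /PE[c1 Q1 ->] /PE[c2 Q2 ->]|_ /PE[c1 Q1 ->]]; last exact: Qnil.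
  by rewrite Qcomm // mem0v.
have kil0 b : gr S 0 b -> killing S c.1 b = 0 /\ killing S c.2 b = 0.
  move=> b0; have : \tr (K c * K (b, 0)) = 0.
    apply: (@mxtrace_nilp _ _ _ N); apply: (products_vanish_mul_nilp PN).
      by apply/PE; exists c.
    move=> _ /PE[c' [Hc' Cc'] ->]; apply/PE; exists (br S b c'.1, br S b c'.2).
      by split; [exact: bracket_pair_ad|exact: centralizes_ad].
    rewrite -crho_br; congr (crho _ _).
    by rewrite /cbr /= !(lin_map0 (lie_linl S _)) subr0 addr0.
  rewrite !crhoE /= (lin_map0 (rho_lin _)) map_mx0 scaler0 addr0 mulrDl linearD /=.
  rewrite -!mulmxE -scalemxAl linearZ /= !mulmxE -!rmorphM /= !trace_map_mx.
  rewrite -complexiE => H.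
  have : Complex (killing S c.1 b) (killing S c.2 b) = 0 by rewrite [LHS]complexE.
  by case=> -> ->.
have [c1 c2] := bracket_pair_degree Hc.
apply: pairP; apply: (killing_homog_nondeg nondeg (p := 0)) => // y; rewrite oppr0 => /kil0[] //.
Qed.

(** In degree 0 the orthogonal of [[s^(0,1), s_1]] centralizes [s^(0,1)]. A vector orthogonal to
    both spaces therefore lies in both, the first by biduality, and is 0. So the grading element is
    a sum [h + k], and [h] acts on [s^(0,1)] as it does. *)
Lemma partial_grading_element : exists2 r : seq (s * s),
  forall z, z \in r -> gr S (-1) z.1 /\ gr S 1 z.2 &
  forall x, gr S (-1) x ->
    br S (\sum_(z <- r) br S z.1 z.2) x - J (br S (\sum_(z <- r) br S (J z.1) z.2) x) = - x.
Proof.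
(* The real part of the complex Killing form: a nondegenerate real form, with the same orthogonals
   of complex subspaces. *)
pose be (x y : s * s) : R := killing S x.1 y.1 - killing S x.2 y.2.
have bel y : lin_map (fun x => be x y : R^o).
  move=> a u v; rewrite /be /= !(killing_linl S _) scalerBr; zmod.
have ber x : lin_map (fun y => be x y : R^o).
  move=> a u v; rewrite /be /= !(killing_linr S _) scalerBr; zmod.
have bend x : (forall y, be x y = 0) -> x = 0.
  move=> H; apply: pairP; apply: nondeg => y.
    by have := H (y, 0); rewrite /be /= (lin_map0 (killing_linr S _)) subr0.
  have := H (0, y); rewrite /be /= (lin_map0 (killing_linr S _)) sub0r => /eqP.
  by rewrite oppr_eq0 => /eqP.
pose c0 (x : s * s) : s * s := (component S 0 x.1, component S 0 x.2).
have be0 x y : gr S 0 x.1 -> gr S 0 x.2 -> be x y = be x (c0 y).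
  move=> x1 x2; rewrite /be /= (killing_component y.1 x1) (killing_component y.2 x2).
  by rewrite oppr0.
have beC x y : be x y = be y x by rewrite /be killingC [killing S x.2 _]killingC.
have c0P x : gr S 0 (c0 x).1 /\ gr S 0 (c0 x).2 by split; exact: component_homog.
have bp0 : bracket_pair 0 by exists [::] => //; rewrite big_nil.
have cz0 : centralizes 0.
  split=> [||x x1]; [exact: homog0|exact: homog0|].
  by rewrite (lin_map0 (lie_linl S x)) cr_J0.
have [H HE] := linear_subset_vspace bp0 bracket_pair_lin.
have Horth y : gr S 0 y.1 -> gr S 0 y.2 -> (forall h, bracket_pair h -> be y h = 0) -> centralizes y.
  move=> y1 y2 yH; split=> // x x1.
  have br1 c' x' : gr S 0 c' -> gr S (-1) x' -> gr S (-1) (br S c' x').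
    by move=> c'0 x'1; have := gl_br c'0 x'1; rewrite add0r.
  apply/eqP; rewrite -subr_eq0; apply/eqP; apply: (killing_homog_nondeg nondeg (p := -1)).
    by apply: homogB; [exact: br1|apply: (cr_stable J_cr); exact: br1].
  rewrite opprK => a a1; rewrite -(cr_comm J_cr y2 x1) (lin_mapB (killing_linl S a)) !killing_br.
  rewrite -[LHS]/(be y (br S x a, br S (J x) a)); apply: yH.
  by exists [:: (x, a)]; rewrite ?big_seq1 // => z; rewrite inE => /eqP->.
have [E E0 EE] := grading_element nondeg.
pose HC c := exists h k, [/\ bracket_pair h, centralizes k & c = h + k].
have [||W WE] := @linear_subset_vspace _ _ HC.
- by exists 0, 0; split=> //; rewrite addr0.
- move=> a _ _ [h [k [h1 k1 ->]]] [h' [k' [h2 k2 ->]]].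
  exists (a *: h + h'), (a *: k + k'); split; [exact: bracket_pair_lin|exact: centralizes_lin|].
  by rewrite scalerDr; zmod.
have : (E, 0) \in W.
  apply: (form_double_orth bel ber bend) => y yW.
  have y0W c : HC c -> be (c0 y) c = 0.
    move=> Hc; have [c1 c2] : gr S 0 c.1 /\ gr S 0 c.2.
      case: Hc => h [k [/bracket_pair_degree[h1 h2] [k1 k2 _] ->]].
      by split; exact: homogD.
    by rewrite beC -be0 // beC; apply/yW/WE.
  have [y1 y2] := c0P y.
  have yC : centralizes (c0 y).
    apply: Horth => // h hH; apply: y0W; exists h, 0; split=> //; by rewrite addr0.
  have yH : bracket_pair (c0 y).
    apply/HE; apply: (form_double_orth bel ber bend) => z zH.
    have [z1 z2] := c0P z; rewrite beC be0 // beC.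
    rewrite beC; apply: y0W; exists 0, (c0 z); rewrite add0r; split=> //.
    apply: Horth => // h hH; have [h1 h2] := bracket_pair_degree hH.
    by rewrite beC -be0 // beC; apply/zH/HE.
  rewrite beC be0 //; last exact: homog0.
  by rewrite (bracket_pair_cap_centralizes yH yC) (lin_map0 (ber _)).
move/WE => [h [k [[r rP hE] [k1 k2 kE] EhK]]]; exists r => // x x1.
have h1 : \sum_(z <- r) br S z.1 z.2 = E - k.1.
  by have := congr1 fst EhK; rewrite /= hE (raddf_sum fst) /= => ->; rewrite addrK.
have h2 : \sum_(z <- r) br S (J z.1) z.2 = - k.2.
  have := congr1 snd EhK; rewrite /= hE (raddf_sum snd) /= => /eqP.
  by rewrite eq_sym addr_eq0 => /eqP.
rewrite h1 h2 (lin_mapB (lie_linl S x)) (lin_mapN (lie_linl S x)) kE //.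
rewrite (cr_JN (_ : gr S (-1) (br S k.2 x))); last by have := gl_br k2 x1; rewrite add0r.
by rewrite opprK subrK (EE _ _ x1) intrN scaleN1r.
Qed.

End Complexification.

(** * The trace argument *)

Section TraceArgument.
Variables (C : numClosedFieldType) (n : nat).
Variables (ps : seq int) (P : int -> 'M[C]_n).
Hypothesis ps_uniq : uniq ps.
Hypothesis P_sum : \sum_(p <- ps) P p = 1.
Hypothesis P_orth : forall p q, P p * P q = if p == q then P p else 0.
Hypothesis P_supp : forall p, p \notin ps -> P p = 0.
Let Dl := \sum_(p <- ps) p%:~R *: P p.
Variables (I : eqType) (r : seq I) (u v : I -> 'M[C]_n) (E Q : 'M[C]_n).
Hypothesis E_def : E = \sum_(i <- r) (u i * v i - v i * u i).
Hypothesis Du : forall i, i \in r -> (Dl - E) * u i = u i * (Dl - E).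
Hypothesis Dv : forall i, i \in r -> (Dl - E) * v i = v i * (Dl - E).
Hypothesis EP : forall p, E * P p = P p * E.
Hypothesis EQ : E * Q = Q * E.
Hypothesis QQ : Q * Q = Q.
Hypothesis QP : Q * P (- 1) = Q.
Hypothesis PQ : P (- 1) * Q = Q.
Hypothesis u_degree : forall i p, i \in r -> P (p - 1) * u i = u i * P p.
Hypothesis v_degree : forall i p, i \in r -> P (p + 1) * v i = v i * P p.
Hypothesis uQ : forall i, i \in r -> u i * Q = 0.
Hypothesis uP0 : forall i, i \in r -> Q * (u i * P 0) = u i * P 0.
(** The image [l^(0,1) + l_0 + l_1 + ...] is stable under [u], which lowers the degree by one,
    because [u] kills [l^(0,1)] ([uQ]) and maps [l_0] into it ([uP0]). The operators [v] raise the
    degree. *)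
Let pi := Q + \sum_(p <- ps | 0 <= p) P p.
Variable b : 'M[C]_n.
Hypothesis Db : (Dl - E) * b = b * (Dl - E).
Hypothesis Pb : P 0 * b = b * P (- 1).

Let PQ0 p : p != - 1 -> P p * Q = 0.
Proof. by move=> p1; rewrite -PQ mulrA P_orth (negbTE p1) mul0r. Qed.

Let QP0 p : p != - 1 -> Q * P p = 0.
Proof. by move=> p1; rewrite -QP -mulrA P_orth eq_sym (negbTE p1) mulr0. Qed.

Let piP p : pi * P p = if p == - 1 then Q else if 0 <= p then P p else 0.
Proof.
rewrite mulrDl mulr_suml; have [->|p1] := eqVneq.
  by rewrite QP big1 ?addr0 // => q; rewrite P_orth; case: eqVneq => [->|].
rewrite QP0 // add0r; have [p0|p0] := boolP (0 <= p); last first.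
  by rewrite big1 // => q q0; rewrite P_orth; case: eqVneq => [qp|//]; rewrite -qp q0 in p0.
have [pps|pps] := boolP (p \in ps); last first.
  by rewrite P_supp // big1 // => q _; rewrite mulr0.
rewrite big_mkcond (bigD1_seq p) //= p0 P_orth eqxx big1 ?addr0 // => q qp.
by rewrite P_orth (negbTE qp) if_same.
Qed.

Let PpiC p : P p * pi = pi * P p.
Proof.
rewrite piP mulrDr mulr_sumr; have [->|p1] := eqVneq.
  by rewrite PQ big1 ?addr0 // => q; rewrite P_orth; case: eqVneq => [<-|].
rewrite PQ0 // add0r; have [p0|p0] := boolP (0 <= p); last first.
  by rewrite big1 // => q q0; rewrite P_orth; case: eqVneq => [qp|//]; rewrite qp q0 in p0.
have [pps|pps] := boolP (p \in ps); last first.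
  by rewrite P_supp // big1 // => q _; rewrite mul0r.
rewrite big_mkcond (bigD1_seq p) //= p0 P_orth eqxx big1 ?addr0 // => q qp.
by rewrite P_orth eq_sym (negbTE qp) if_same.
Qed.

Let pipi : pi * pi = pi.
Proof.
have piQ : pi * Q = Q by rewrite -PQ mulrA piP eqxx QQ.
rewrite {2}/pi mulrDr piQ mulr_sumr; congr (_ + _); apply: eq_bigr => p p0.
by rewrite piP p0; case: eqVneq p0 => [->|].
Qed.

Let piQ : pi * Q = Q.
Proof. by rewrite -{1}PQ mulrA piP eqxx QQ. Qed.

Let stable_pi M : pi * (M * Q) = M * Q -> (forall p, 0 <= p -> pi * (M * P p) = M * P p) ->
  M * pi = pi * M * pi.
Proof.
move=> MQ MP; rewrite -mulrA {1 3}/pi !mulrDr MQ; congr (_ + _).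
by rewrite !mulr_sumr; apply: eq_bigr => p p0; rewrite MP.
Qed.

Let u_pi i : i \in r -> u i * pi = pi * u i * pi.
Proof.
move=> ir; apply: stable_pi => [|p p0]; first by rewrite uQ // mulr0.
have [->|pn0] := eqVneq p 0.
  by rewrite -uP0 // mulrA piQ.
rewrite -u_degree // mulrA piP subr_ge0 -gtz0_ge1 lt_def pn0 p0.
by rewrite -subr_eq0 opprK subrK (negbTE pn0).
Qed.

Let v_pi i : i \in r -> v i * pi = pi * v i * pi.
Proof.
move=> ir; apply: stable_pi => [|p p0].
  have -> : v i * Q = P 0 * (v i * Q) by rewrite -{1}PQ mulrA -v_degree // addNr mulrA.
  by rewrite mulrA piP.
rewrite -v_degree // mulrA piP addr_ge0 // -subr_eq0 opprK.
by rewrite gt_eqF // ltr_wpDr // ltr_wpDl.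
Qed.

Let Epi : E * pi = pi * E.
Proof.
rewrite mulrDr mulrDl EQ mulr_sumr mulr_suml; congr (_ + _).
by apply: eq_bigr => p _; rewrite EP.
Qed.

Let Dl_comm M : (forall p, P p * M = M * P p) -> Dl * M = M * Dl.
Proof.
move=> PM; rewrite mulr_suml mulr_sumr; apply: eq_bigr => p _.
by rewrite -!mulmxE -scalemxAl -scalemxAr !mulmxE PM.
Qed.

Section Idempotent.
Variables (f : 'M[C]_n) (c : C) (k : nat).
Hypothesis ff : f * f = f.
Hypothesis Pf : forall p, P p * f = f * P p.
Hypothesis Ef : E * f = f * E.
Hypothesis fE0 : \tr (f * E) = 0.
Hypothesis fc : (Dl - E - c%:M) ^+ k * f = 0.

Let dims p := \rank (P p * f)%R.

Let PfPf p : P p * f * (P p * f) = P p * f.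
Proof. by rewrite -mulrA [f * _]mulrA -Pf -mulrA ff mulrA P_orth eqxx. Qed.

(** On [im f] the trace of [Dl] is that of [Dl - E], which has the single eigenvalue [c]. *)
Lemma weighted_dims : \sum_(p <- ps) (p%:~R - c) * (dims p)%:R = 0.
Proof.
have Af : (Dl - E) * f = f * (Dl - E) by rewrite mulrBl mulrBr Ef Dl_comm.
have tr1 : \tr (Dl * f) = c * \tr f.
  have -> : Dl * f = (Dl - E) * f + E * f by rewrite mulrBl subrK.
  rewrite linearD /= (mxtrace_generalized_eigen Af ff fc) [X in _ + X]mxtraceC fE0 addr0.
  by rewrite (mxtrace_idem ff).
have tr2 : \tr f = \sum_(p <- ps) (dims p)%:R.
  rewrite -[in LHS](mul1r f) -P_sum mulr_suml linear_sum; apply: eq_bigr => p _ /=.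
  exact: mxtrace_idem.
have tr3 : \tr (Dl * f) = \sum_(p <- ps) p%:~R * (dims p)%:R.
  rewrite mulr_suml linear_sum; apply: eq_bigr => p _ /=.
  by rewrite -mulmxE -scalemxAl linearZ /= mulmxE mxtrace_idem.
move: tr1; rewrite tr2 tr3 mulr_sumr => /eqP.
rewrite -subr_eq0 -sumrB => /eqP H; rewrite -[RHS]H.
by apply: eq_bigr => p _; rewrite mulrBl.
Qed.

End Idempotent.

(** Eliminating [c] gives a zero double sum of [(p - q) * d p * d' q]. Its terms are nonnegative, as
    [p >= -1 >= q] on the supports, so the one at [p = 0], [q = -1] vanishes. *)
Lemma weighted_dims_disjoint (d d' : int -> nat) (c : C) :
  (forall p, p < - 1 -> d p = 0%N) -> (forall p, - 1 < p -> d' p = 0%N) ->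
  \sum_(p <- ps) (p%:~R - c) * (d p)%:R = 0 -> \sum_(p <- ps) (p%:~R - c) * (d' p)%:R = 0 ->
  0 \in ps -> - 1 \in ps -> d 0 = 0%N \/ d' (- 1) = 0%N.
Proof.
move=> dl d'h sd sd' ps0 ps1.
have Z : \sum_(p <- ps) \sum_(q <- ps) ((p - q)%:~R * (d p * d' q)%:R : C) == 0.
  pose D' : C := \sum_(q <- ps) (d' q)%:R.
  transitivity (\sum_(p <- ps) D' * ((p%:~R - c) * (d p)%:R)
      - \sum_(p <- ps) (d p)%:R * \sum_(q <- ps) (q%:~R - c) * (d' q)%:R == 0).
    congr (_ == _); rewrite -sumrB; apply: eq_bigr => p _.
    rewrite mulr_suml mulr_sumr -sumrB; apply: eq_bigr => q _.
    by rewrite natrM intrD rmorphN /=; ring.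
  by rewrite -mulr_sumr sd mulr0 sub0r big1 ?oppr0 ?eqxx // => p _; rewrite sd' mulr0.
have pos p q : 0 <= (p - q)%:~R * (d p * d' q)%:R :> C.
  have [pl|pl] := ltP p (- 1); first by rewrite dl // mul0n mulr0.
  have [qh|qh] := ltP (- 1) q; first by rewrite d'h // muln0 mulr0.
  by rewrite mulr_ge0 // ler0z subr_ge0 (le_trans qh).
move: Z; rewrite psumr_eq0 => [/allP/(_ _ ps0)/=|p _]; last exact: sumr_ge0.
rewrite psumr_eq0 // => /allP/(_ _ ps1)/=.
rewrite opprK add0r mul1r pnatr_eq0 muln_eq0 => /orP[]/eqP; [left|right] => //.
Qed.

(* On each spectral subspace of [Dl - E] the sum [E] of commutators has trace zero on the
   [pi]-stable part, which lives in degrees [>= -1], and on its complement, which lives in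
   degrees [<= -1]. So the average degree of both parts is the eigenvalue, and the first part
   vanishes in degree [0] or the second in degree [-1]; but [b] commutes with [Dl - E]. *)
Lemma trace_argument : b * (P (- 1) - Q) = 0.
Proof.
have [cs [p [k [ucs e1 ee Ae]]]] := closed_spectral_projections (Dl - E).
pose e c := hmx (Dl - E) (p c).
have eC c M : (Dl - E) * M = M * (Dl - E) -> e c * M = M * e c by exact: hmx_comm.
have PDE q : (Dl - E) * P q = P q * (Dl - E).
  rewrite mulrBl mulrBr EP Dl_comm // => q'; rewrite !P_orth eq_sym.
  by case: eqVneq => [->|].
have EDE : (Dl - E) * E = E * (Dl - E) by rewrite mulrBl mulrBr Dl_comm // => q; rewrite EP.
have piDE : (Dl - E) * pi = pi * (Dl - E) by rewrite mulrBl mulrBr Epi Dl_comm.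
have epi c : e c * pi = pi * e c by exact: eC.
have eE c : e c * E = E * e c by exact: eC.
have eP c q : e c * P q = P q * e c by exact: eC.
have stab c g M : c \in cs -> g * g = g -> e c * g = g * e c -> e c * M = M * e c ->
    M * g = g * M * g -> M * (g * e c) = g * e c * M * (g * e c).
  move=> ccs gg eg eM Mg.
  have -> : g * e c * M * (g * e c) = g * M * (g * (e c * e c)).
    by rewrite -[g * e c * M]mulrA eM -!mulrA (mulrA (e c) g) eg -mulrA.
  by rewrite ee // [LHS]mulrA Mg -mulrA.
have key c : c \in cs -> e c * (P (- 1) - Q) = 0 \/ P 0 * e c = 0.
  move=> ccs; pose f := pi * e c; pose f' := (1 - pi) * e c.
  have pi'pi' : (1 - pi) * (1 - pi) = 1 - pi by rewrite mulrBl !mulrBr !mulr1 !mul1r pipi subrr subr0.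
  have epi' : e c * (1 - pi) = (1 - pi) * e c by rewrite mulrBl mulrBr mulr1 mul1r epi.
  have idem g : g * g = g -> e c * g = g * e c -> g * e c * (g * e c) = g * e c.
    by move=> gg eg; rewrite -mulrA [e c * _]mulrA eg -mulrA ee // mulrA gg.
  have Pg q g : P q * g = g * P q -> P q * (g * e c) = g * e c * P q.
    by move=> Pg; rewrite mulrA Pg -!mulrA -eP.
  have Eg g : E * g = g * E -> E * (g * e c) = g * e c * E.
    by move=> Eg; rewrite mulrA Eg -!mulrA -eE.
  have Ag g : g * (Dl - E) = (Dl - E) * g -> (Dl - E - c%:M) ^+ k * (g * e c) = 0.
    move=> Ag; have -> : g * e c = e c * g by rewrite eC.
    by rewrite mulrA Ae // mul0r.
  have trf : \tr (f * E) = 0.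
    rewrite E_def mulr_sumr linear_sum big_seq big1 //= => i ir.
    apply: mxtrace_idem_comm; first exact: idem.
      by apply: stab => //; [exact/eC/Du|exact: u_pi].
    by apply: stab => //; [exact/eC/Dv|exact: v_pi].
  (* The image of [1 - pi] need not be stable, so its trace is found by subtraction from the whole
     spectral subspace. *)
  have tre : \tr (e c * E) = 0.
    rewrite E_def mulr_sumr linear_sum big_seq big1 //= => i ir.
    by apply: mxtrace_comm0; rewrite eC // Du.
  have trf' : \tr (f' * E) = 0.
    by rewrite /f' mulrBl mul1r mulrBl linearB /= tre trf subrr.
  have Ppi' q : P q * (1 - pi) = (1 - pi) * P q by rewrite mulrBl mulrBr mulr1 mul1r PpiC.
  have Epi' : E * (1 - pi) = (1 - pi) * E by rewrite mulrBl mulrBr mulr1 mul1r Epi.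
  have wf := weighted_dims (idem pi pipi (epi c)) (fun q => Pg q pi (PpiC q)) (Eg pi Epi) trf
    (Ag pi (esym piDE)).
  have DEpi' : (1 - pi) * (Dl - E) = (Dl - E) * (1 - pi).
    by rewrite mulrBl mul1r [RHS]mulrBr mulr1 piDE.
  have wf' := weighted_dims (idem _ pi'pi' epi') (fun q => Pg q _ (Ppi' q)) (Eg _ Epi') trf'
    (Ag _ DEpi').
  have [ps0|/P_supp P00] := boolP (0 \in ps); last by right; rewrite P00 mul0r.
  have [ps1|/P_supp P10] := boolP (- 1 \in ps); last first.
    by left; rewrite -QP P10 mulr0 subrr mulr0.
  have dl q : q < - 1 -> \rank (P q * f)%R = 0%N.
    move=> q1; rewrite /f mulrA PpiC piP lt_eqF // leNgt (lt_trans q1) // mul0r mxrank0 //.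
  have dh q : - 1 < q -> \rank (P q * f')%R = 0%N.
    move=> q1; rewrite /f' mulrA mulrBr mulr1 PpiC piP gt_eqF //.
    by have -> : 0 <= q by []; rewrite subrr mul0r mxrank0.
  have [/eqP|/eqP] := weighted_dims_disjoint dl dh wf wf' ps0 ps1.
    rewrite mxrank_eq0 /f mulrA PpiC piP /= => /eqP H; by right.
  rewrite mxrank_eq0 /f' mulrA mulrBr mulr1 PpiC piP eqxx => /eqP H; left.
  rewrite eC // [LHS]mulrBr [RHS]mulrBl PDE; congr (_ - _).
  by rewrite mulrBl mulrBr EQ Dl_comm // => q; have [->|q1] := eqVneq q (- 1); rewrite ?PQ ?QP ?PQ0 ?QP0.
(* On each spectral subspace either the source [P (-1) - Q] or the target [P 0] of [b] is zero. *)
rewrite -[b]mulr1 -e1 mulr_sumr mulr_suml big_seq big1 // => c ccs.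
rewrite -/(e c) -mulrA; have [->|P0e] := key c ccs; first by rewrite mulr0.
have -> : P (- 1) - Q = P (- 1) * (P (- 1) - Q) by rewrite mulrBr PQ P_orth eqxx.
by rewrite mulrA -(eC c b Db) -!mulrA [b * _]mulrA -Pb -!mulrA mulrA eP P0e mul0r.
Qed.
End TraceArgument.

(** * J and the action of degree 1 *)

Section ComplexMatrices.
Variables (F : numFieldType) (im : F) (n : nat).
Hypothesis im2 : im ^+ 2 = -1.
Variables P J : 'M[F]_n.
Hypothesis PP : P * P = P.
Hypothesis PJ : P * J = J.
Hypothesis JP : J * P = J.
Hypothesis JJ : J * J = - P.
(** The projection onto the eigenspace of [J] for [- im], that is, onto type [(0,1)]. *)
Let Q : 'M[F]_n := 2^-1 *: (P + im *: J).

Let half2 (X : 'M[F]_n) : 2^-1 *: (X + X) = X.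
Proof. by rewrite -mulr2n -[X *+ 2]scaler_nat scalerA mulVf ?scale1r // pnatr_eq0. Qed.

Let mulQ (X Y : 'M[F]_n) : X * (2^-1 *: Y) = 2^-1 *: (X * Y).
Proof. by rewrite -mulmxE -scalemxAr. Qed.

Let Qmul (X Y : 'M[F]_n) : (2^-1 *: Y) * X = 2^-1 *: (Y * X).
Proof. by rewrite -mulmxE -scalemxAl. Qed.

Lemma type01_idem : Q * Q = Q.
Proof.
rewrite /Q mulQ Qmul mulmx_complex // PP PJ JP JJ opprK [im *: (_ + _)]scalerDr.
by rewrite [_ + _ + (_ + _)]addrACA half2.
Qed.

Lemma type01P : Q * P = Q.
Proof. by rewrite /Q Qmul mulrDl PP -mulmxE -scalemxAl mulmxE JP. Qed.

Lemma Ptype01 : P * Q = Q.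
Proof. by rewrite /Q mulQ mulrDr PP -mulmxE -scalemxAr mulmxE PJ. Qed.

Lemma type01_annihilated (X1 X2 : 'M[F]_n) : X1 * P = X2 * J -> X1 * J = - (X2 * P) ->
  (X1 + im *: X2) * Q = 0.
Proof.
by move=> H1 H2; rewrite /Q mulQ mulmx_complex // H1 H2 subrr addNr scaler0 addr0 scaler0.
Qed.

Lemma type01_range (X1 X2 P0 : 'M[F]_n) : J * (X1 * P0) = X2 * P0 -> P * (X1 * P0) = X1 * P0 ->
  Q * ((X1 + im *: X2) * P0) = (X1 + im *: X2) * P0.
Proof.
move=> H1 H2; have H3 : J * (X2 * P0) = - (X1 * P0) by rewrite -H1 mulrA JJ mulNr H2.
have H4 : P * (X2 * P0) = X2 * P0 by rewrite -H1 mulrA PJ.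
rewrite mulrDl (_ : (im *: X2) * P0 = im *: (X2 * P0)); last by rewrite -mulmxE scalemxAl.
rewrite /Q Qmul mulmx_complex // H1 H2 H3 H4 opprK [im *: (_ + _)]scalerDr.
by rewrite [_ + _ + (_ + _)]addrACA half2.
Qed.

Lemma type10_annihilator (X1 X2 : 'M[F]_n) : (X1 + im *: X2) * (P - Q) = 0 ->
  (X1 * P + X2 * J) + im *: (X2 * P - X1 * J) = 0.
Proof.
have -> : P - Q = 2^-1 *: (P + im *: - J).
  by rewrite -{1}[P]half2 -scalerBr scalerN; congr (_ *: _); zmod.
rewrite mulQ mulmx_complex // !mulrN opprK => /eqP.
rewrite scaler_eq0 invr_eq0 pnatr_eq0 /= => /eqP <-.
by congr (_ + _ *: _); zmod.
Qed.

Lemma comm_sub (T : pzRingType) (D E X Y : T) : D * X = X * D + Y -> Y = E * X - X * E ->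
  (D - E) * X = X * (D - E).
Proof. by move=> DX YE; rewrite mulrBl mulrBr DX YE; zmod. Qed.

End ComplexMatrices.

Section RaiseJ.
Variables (R : rcfType) (s : vectType R) (S : graded_lie s).
Hypothesis nondeg : forall x, (forall y, killing S x y = 0) -> x = 0.
Variables (J d : s -> s).
Hypothesis J_cr : is_cr S J.
Hypothesis dP : forall a, gr S 1 a -> gr S 1 (d a) /\
  forall x, gr S (-1) x -> killing S (d a) x = - killing S a (J x).
Variables (l : vectType R) (L : graded_module S l) (JL : l -> l).
Hypothesis JL_stable : forall y, gr L (-1) y -> gr L (-1) (JL y).
Hypothesis JL_lin : forall a y z, gr L (-1) y -> gr L (-1) z -> JL (a *: y + z) = a *: JL y + JL z.
Hypothesis JL_sqr : forall y, gr L (-1) y -> JL (JL y) = - y.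
Hypothesis JL_comm : forall b y, gr S 0 b -> gr L (-1) y -> act L b (JL y) = JL (act L b y).
Hypothesis JL_act : forall x y, gr S (-1) x -> gr L (-1) y -> act L x (JL y) = - act L (J x) y.
Hypothesis JL_act0 : forall x y, gr S (-1) x -> gr L 0 y -> JL (act L x y) = act L (J x) y.

Let m := map_mx (real_complex R) : 'M_(dim l) -> 'M_(dim l).
(** [JL] is constrained only in degree [-1]; the projection makes it a linear operator. *)
Let Jp y := JL (component L (-1) y).
Let Jm := opmx Jp.
Let cP p := component_mx L p.

Let Jp_lin : lin_map Jp.
Proof. by move=> a y z; rewrite /Jp component_lin JL_lin //; exact: component_homog. Qed.

Let comp_lin p : lin_map (component L p) := component_lin L p.

Let PJ : cP (-1) * Jm = Jm.
Proof.
rewrite -opmx_comp //; apply: opmx_eq => y.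
by rewrite component_id //; apply/JL_stable/component_homog.
Qed.

Let JP : Jm * cP (-1) = Jm.
Proof.
rewrite -opmx_comp //; apply: opmx_eq => y.
by rewrite /Jp (component_id (component_homog _ _ _)).
Qed.

Let JJ : Jm * Jm = - cP (-1).
Proof.
rewrite -opmx_comp //; apply/matrixP => i j.
have y1 := component_homog L (-1) (bvec j).
by rewrite !mxE /Jp (component_id (JL_stable y1)) JL_sqr // linearN mxE.
Qed.

Let cP_rho p q x : gr S q x -> cP p * rho L x = rho L x * cP (p - q).
Proof.
move=> qx; rewrite -!opmx_comp //; last exact: act_lin.
by apply: opmx_eq => y; exact: component_act.
Qed.

Let intertwine (M N : 'M_(dim l)) x : M * rho L x.1 = rho L x.1 * N ->
  M * rho L x.2 = rho L x.2 * N -> m M * crho L x = crho L x * m N.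
Proof.
move=> H1 H2; rewrite crhoE mulrDr mulrDl -/m; congr (_ + _).
  by rewrite -[LHS]map_mxM -[RHS]map_mxM; congr (m _).
rewrite -!mulmxE -scalemxAl -scalemxAr; congr (_ *: _).
by rewrite -[LHS]map_mxM -[RHS]map_mxM; congr (m _).
Qed.

Let degree_crho q x : gr S q x.1 -> gr S q x.2 ->
  m (degree_mx L) * crho L x = crho L x * m (degree_mx L) + q%:~R *: crho L x.
Proof.
move=> x1 x2; have H y : gr S q y -> m (degree_mx L) * m (rho L y) =
    m (rho L y) * m (degree_mx L) + q%:~R *: m (rho L y).
  move=> qy; have /(congr1 m) := degree_mx_rho L qy.
  by rewrite /m map_mxD map_mxZ !map_mxM rmorph_int.
rewrite crhoE -/m mulrDr mulrDl [q%:~R *: (_ + _)]scalerDr -!mulmxE -!scalemxAl -!scalemxAr !mulmxE.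
by rewrite !H // [_ *: (_ + _)]scalerDr !scalerA ['i * _]mulrC addrACA.
Qed.

Let Jm_rho0 b : gr S 0 b -> Jm * rho L b = rho L b * Jm.
Proof.
move=> b0; rewrite -!opmx_comp //; last exact: act_lin.
apply: opmx_eq => y; rewrite /Jp (@component_act _ _ _ _ L 0 (-1) b y b0) subr0 JL_comm //.
exact: component_homog.
Qed.

Let Jm_rho1 x : gr S (-1) x -> rho L x * Jm = - (rho L (J x) * cP (-1)).
Proof.
move=> x1; rewrite -!opmx_comp; try exact: act_lin.
apply/matrixP => i j; rewrite !mxE /Jp JL_act ?linearN ?mxE //.
exact: component_homog.
Qed.

Let Jm_rho0' x : gr S (-1) x -> Jm * (rho L x * cP 0) = rho L (J x) * cP 0.
Proof.
move=> x1; rewrite -!opmx_comp //; try exact: act_lin.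
apply: opmx_eq => y; have y0 : gr L 0 (component L 0 y) by exact: component_homog.
rewrite /Jp component_id ?JL_act0 //.
by have := gm_act x1 y0; rewrite addr0.
Qed.

Let cP_sum : \sum_(p <- gsupp L) cP p = 1.
Proof.
rewrite -opmx_id; apply/matrixP => i j; rewrite summxE mxE [bvec j in RHS](component_sum L).
by rewrite linear_sum summxE; apply: eq_bigr => p _; rewrite mxE.
Qed.

Let cP_orth p q : cP p * cP q = if p == q then cP p else 0.
Proof.
case: eqVneq => [->|pq]; first exact: component_mx_idem.
rewrite -opmx_comp //; apply/matrixP => i j.
by rewrite !mxE (component_neq (component_homog L q _) pq) linear0 mxE.
Qed.

Let cP_supp p : p \notin gsupp L -> cP p = 0.
Proof. by move=> ps; apply/matrixP => i j; rewrite !mxE component_nsupp // linear0 mxE. Qed.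

Let cP_crho p q k x : gr S q x.1 -> gr S q x.2 -> k = p - q ->
  m (cP p) * crho L x = crho L x * m (cP k).
Proof. by move=> x1 x2 ->; apply: intertwine; exact: cP_rho. Qed.

Lemma J_raise a y : gr S 1 a -> gr L (-1) y -> act L a (JL y) = - act L (d a) y.
Proof.
move=> a1 y1; have [r rP rE] := partial_grading_element nondeg J_cr dP.
pose c := \sum_(z <- r) (br S z.1 z.2, br S (J z.1) z.2).
have c1E : c.1 = \sum_(z <- r) br S z.1 z.2 by rewrite /c (raddf_sum fst).
have c2E : c.2 = \sum_(z <- r) br S (J z.1) z.2 by rewrite /c (raddf_sum snd).
have [c1 c2] : gr S 0 c.1 /\ gr S 0 c.2.
  by apply: (bracket_pair_degree J_cr); exists r.
have [|cx ca] := cbr_degree1 nondeg J_cr dP (k := 1) c1 c2.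
  by move=> x x1; rewrite c1E c2E rE // scale1r.
pose E := crho L c; pose u (z : s * s) := crho L (z.1, J z.1).
pose v (z : s * s) := crho L (2^-1 *: (z.2, - d z.2)); pose b := crho L (a, - d a).
pose P p := m (cP p); pose Q := 2^-1 *: (P (-1) + 'i *: m Jm).
have PP p : cP p * cP p = cP p by exact: component_mx_idem.
have mM A B : m A * m B = m (A * B) by rewrite /m [RHS]map_mxM.
have P1 : P (-1) * P (-1) = P (-1) by rewrite mM PP.
have PJ' : P (-1) * m Jm = m Jm by rewrite mM PJ.
have JP' : m Jm * P (-1) = m Jm by rewrite mM JP.
have JJ' : m Jm * m Jm = - P (-1) by rewrite mM JJ /m map_mxN.
have i2 : 'i ^+ 2 = -1 :> R[i] by exact: sqrCi.
have DlE : \sum_(p <- gsupp L) p%:~R *: P p = m (degree_mx L).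
  rewrite degree_mxE /m map_mx_sum; apply: eq_bigr => p _.
  by rewrite map_mxZ rmorph_int.
(* Bracketing with the degree operator and with [E] both multiply [crho L w] by [q], so their
   difference commutes with it. *)
have DEcomm q w : gr S q w.1 -> gr S q w.2 -> cbr S c w = q%:~R *: w ->
    (m (degree_mx L) - E) * crho L w = crho L w * (m (degree_mx L) - E).
    move=> w1 w2 wE; apply: comm_sub (degree_crho w1 w2) _.
    by have := crho_br L c w; rewrite wE crhoZ rmorph_int.
have uE z : z \in r -> cbr S c (z.1, J z.1) = (-1)%:~R *: (z.1, J z.1).
  by move=> /rP[z1 _]; rewrite cx // scale1r scaleN1r.
have vE z : z \in r -> cbr S c (2^-1 *: (z.2, - d z.2)) = 1%:~R *: (2^-1 *: (z.2, - d z.2)).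
  move=> /rP[_ z2]; rewrite scale1r.
  have -> : cbr S c (2^-1 *: (z.2, - d z.2)) = 2^-1 *: cbr S c (z.2, - d z.2).
    by rewrite /cbr /= !(lin_mapZ (lie_linr S _)) -scalerBr -scalerDr.
  by rewrite ca // scale1r.
have vd z : z \in r -> gr S 1 (2^-1 *: (z.2, - d z.2)).1 /\ gr S 1 (2^-1 *: (z.2, - d z.2)).2.
  move=> /rP[_ z2]; split; first exact: homogZ.
  by apply/homogZ/homogN; have [] := dP z2.
have da1 : gr S 1 (- d a) by apply: homogN; have [] := dP a1.
have bQ : b * (P (-1) - Q) = 0.
  apply: (@trace_argument _ _ (gsupp L) P _ _ _ _ _ r u v E Q); rewrite ?DlE.
  - exact: gsupp_uniq.
  - by rewrite -map_mx_sum cP_sum map_mx1.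
  - by move=> p q; rewrite mM cP_orth; case: ifP => // _; rewrite /m map_mx0.
  - by move=> p ps; rewrite /P cP_supp // /m map_mx0.
  - exact: crho_bracket_pair.
  - move=> z zr; have [z1 _] := rP z zr.
    apply: (DEcomm (-1)) => //; [exact: (cr_stable J_cr)|exact: uE].
  - move=> z zr; have [z1 z2] := vd z zr.
    by apply: (DEcomm 1) => //; exact: vE.
  - by move=> p; apply/esym/(cP_crho c1 c2); rewrite subr0.
  - rewrite /Q -!mulmxE -scalemxAl -scalemxAr !mulmxE mulrDl mulrDr.
    rewrite -!mulmxE -scalemxAl -scalemxAr !mulmxE; congr (_ *: (_ + _ *: _)).
      by apply/esym/(cP_crho c1 c2); rewrite subr0.
    by apply/esym/intertwine; exact: Jm_rho0.
  - exact: type01_idem.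
  - exact: type01P.
  - exact: Ptype01.
  - move=> z p zr; have [z1 _] := rP z zr.
    by apply: (cP_crho (q := -1)) => //; [exact: (cr_stable J_cr)|rewrite opprK subrK].
  - move=> z p zr; have [z1 z2] := vd z zr.
    by apply: (cP_crho (q := 1)) => //; rewrite addrK.
  - move=> z zr; have [z1 _] := rP z zr; rewrite /u crhoE.
    have Jz1 := cr_stable J_cr z1.
    apply: (type01_annihilated i2).
      rewrite -[LHS]/(m _ * m _) -[RHS]/(m _ * m _) !mM Jm_rho1 // (cr_sqr J_cr) //.
      by rewrite (lin_mapN (rho_lin L)) mulNr opprK.
    by rewrite -[LHS]/(m _ * m _) -[X in - X]/(m _ * m _) !mM Jm_rho1 // /m map_mxN.
  - move=> z zr; have [z1 _] := rP z zr; rewrite /u crhoE.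
    apply: (type01_range i2 PJ' JJ').
      by rewrite -[LHS]/(m _ * (m _ * m _)) -[RHS]/(m _ * m _) !mM Jm_rho0'.
    rewrite -[LHS]/(m _ * (m _ * m _)) -[RHS]/(m _ * m _) !mM mulrA (cP_rho _ z1).
    by rewrite -mulrA subrr cP_orth.
  - by apply: (DEcomm 1) => //; rewrite ca // !scale1r.
  - by apply: (cP_crho (q := 1)).
(* The vanishing of [b] on [l^(1,0)] is split into real and imaginary parts; the imaginary part is
   the claim. *)
have B0 : rho L (- d a) * cP (-1) - rho L a * Jm = 0.
  have H : m (rho L a * cP (-1) + rho L (- d a) * Jm)
      + 'i *: m (rho L (- d a) * cP (-1) - rho L a * Jm) = 0.
    by rewrite /m map_mxD map_mxB !map_mxM; move: bQ; rewrite /b crhoE; apply: type10_annihilator.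
  apply/matrixP => i j; have := congr1 (fun M : 'M_(dim l) => M i j) H.
  have Im0 (x z : R) : (x%:C)%C + 'i * (z%:C)%C = 0 :> R[i] -> z = 0.
    rewrite -complexiE => H'; have : Complex x z = 0 by rewrite [LHS]complexE.
    by case.
  by rewrite !mxE; apply: Im0.
have := subr0_eq B0; rewrite -!opmx_comp; try exact: act_lin.
move=> /opmx_inj H; have {H} := H _ _ y.
rewrite /Jp (component_id y1) (lin_mapN (actl_lin L y)) => -> //.
- by move=> k w w0; rewrite component_lin act_lin.
- by move=> k w w0; rewrite -[JL _]/(Jp _) Jp_lin act_lin.
Qed.

End RaiseJ.

(** * Derivations of the negative part *)

Lemma Negz_pred n : Negz n - 1 = Negz n.+1.
Proof. by rewrite !NegzE -opprD -PoszD addn1. Qed.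

Section Fundamental.
Variables (F : numFieldType) (s l : lmodType F) (S : graded_lie s) (L : graded_module S l).

Definition raised_gen p : l -> Prop :=
  fun z => exists x y, [/\ gr S (-1) x, gr L p y & z = act L x y].

Lemma lspanB (V : lmodType F) (A : V -> Prop) x y : lspan A x -> lspan A y -> lspan A (x - y).
Proof. by move=> Ax Ay; rewrite addrC -scaleN1r; exact: lspan_lin. Qed.

Lemma fundamental_moduleP : (forall p z, p < 0 -> gr L (p - 1) z -> lspan (raised_gen p) z) ->
  fundamental_module L.
Proof.
move=> H p p0; apply/predeqP => z; split=> [/(H _ _ p0)//|].
move: z; apply: lspan_ind => [|a x y [u [w [u1 wp ->]]] _ IH]; first exact: homog0.
by apply: gr_lin => //; rewrite addrC; exact: gm_act.
Qed.

Lemma lspan_image (V W : lmodType F) (A : V -> Prop) (B : W -> Prop) (f : V -> W) z :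
  lin_map f -> (forall x, A x -> lspan B (f x)) -> lspan A z -> lspan B (f z).
Proof.
move=> fl AB; move: z; apply: lspan_ind => [|a x y Ax _ IH].
  by rewrite (lin_map0 fl); exact: lspan0.
rewrite fl; apply: lspan_lin IH; exact: AB.
Qed.

End Fundamental.

Section NegativeDegrees.
Variables (F : numFieldType) (s l : lmodType F) (S : graded_lie s) (L : graded_module S l).

Lemma fundamental_ext_algebra : fundamental_algebra (extension L) -> fundamental_algebra S.
Proof.
move=> fund; apply: fundamental_moduleP => p x p0 xp.
have : gr (extension L) (p - 1) (x, 0) by split=> //; exact: homog0.
rewrite (fund p p0); apply: (@lspan_image _ _ _ _ _ fst) => // _ [X [Y [X1 Yp ->]]].
by apply: lspan_sub; exists X.1, Y.1; case: X1 => ?; case: Yp.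
Qed.

Hypothesis Sfund : fundamental_algebra S.

Lemma act_negative n q x y : gr S (Negz n) x -> gr L q y ->
  lspan (raised_gen L (Negz n + q + 1)) (act L x y).
Proof.
elim: n q x y => [|n IH] q x y nx qy.
  by apply: lspan_sub; exists x, y; split=> //; rewrite addrC addrA subrr add0r.
have : gr S (Negz n - 1) x by rewrite Negz_pred.
rewrite (Sfund (_ : Negz n < 0)) //.
apply: (@lspan_image _ _ _ _ _ (fun x => act L x y)); first exact: actl_lin.
have -> : Negz n.+1 + q + 1 = Negz n + q.
  by rewrite -Negz_pred addrAC subrK.
move=> _ [a [b [a1 bn ->]]]; rewrite act_br; apply: lspanB.
  by apply: lspan_sub; exists a, (act L b y); split=> //; exact: gm_act.
have := IH (-1 + q) b (act L a y) bn (gm_act a1 qy).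
by rewrite addrCA addrAC addNr add0r.
Qed.

(** Brackets in the extension also produce terms from [[s_p, l_(-1)]]. They add nothing to
    [[s_(-1), l_p]], because [s_p] is generated by [s_(-1)]. *)
Lemma fundamental_ext_module : fundamental_algebra (extension L) -> fundamental_module L.
Proof.
move=> fund; apply: fundamental_moduleP => -[//|n] y p0 yp.
have : gr (extension L) (Negz n - 1) (0, y) by split=> //; exact: homog0.
rewrite (fund _ p0); apply: (@lspan_image _ _ _ _ _ snd) => // _ [X [Y [[X1 X2] [Y1 Y2] ->]]].
apply: lspanB; first by apply: lspan_sub; exists X.1, Y.2.
by have := act_negative Y1 X2; rewrite addrK.
Qed.

Variables (J Ds : s -> s) (D : l -> l).
Hypothesis Ds_lin : lin_map Ds.
Hypothesis DsJ : forall x, gr S (-1) x -> Ds x = J x.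
Hypothesis Ds_br : forall p x y, p < 0 -> gr S (-1) x -> gr S p y ->
  Ds (br S x y) = br S (J x) y + br S x (Ds y).
Hypothesis D_lin : lin_map D.
Hypothesis D_act : forall p x y, p < 0 -> gr S (-1) x -> gr L p y ->
  D (act L x y) = act L (J x) y + act L x (D y).

(** The rule for [x] in [s_(-1)] propagates to lower degrees by the Jacobi identity. *)
Lemma derivation_negative p q x y : p < 0 -> q < 0 -> gr S p x -> gr L q y ->
  D (act L x y) = act L (Ds x) y + act L x (D y).
Proof.
case: p => // n _; elim: n q x y => [|n IH] q x y q0 nx qy.
  by rewrite (DsJ nx) (D_act q0).
have : gr S (Negz n - 1) x by rewrite Negz_pred.
rewrite (Sfund (_ : Negz n < 0)) //.
move: x {nx}; apply: lspan_ind => [|k u v [a [b [a1 bn ->]]] _ Dv].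
  by rewrite (lin_map0 Ds_lin) !(lin_map0 (actl_lin L _)) (lin_map0 D_lin) addr0.
rewrite Ds_lin !(act_linl L) D_lin Dv.
suff -> : D (act L (br S a b) y) = act L (Ds (br S a b)) y + act L (br S a b) (D y).
  by rewrite scalerDr; zmod.
have q1 : -1 + q < 0 by rewrite -[0]addr0 ltrD.
have nq : Negz n + q < 0 by rewrite -[0]addr0 ltrD.
have Db := IH _ _ _ q0 bn qy.
rewrite [Ds _](Ds_br (_ : Negz n < 0)) // (lin_mapD (actl_lin L y)) !act_br (lin_mapB D_lin).
rewrite (D_act nq a1 (gm_act bn qy)) (IH _ _ _ q1 bn (gm_act a1 qy)) Db (D_act q0 a1 qy).
by rewrite !(lin_mapD (act_lin L _)); zmod.
Qed.

End NegativeDegrees.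

Section Prolongation.
Variables (F : numFieldType) (V : lmodType F) (A : cr_algebra V).
Variables (g : lmodType F) (G : cr_algebra g) (iota : neg_part A -> g).
Hypothesis hG : is_levi_tanaka (negative_part A) G iota.
Variable D : V -> V.
Hypothesis D_lin : lin_map D.
Hypothesis D_degree : forall p x, gr A p x -> gr A p (D x).
Hypothesis DJ : forall x, gr A (-1) x -> D x = cr_J A x.
Hypothesis D_br : forall p q x y, p < 0 -> q < 0 -> gr A p x -> gr A q y ->
  D (br A x y) = br A (D x) y + br A x (D y).

Let ad_linl y : lin_map (fun x => br A x y) := fun a x z => br_linl A a x z y.
Let ad_linr x : lin_map (br A x) := fun a y z => br_linr A a x y z.

Let D_neg (X : neg_part A) : D (val X) \in neg_pred A.
Proof.
apply/asboolP; have /asboolP := valP X; apply: (@lspan_image _ _ _ _ _ D) => // x [p p0 px].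
by apply: lspan_sub; exists p => //; exact: D_degree.
Qed.

Let Dm (X : neg_part A) : neg_part A := NegPart (D_neg X).

Let Dm_lin : lin_map Dm.
Proof. by move=> a X Y; apply: val_inj; exact: D_lin. Qed.

Let DmJ X : gr A (-1) (val X) -> Dm X = neg_J X.
Proof. by move=> X1; apply: val_inj; rewrite neg_JE //; exact: DJ. Qed.

Let Dm_br X Y : Dm (br (negative_part A) X Y) =
  br (negative_part A) (Dm X) Y + br (negative_part A) X (Dm Y).
Proof.
apply: val_inj; rewrite -[LHS]/(D (br A (val X) (val Y))).
rewrite -[RHS]/(br A (D (val X)) (val Y) + br A (val X) (D (val Y))).
have /asboolP := valP X; have /asboolP := valP Y.
move: (val X) (val Y) => x y Hy; move: x; apply: lspan_ind => [|a x x' [p p0 px] _ IH].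
  by rewrite !(lin_map0 (ad_linl _), lin_map0 D_lin) addr0.
rewrite D_lin !(br_linl A) D_lin IH.
suff -> : D (br A x y) = br A (D x) y + br A x (D y) by rewrite scalerDr; zmod.
move: y Hy {IH}; apply: lspan_ind => [|b y y' [q q0 qy] _ IH].
  by rewrite !(lin_map0 (ad_linr _), lin_map0 D_lin) addr0.
rewrite D_lin !(br_linr A) D_lin IH (D_br p0 q0 px qy).
by rewrite scalerDr; zmod.
Qed.

Lemma J_property_of_derivation : J_property G.
Proof.
have [neg0 _ _ iota_lin _ iota_br iota_neg iota_J prolong] := hG.
have [|A0 [[_ A0E] _]] := prolong 0 (iota \o Dm) (lexx 0).
  split=> [a X Y|q X qX|X Y|_ X X1] /=.
  - by rewrite Dm_lin iota_lin.
  - rewrite addr0; have [q0|q0] := leP 0 q.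
      have -> : X = 0 by exact: (neg0 q q0 X qX).
      by rewrite (lin_map0 Dm_lin) (lin_map0 iota_lin); exact: homog0.
    by rewrite iota_neg //; exists (Dm X) => //; exact: D_degree.
  - by rewrite -!iota_br -(lin_mapD iota_lin) -Dm_br.
  - by rewrite !DmJ ?iota_J //; exact: (cr_stable (cr_axioms (negative_part A))).
exists A0 => x; rewrite iota_neg // => -[X X1 <-].
by rewrite A0E /= DmJ // -iota_J.
Qed.

End Prolongation.

(** * The derivation of [s + l] extending [J] *)

Section Assembly.
Variables (R : rcfType) (s l : vectType R) (S : cr_algebra s) (L : cr_module S l).
Hypothesis nondeg : forall x, (forall y, killing S x y = 0) -> x = 0.
Hypothesis tr : transitive_algebra S.
Hypothesis fund : fundamental_algebra (cr_extension L).
Local Notation J := (cr_J S).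
Local Notation JL := (cm_J L).

Let J_cr : is_cr S J := cr_axioms S.
Let L_cr := cm_axioms L.
Let Sfund : fundamental_algebra S := fundamental_ext_algebra fund.
Let Lfund : fundamental_module L := fundamental_ext_module Sfund fund.

Let inr p (y : l) : gr L p y -> gr (extension L) p (0, y).
Proof. by move=> yp; split=> //; exact: homog0. Qed.

Let inl p (x : s) : gr S p x -> gr (extension L) p (x, 0).
Proof. by move=> xp; split=> //; exact: homog0. Qed.

Lemma module_J_stable y : gr L (-1) y -> gr L (-1) (JL y).
Proof. by move=> /inr/(cr_stable L_cr)[]. Qed.

Lemma module_J_lin a y z : gr L (-1) y -> gr L (-1) z -> JL (a *: y + z) = a *: JL y + JL z.
Proof. by move=> /inr y1 /inr z1; have /(congr1 snd) := cr_lin L_cr a y1 z1. Qed.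

Let JL0 : JL 0 = 0.
Proof.
have := module_J_lin 1 (homog0 L (-1)) (homog0 L (-1)); rewrite !scale1r addr0 => /eqP.
by rewrite -subr_eq0 opprD addNKr oppr_eq0 => /eqP.
Qed.

Lemma module_J_sqr y : gr L (-1) y -> JL (JL y) = - y.
Proof. by move=> /inr y1; have /(congr1 snd) := cr_sqr L_cr y1. Qed.

Lemma module_J_comm b y : gr S 0 b -> gr L (-1) y -> act L b (JL y) = JL (act L b y).
Proof.
move=> /inl b0 /inr y1; have /(congr1 snd) := cr_comm L_cr b0 y1.
by rewrite /= !(lin_map0 (act_lin L _)) !subr0.
Qed.

Lemma module_J_act x y : gr S (-1) x -> gr L (-1) y -> act L x (JL y) = - act L (J x) y.
Proof.
move=> x1 y1; have /(congr1 snd) := cr_br L_cr (inl x1) (inr (module_J_stable y1)).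
rewrite /= (cr_J0 J_cr) JL0 !(lin_map0 (act_lin L _)) !subr0 module_J_sqr // => <-.
by rewrite (lin_mapN (act_lin L _)).
Qed.

(** Elements of [l_0] have degree 0 in [s + l], so bracketing with them commutes with [J]. *)
Lemma module_J_act0 x y : gr S (-1) x -> gr L 0 y -> JL (act L x y) = act L (J x) y.
Proof.
move=> x1 y0; have /(congr1 snd) := cr_comm L_cr (inr y0) (inl x1).
rewrite /= !(lin_map0 (actl_lin L _)) !sub0r => H.
have xy1 : gr L (-1) (act L x y) by have := gm_act x1 y0; rewrite addr0.
apply/eqP; rewrite -eqr_opp H; apply/eqP.
have := module_J_lin (-1) xy1 (homog0 L (-1)); by rewrite JL0 !addr0 !scaleN1r.
Qed.

Lemma levi_tanaka_J_property (g : lmodType R) (G : cr_algebra g)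
    (iota : neg_part (cr_extension L) -> g) :
  is_levi_tanaka_extension G iota -> J_property G.
Proof.
have [d dP] := exists_dual_J nondeg J_cr.
have d_stable a (a1 : gr S 1 a) : gr S 1 (d a) := proj1 (dP a a1).
have d_br := dual_J_br nondeg J_cr dP.
have J_raise := J_raise nondeg J_cr dP module_J_stable module_J_lin module_J_sqr
  module_J_comm module_J_act module_J_act0.
have [D [D_lin D_deg DJ D_act]] := extension_of_J (cr_stable J_cr) (cr_comm J_cr) d_stable d_br
  module_J_stable module_J_lin module_J_comm module_J_act module_J_act0 J_raise Lfund
  (singular_eq0 nondeg tr Sfund Lfund).
have J_ad x y : gr S (-1) x -> gr S (-1) y -> br S x (J y) = - br S (J x) y.
  move=> x1 y1; rewrite -(cr_br J_cr x1 (cr_stable J_cr y1)) (cr_sqr J_cr y1).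
  by rewrite (lin_mapN (lie_linr S _)).
have J_ad0 x y : gr S (-1) x -> gr S 0 y -> J (br S x y) = br S (J x) y.
  move=> x1 y0; have yx1 : gr S (-1) (br S y x) by have := gl_br y0 x1; rewrite add0r.
  by rewrite lie_anti (cr_JN J_cr yx1) -(cr_comm J_cr y0 x1) lie_anti opprK.
have d_ad a y : gr S 1 a -> gr S (-1) y -> br S a (J y) = - br S (d a) y.
  by move=> a1 y1; rewrite d_br // opprK.
(* The same construction for the adjoint module, where the relation with [s_1] in degree [-1] is
   [dual_J_br]. *)
have [Ds [Ds_lin Ds_deg DsJ Ds_br]] := @extension_of_J _ _ _ _ (adjoint S) _ _ _
  (cr_stable J_cr) (cr_comm J_cr) d_stable d_br (cr_stable J_cr) (cr_lin J_cr) (cr_comm J_cr)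
  J_ad J_ad0 d_ad Sfund (singular_adjoint0 nondeg tr).
move=> hG; apply: (J_property_of_derivation hG (D := fun z => (Ds z.1, D z.2))).
- by move=> a x y; apply: pairP; [exact: Ds_lin|exact: D_lin].
- by move=> p x [x1 x2]; split; [exact: Ds_deg|exact: D_deg].
- by move=> x [x1 x2]; apply: pairP; [exact: DsJ|exact: DJ].
move=> p q x y p0 q0 [x1 x2] [y1 y2]; apply: pairP => /=.
  exact: (@derivation_negative _ _ _ _ (adjoint S) Sfund J Ds Ds Ds_lin DsJ Ds_br Ds_lin Ds_br p q x.1 y.1).
have der := derivation_negative Sfund Ds_lin DsJ Ds_br D_lin D_act.
rewrite (lin_mapB D_lin) (der _ _ _ _ p0 q0 x1 y2) (der _ _ _ _ q0 p0 y1 x2).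
by zmod.

Qed.

End Assembly.

Theorem theorem3p11 (R : realType) (s l : vectType R)
  (S : cr_algebra s) (L : cr_module S l)
  (hs_transitive : transitive_algebra S)
  (hs_semisimple : semisimple S)
  (hl_nondegenerate : nondegenerate_module L)
  (hl_transitive : transitive_module L)
  (hdefined : levi_tanaka_extension_defined L)
  (g : lmodType R) (G : cr_algebra g) (iota : neg_part (cr_extension L) -> g)
  (hG : is_levi_tanaka_extension G iota) :
  J_property G.
Proof.
have nondeg := semisimple_killing_nondeg (real_complex R) hs_semisimple.
have [_ _ fund _] := hdefined.
exact: levi_tanaka_J_property nondeg hs_transitive fund _ _ _ hG.
Qed.
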